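(* Let $(\mu_n)_{n\ge1}$ be a sequence of rotationally invariant probability measures on $\mathbb{C}$, and for each $n$ let $z_1,\dots,z_n$ be the points of the symmetric polynomial projection (SPP) process defined by $(\mu_n,n)$. Put $M(n,k)=\int_{\mathbb{C}}|z|^k\,d\mu_n(z)$ and assume that for all integers $m$ $$\frac{M(n,2n+2m)}{M(n,2n)}\to1\qquad\text{as }n\to\infty .$$ Then, for $f$ any polynomial in $z$ (with complex coefficients), $$\sum_{k=1}^n\left(f(z_k)-\mathbf{E}f(z_k)\right)\ \Rightarrow\ \mathcal{N}_{\mathbb{C}}\Bigl(0,\frac1\pi\|f'\|_{L^2(\mathbb{U})}^2\Bigr)$$ in distribution as $n\to\infty$.
   Context: An SPP process defined by a pair $(\mu,n)$, where $\mu$ is a rotationally invariant probability measure on $\mathbb{C}$ (with the relevant moments finite) and $n\ge1$ is an integer, is the random collection of $n$ points in $\mathbb{C}$ forming the determinantal process whose joint intensities with respect to $\mu^{k}$ are $p(z_1,\dots,z_k)=\det\left(K(z_i,z_j)\right)_{1\le i,j\le k}$, where $K$ is the integral kernel of the orthogonal projection in $L^2(\mathbb{C},\mu)$ onto the subspace of polynomials in $z$ of degree less than $n$. (It suffices to require this for $k=n$.) $\mathbb{U}=\{|z|<1\}$, and $\|f'\|_{L^2(\mathbb{U})}^2=\int_{\mathbb{U}}|f'(z)|^2\,d^2z$ with $d^2z$ Lebesgue measure. $\mathcal{N}_{\mathbb{C}}(0,\sigma^2)$ is the law of a mean-zero (rotation invariant) complex Gaussian $Z$ with $\mathbf{E}|Z|^2=\sigma^2$.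 For negative $m$, the limit is over $n$ with $n+m\ge0$. *)

(* Defs.v *)
From HB Require Import structures.
From mathcomp Require Import all_boot all_order all_algebra complex.
From mathcomp Require Import all_classical all_reals all_analysis.
From mathcomp Require Import measurable_realfun.

Set Implicit Arguments.
Unset Strict Implicit.
Unset Printing Implicit Defensive.

Import Order.TTheory GRing.Theory Num.Theory.
Import numFieldNormedType.Exports.

Local Open Scope classical_set_scope.
Local Open Scope ring_scope.
Local Open Scope complex_scope.

(** ℂ as a measurable and topological space is the product of two copies of the
    real line (so it carries the Borel sets and the topology of ℝ²), whereas
    the algebra of ℂ is that of [R[i]]; [toC] and [ofC] are the inverse
    identifications of the two. *)
Notation plane R := (measurableTypeR R * measurableTypeR R)%type.

Definition toC (R : realType) (p : plane R) : R[i] := p.1 +i* p.2.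

Definition ofC (R : realType) (z : R[i]) : plane R :=
  (complex.Re z, complex.Im z).

(** The modulus as a real number (the norm of [R[i]] takes its values in
    [R[i]]). *)
Definition cmod (R : realType) (z : R[i]) : R :=
  Num.sqrt (complex.Re z ^+ 2 + complex.Im z ^+ 2).

Definition cint (d : measure_display) (T : measurableType d) (R : realType)
    (mu : {measure set T -> \bar R}) (h : T -> R[i]) : R[i] :=
  Rintegral mu setT (fun x => complex.Re (h x)) +i*
  Rintegral mu setT (fun x => complex.Im (h x)).

Definition square_integrable (R : realType)
    (mu : {measure set (plane R) -> \bar R}) (g : plane R -> R[i]) : Prop :=
  [/\ measurable_fun setT (fun z => complex.Re (g z)),
      measurable_fun setT (fun z => complex.Im (g z)) &
      (\int[mu]_z (cmod (g z) ^+ 2)%:E < +oo)%E].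

Definition rotation_invariant (R : realType)
    (mu : {measure set (plane R) -> \bar R}) : Prop :=
  forall u : R[i], cmod u = 1 ->
  forall A : set (plane R), measurable A ->
    mu ((fun z => ofC (u * toC z)) @^-1` A) = mu A.

Definition moment (R : realType) (mu : {measure set (plane R) -> \bar R})
    (k : nat) : \bar R :=
  (\int[mu]_z (cmod (toC z) ^+ k)%:E)%E.

(** M(2n + 2m) / M(2n), meant for n + m >= 0; limits as n -> oo do not see the
    junk value taken otherwise.  An infinite moment, or M(2n) = 0, makes the
    ratio 0 ([fine +oo = 0]), so convergence of the ratio to 1 entails that
    both moments are eventually finite and positive. *)
Definition moment_ratio (R : realType)
    (mu : {measure set (plane R) -> \bar R}) (n : nat) (m : int) : R :=
  fine (moment mu `|(2 * n%:Z + 2 * m)%R|%N) / fine (moment mu (2 * n)%N).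

(** [K] is the integral kernel of the orthogonal projection of L²(ℂ, mu) onto
    the space V of polynomials of degree less than [n] ([size p <= n]).  Since
    joint intensities evaluate [K] on the diagonal, the almost-everywhere class
    of [K] does not suffice: the first two conditions select the usual
    representative, whose sections K(·, w) and conj K(z, ·) belong to V.  In the
    third one, [p] is the projection of [g]: it is in V, and [g - p] is
    orthogonal to V. *)
Definition is_projection_kernel (R : realType)
    (mu : {measure set (plane R) -> \bar R}) (n : nat)
    (K : R[i] -> R[i] -> R[i]) : Prop :=
  [/\ forall w, exists2 p : {poly R[i]},
        (size p <= n)%N & forall z, K z w = p.[z],
      forall z, exists2 q : {poly R[i]},
        (size q <= n)%N & forall w, conjc (K z w) = q.[w] &
      forall g : plane R -> R[i], square_integrable mu g ->
        exists p : {poly R[i]},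
        [/\ (size p <= n)%N,
            forall z : R[i], cint mu (fun w => K z (toC w) * g w) = p.[z] &
            forall q : {poly R[i]}, (size q <= n)%N ->
              cint mu (fun z => (g z - p.[toC z]) * conjc q.[toC z]) = 0]].

(** ∫ F(z_1, ..., z_k) dmu(z_1) ... dmu(z_k); on nonnegative measurable [F] this
    is the integral with respect to the k-fold product measure. *)
Fixpoint power_integral (d : measure_display) (T : measurableType d)
    (R : realType) (mu : {measure set T -> \bar R}) (k : nat) :
    (k.-tuple T -> \bar R) -> \bar R :=
  match k with
  | 0 => fun F => F [tuple]
  | k'.+1 => fun F =>
      (\int[mu]_z power_integral mu (fun t => F (cons_tuple z t)))%E
  end.

(** The unordered points [Z 0], ..., [Z n.-1] (labelled arbitrarily) have joint
    intensities det (K(z_i, z_j)) with respect to the powers of [mu]: for each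
    [k], integrating a test function [h] against the intensity gives the
    expectation of the sum of [h] over all [k]-tuples of points with distinct
    labels.  The determinants are real and nonnegative, [K] being the kernel of a
    projection. *)
Definition has_determinantal_intensities (R : realType)
    (mu : {measure set (plane R) -> \bar R}) (K : R[i] -> R[i] -> R[i])
    (d : measure_display) (T : measurableType d) (P : probability T R)
    (n : nat) (Z : 'I_n -> {RV P >-> plane R}) : Prop :=
  forall (k : nat) (h : k.-tuple (plane R) -> \bar R),
    measurable_fun setT h -> (forall t, 0 <= h t)%E ->
    (\int[P]_w \sum_(s : {ffun 'I_k -> 'I_n} | injectiveb s)
       h [tuple Z (s j) w | j < k])%E =
    power_integral mu (fun t => h t *
      (complex.Re (\det (\matrix_(i < k, j < k)
         K (toC (tnth t i)) (toC (tnth t j)))))%:E)%E.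

(** The first condition says that the polynomials of degree less than [n] do
    lie in L²(ℂ, mu). *)
Definition is_SPP (R : realType) (mu : {measure set (plane R) -> \bar R})
    (n : nat) (d : measure_display) (T : measurableType d)
    (P : probability T R) (Z : 'I_n -> {RV P >-> plane R}) : Prop :=
  (forall p : {poly R[i]}, (size p <= n)%N ->
     square_integrable mu (fun z => p.[toC z])) /\
  exists K : R[i] -> R[i] -> R[i],
    is_projection_kernel mu n K /\ has_determinantal_intensities mu K Z.

(** Convergence in distribution to [nu] of random points of the plane, possibly
    defined on different probability spaces. *)
Definition converges_in_distribution (R : realType)
    (d : nat -> measure_display) (T : forall n, measurableType (d n))
    (P : forall n, probability (T n) R) (X : forall n, T n -> plane R)
    (nu : probability (plane R) R) : Prop :=
  forall g : plane R -> R, continuous g ->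
    (exists M : R, forall z, `|g z| <= M) ->
    ('E_(P n)[fun w => g (X n w)])%E @[n --> \oo] --> (\int[nu]_z (g z)%:E)%E.

Definition scale_plane (R : realType) (a : R) (p : plane R) : plane R :=
  (a * p.1, a * p.2).

Lemma measurable_scale_plane (R : realType) (a : R) :
  measurable_fun setT (@scale_plane R a).
Proof.
by apply/measurable_fun_pairP; split; apply: measurable_funM.
Qed.

HB.instance Definition _ (R : realType) (a : R) :=
  isMeasurableFun.Build _ _ (plane R) (plane R) (@scale_plane R a)
    (@measurable_scale_plane R a).

Definition std_normal (R : realType) : probability (measurableTypeR R) R :=
  normal_prob 0 1.

(** N_ℂ(0, s2): the law of √(s2/2) (X + iY), for X and Y independent standard
    real Gaussians.  It is the Dirac mass at 0 when s2 = 0; rescaling standard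
    Gaussians avoids [normal_prob 0 0], which is not a Dirac mass. *)
Definition complex_gaussian (R : realType) (s2 : R) :
    probability (plane R) R :=
  distribution (@std_normal R \x @std_normal R)%E
    (@scale_plane R (Num.sqrt (s2 / 2))).

(** ∫ |g|² d²z over the open unit disc. *)
Definition disc_norm2 (R : realType) (g : R[i] -> R[i]) : R :=
  fine (\int[(@lebesgue_measure R \x @lebesgue_measure R)%E]_(z in
          [set z : plane R | (cmod (toC z) < 1)%R]) (cmod (g (toC z)) ^+ 2)%:E)%E.

(* Main.v *)
Require Import Defs.
From mathcomp Require Import all_boot all_order all_algebra all_fingroup complex.
From mathcomp Require Import all_classical all_reals all_analysis.
From mathcomp Require Import measurable_realfun zify ring lra.

Set Implicit Arguments.
Unset Strict Implicit.
Unset Printing Implicit Defensive.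

Import Order.TTheory GRing.Theory Num.Theory.
Import numFieldNormedType.Exports.

Local Open Scope classical_set_scope.
Local Open Scope ring_scope.
Local Open Scope complex_scope.

(** Write X for the centered statistic, which for large n is the sum
    of c_k z_i^(k+1) over the points z_i and the degrees k, with c_k the coefficient
    of f at z^(k+1).  The joint density of the points is a constant times the squared
    modulus of the Slater determinant det(z_i^j), so E(X^a conj(X)^b) is an inner
    product of X^a det and X^b det.  Multiplying a Slater determinant by X raises
    exponents (an operator A); its adjoint B lowers them.  On antisymmetric
    states whose low levels are all occupied, AB - BA is the scalar
    s = sum_k (k+1) |c_k|^2, and lowering the ground state gives zero, so if all
    the moments involved were equal one would get E(X^a conj(X)^b) = [a = b] a! s^a.
    The assumption on the moments says that the weights of the finitely many
    displaced levels tend to 1.  Hence the mixed moments of X converge to those of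
    the complex Gaussian, the Taylor expansion of cos then gives convergence of
    E cos(theta + p Re X + q Im X), and approximating a bounded continuous function
    by trigonometric polynomials in the plane gives convergence in distribution.
    Finally s is the Dirichlet integral of f over the disc divided by pi: the
    integrals of z^a conj(z)^b over the disc come from the divergence theorem
    applied to (1 - |z|^2) z^a conj(z)^b, which vanishes on the circle. *)

(** * Raising and lowering operators *)

(** Two obstacles stand between the algebra and a limit: the commutator is scalar only on vectors
    whose lowest [d] levels are occupied, and the error terms are sums over n particles. One
    combinatorial fact settles both. Starting from the filled levels 0, ..., n-1, raisings of total
    degree at most D that keep the exponents distinct leave every level below n - D in place. Hence
    the commutator applies as soon as n exceeds a constant, and at most D particles contribute at
    each raising, so the error bounds do not grow with n. For the same reason the ratios of weights
    involve only moments of |z|^(2j) with |j - n| <= D, which is what the hypothesis controls. The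
    intensities are tested on nonnegative functions only; mixed moments are therefore obtained by
    polarisation from expectations of squared moduli. Tightness is built into the trigonometric
    approximation: its error is eta (1 + |z|^2), and the second moments are known to converge. *)

Definition addat n (e : {ffun 'I_n -> nat}) (j : 'I_n) (k : nat) :=
  [ffun i => (e i + (i == j) * k)%N].
Definition subat n (e : {ffun 'I_n -> nat}) (j : 'I_n) (k : nat) :=
  [ffun i => (e i - (i == j) * k)%N].
Definition permexp n (e : {ffun 'I_n -> nat}) (s : 'S_n) := [ffun i => e (s i)].

(* A state [Psi] gives an amplitude to each exponent vector.  On Slater
   determinants, [raise] is multiplication by the power sum with coefficients [c]
   (lemma [raise_slater]); [lower] is its transpose for [overlap]. *)
Definition raise n (F : numFieldType) (d : nat) (c : nat -> F)
    (Psi : {ffun 'I_n -> nat} -> F) (e : {ffun 'I_n -> nat}) : F :=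
  \sum_(j < n) \sum_(k < d) c k * Psi (addat e j k.+1).
Definition lower n (F : numFieldType) (d : nat) (c : nat -> F)
    (Psi : {ffun 'I_n -> nat} -> F) (e : {ffun 'I_n -> nat}) : F :=
  \sum_(j < n) \sum_(k < d)
    c k * (if (k < e j)%N then Psi (subat e j k.+1) else 0).

Definition alternating n (F : numFieldType) (Psi : {ffun 'I_n -> nat} -> F) :=
  forall e i j, i != j -> Psi (permexp e (tperm i j)) = - Psi e.

Section Alternating.
Variables (n : nat) (F : numFieldType).
Implicit Types (e : {ffun 'I_n -> nat}) (Psi : {ffun 'I_n -> nat} -> F).

Lemma addat_perm e (s : 'S_n) j k :
  addat (permexp e s) j k = permexp (addat e (s j) k) s.
Proof. by apply/ffunP => i; rewrite !ffunE (inj_eq perm_inj). Qed.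

Lemma subat_perm e (s : 'S_n) j k :
  subat (permexp e s) j k = permexp (subat e (s j) k) s.
Proof. by apply/ffunP => i; rewrite !ffunE (inj_eq perm_inj). Qed.

(** Pauli exclusion: the transposition fixes [e], so the amplitude equals its own opposite. *)
Lemma alternating_vanish Psi e i j : alternating Psi -> i != j ->
  e i = e j -> Psi e = 0.
Proof.
move=> aP ij eij.
have: Psi (permexp e (tperm i j)) = - Psi e by exact: aP.
have -> : permexp e (tperm i j) = e.
  by apply/ffunP => k; rewrite ffunE; case: tpermP => // ->.
by move/eqP; rewrite -addr_eq0 -mulr2n mulrn_eq0 => /eqP.
Qed.

Lemma alternating_noninj Psi e : alternating Psi -> ~~ injectiveb e -> Psi e = 0.
Proof.
move=> aP /injectivePn [i [j ij eij]].
exact: (alternating_vanish aP ij eij).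
Qed.

Lemma alternating_raise d c Psi : alternating Psi -> alternating (raise d c Psi).
Proof.
move=> aP e i j ij; rewrite /raise [X in _ = - X](reindex_inj (@perm_inj _ (tperm i j))).
rewrite -sumrN; apply: eq_bigr => m _; rewrite -sumrN; apply: eq_bigr => k _.
by rewrite addat_perm aP // mulrN.
Qed.

Lemma alternating_lower d c Psi : alternating Psi -> alternating (lower d c Psi).
Proof.
move=> aP e i j ij; rewrite /lower [X in _ = - X](reindex_inj (@perm_inj _ (tperm i j))).
rewrite -sumrN; apply: eq_bigr => m _; rewrite -sumrN; apply: eq_bigr => k _.
by rewrite subat_perm aP // ffunE -mulrN; case: ifP => // _; rewrite oppr0.
Qed.

Lemma alternating_iter_raise d c Psi a :
  alternating Psi -> alternating (iter a (raise d c) Psi).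
Proof. by move=> aP; elim: a => //= a IH; apply: alternating_raise. Qed.

Lemma alternating_iter_lower d c Psi a :
  alternating Psi -> alternating (iter a (lower d c) Psi).
Proof. by move=> aP; elim: a => //= a IH; apply: alternating_lower. Qed.

Definition ground : {ffun 'I_n -> nat} := [ffun i : 'I_n => nat_of_ord i].

(* The exponent vectors obtained from [ground] by raisings of total degree at
   most [D]. *)
Definition above (D : nat) e :=
  [forall i : 'I_n, i <= e i]%N && (\sum_(i < n) (e i - i) <= D)%N.

Lemma above_ground D : above D ground.
Proof.
apply/andP; split; first by apply/forallP => i; rewrite ffunE.
by rewrite big1 // => i _; rewrite ffunE subnn.
Qed.

Lemma above_addat D e j k : above D e -> above (D + k) (addat e j k).
Proof.
move=> /andP[/forallP ge D_ge]; apply/andP; split.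
  by apply/forallP => i; rewrite ffunE (leq_trans (ge i)) ?leq_addr.
have -> : (\sum_(i < n) (addat e j k i - i) =
           \sum_(i < n) (e i - i) + \sum_(i < n) (i == j) * k)%N.
  by rewrite -big_split /=; apply: eq_bigr => i _; rewrite ffunE addnBAC.
have -> : (\sum_(i < n) (i == j) * k = k)%N.
  by rewrite (bigD1 j) //= big1 => [|i /negPf-> //]; rewrite eqxx mul1n addn0.
by rewrite leq_add2r.
Qed.

Lemma above_le D D' e : (D <= D')%N -> above D e -> above D' e.
Proof. by move=> DD' /andP[ge le]; rewrite /above ge (leq_trans le). Qed.

(* A displaced particle lands on a free site or pushes out its occupant: a
   chain of displacements leads from [i] to some site [>= n]. *)
Lemma injective_displacement e : (forall i : 'I_n, (i <= e i)%N) -> injective e ->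
  forall i : 'I_n, (e i != i)%N -> (n - i <= \sum_(j < n | i <= j) (e j - j))%N.
Proof.
move=> ge inj i; move: {2}(n - i)%N (leqnn (n - i)) => m.
elim: m i => [|m IH] i nim ei; first by have := ltn_ord i; lia.
have [nei|nei] := leqP n (e i).
  by rewrite (bigD1 i) //=; have := ltn_ord i; lia.
pose j := Ordinal nei.
have ij : (i < j)%N by rewrite /= ltn_neqAle eq_sym ei ge.
(* The occupant of level [e i] is displaced too: staying put, it would share its level with [i]. *)
have ej : e j != j.
  apply/eqP => h; have : j = i by apply: inj.
  by move=> h'; move: ij; rewrite h' ltnn.
have nj : (n - j <= m)%N by lia.
have le2 := IH j nj ej.
(* By induction the indices from [e i] on account for [n - e i]; the index [i] lies below them and
   adds [e i - i]. *)
rewrite (bigD1 i) //=.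
have : (\sum_(j0 < n | (e i <= j0)%N) (e j0 - j0) <=
        \sum_(j0 < n | (i <= j0)%N && (j0 != i)) (e j0 - j0))%N.
  rewrite [X in (_ <= X)%N]big_mkcond [X in (X <= _)%N]big_mkcond.
  apply: leq_sum => j0 _; case: ifP => // h1; rewrite ifT //.
  rewrite /= in ij; apply/andP; split; first by lia.
  by apply/eqP => h; move: h1; rewrite h; lia.
move=> le1; have le3 := leq_trans le2 le1; rewrite /= in ij le3.
by rewrite -(leq_add2l (e i - i)) in le3; apply: leq_trans le3; lia.
Qed.

(** A displacement at [i] would force a total displacement of at least [n - i], which is more than
    [D]. *)
Lemma above_fixed D e (i : 'I_n) : above D e -> injectiveb e -> (i + D < n)%N -> e i = i.
Proof.
move=> /andP[/forallP ge le] /injectiveP inj iD; apply/eqP/negPn/negP => ei.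
have := injective_displacement ge inj ei.
have : (\sum_(j < n | (i <= j)%N) (e j - j) <= \sum_(j < n) (e j - j))%N.
  by rewrite [X in (X <= _)%N]big_mkcond; apply: leq_sum => j _; case: ifP.
by have := ltn_ord i; lia.
Qed.

Lemma above_bound D e i : above D e -> (e i <= n + D)%N.
Proof.
move=> /andP[/forallP ge le].
have : (e i - i <= D)%N by apply: leq_trans le; rewrite (bigD1 i) //= leq_addr.
by have := ltn_ord i; lia.
Qed.

End Alternating.

(** * The commutation relation *)

Section Commutation.
Variables (n : nat) (F : numFieldType).
Implicit Types (e : {ffun 'I_n -> nat}) (Psi : {ffun 'I_n -> nat} -> F).

(** Supplies the factor [k.+1] of the commutator: when the low levels are occupied once each, [k.+1]
    particles sit at levels at most [k]. *)
Lemma card_lt_injective e m : injectiveb e ->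
  (forall v, (v < m)%N -> exists i, e i = v) -> #|[pred i | (e i < m)%N]| = m.
Proof.
move=> /injectiveP inj surj; rewrite cardE -(size_map e) -[RHS](size_iota 0).
apply/perm_size/uniq_perm; rewrite ?iota_uniq ?map_inj_uniq ?enum_uniq //.
move=> v; rewrite mem_iota /= add0n; apply/mapP/idP => [[i + ->]|vm].
  by rewrite mem_enum.
by have [i ei] := surj v vm; exists i; rewrite // mem_enum inE ei.
Qed.

(** The two orders can differ only when both shifts act on the same particle. For different shifts,
    either both orders read the same vector, or the term without counterpart reads a vector with a
    doubly occupied level. For equal shifts, adding first always gives back [e], while removing
    first requires [k < e i]; the difference counts the particles at levels at most [k]. *)
Lemma commutator_term Psi e k l m : alternating Psi -> injectiveb e ->
  (k < m)%N -> (l < m)%N -> (forall v, (v < m)%N -> exists i, e i = v) ->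
  \sum_(i < n) \sum_(j < n) (if (l < addat e i k.+1 j)%N
     then Psi (subat (addat e i k.+1) j l.+1) else 0) =
  \sum_(i < n) \sum_(j < n) (if (l < e j)%N
     then Psi (addat (subat e j l.+1) i k.+1) else 0) +
  (k == l)%:R * k.+1%:R * Psi e.
Proof.
move=> aP inj km lm surj; apply/eqP; rewrite addrC -subr_eq; apply/eqP.
rewrite -sumrB; under eq_bigr => i _.
  rewrite -sumrB (bigD1 i) //= big1 ?addr0 => [|j ji]; last first.
    rewrite ffunE (negPf ji) mul0n addn0; case: ifP => lj; last by rewrite subrr.
    apply/eqP; rewrite subr_eq0; apply/eqP; congr Psi; apply/ffunP => x.
    by rewrite !ffunE; case: eqP => [->|]; case: eqP => // h; rewrite ?h ?mul0n ?subn0 ?addn0 //;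
       move: ji; rewrite h eqxx.
  rewrite ffunE eqxx mul1n.
  over.
rewrite /=; case: (eqVneq k l) => [<-|kl]; last first.
  rewrite !mul0r; apply: big1 => i _.
  case: ifP => h1; case: ifP => h2; last by rewrite subrr.
  - apply/eqP; rewrite subr_eq0; apply/eqP; congr Psi; apply/ffunP => x.
    by rewrite !ffunE; case: eqP => [->|_]; rewrite ?mul1n ?mul0n ?addn0 ?subn0 //; lia.
  (* Here [e i <= l], so the new level [e i + k - l] is at most [k]: it is occupied, and by another
     particle because [k] differs from [l]. *)
  - rewrite subr0; have [|i' ei'] := surj (e i + k - l)%N; first lia.
    have ii' : i != i' by apply/eqP => h; move: ei'; rewrite -h; lia.
    apply: (alternating_vanish aP ii'); rewrite !ffunE eqxx eq_sym (negPf ii').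
    by rewrite mul1n mul0n addn0 subn0 ei'; lia.
  - lia.
rewrite mul1r (eq_bigr (fun i => (e i <= k)%N%:R * Psi e)) => [|i _].
  rewrite -mulr_suml -natr_sum -(card_lt_injective inj (m := k.+1)); last first.
    by move=> v vk; apply: surj; lia.
  congr (_%:R * _); rewrite -sum1_card [RHS]big_mkcond /=.
  by apply: eq_bigr => i _; rewrite inE ltnS; case: leqP.
case: ifP => h1; last lia.
have -> : subat (addat e i k.+1) i k.+1 = e.
  by apply/ffunP => x; rewrite !ffunE addnK.
case: ifP => h2; last by rewrite subr0 leqNgt h2 mul1r.
have -> : addat (subat e i k.+1) i k.+1 = e.
  by apply/ffunP => x; rewrite !ffunE; case: eqP => [->|_]; rewrite ?mul1n ?mul0n ?addn0 ?subn0 // subnK.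
by rewrite subrr leqNgt h2 mul0r.
Qed.

Lemma raise_lower d c c' Psi e : alternating Psi -> injectiveb e ->
  (forall v, (v < d)%N -> exists i, e i = v) ->
  raise d c (lower d c' Psi) e = lower d c' (raise d c Psi) e +
    (\sum_(k < d) k.+1%:R * (c k * c' k)) * Psi e.
Proof.
move=> aP inj surj; rewrite /raise /lower.
pose T1 i j k l := (if (l < addat e i k.+1 j)%N
     then Psi (subat (addat e i k.+1) j l.+1) else 0).
pose T2 i j k l := (if (l < e j)%N
     then Psi (addat (subat e j l.+1) i k.+1) else 0).
transitivity (\sum_(k < d) \sum_(l < d) c k * c' l * \sum_i \sum_j T1 i j k l).
  rewrite exchange_big; apply: eq_bigr => k _ /=.
  under [RHS]eq_bigr => l _ do rewrite mulr_sumr.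
  rewrite [RHS]exchange_big /=; apply: eq_bigr => i _.
  under [RHS]eq_bigr => l _ do rewrite mulr_sumr.
  rewrite [RHS]exchange_big mulr_sumr /=; apply: eq_bigr => j _.
  by rewrite mulr_sumr; apply: eq_bigr => l _; rewrite mulrA.
transitivity (\sum_(k < d) \sum_(l < d) c k * c' l *
    (\sum_i \sum_j T2 i j k l + (k == l :> nat)%:R * k.+1%:R * Psi e)).
  apply: eq_bigr => k _; apply: eq_bigr => l _; congr (_ * _).
  by apply: (@commutator_term Psi e k l d).
under eq_bigr => k _ do under eq_bigr => l _ do rewrite mulrDr.
under eq_bigr => k _ do rewrite big_split /=.
rewrite big_split /=; congr (_ + _).
  rewrite exchange_big /= [RHS]exchange_big /=; apply: eq_bigr => l _.
  under eq_bigr => k _ do rewrite exchange_big /= mulr_sumr.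
  rewrite exchange_big /=; apply: eq_bigr => j _.
  under eq_bigr => k _ do rewrite mulr_sumr.
  rewrite exchange_big /= /T2; case: ifP => _; last first.
    by rewrite mulr0 big1 // => i _; rewrite big1 // => k _; rewrite mulr0.
  rewrite mulr_sumr; apply: eq_bigr => i _; rewrite mulr_sumr.
  by apply: eq_bigr => k _; rewrite mulrCA mulrA.
rewrite mulr_suml; apply: eq_bigr => k _; rewrite (bigD1 k) //= eqxx big1.
  by rewrite addr0 mul1r mulrA; congr (_ * _); rewrite mulrC.
move=> l lk; have -> : (k == l :> nat) = false.
  by apply/eqP => h; move: lk => /eqP; apply; apply: val_inj.
by rewrite !mul0r mulr0.
Qed.

Lemma raiseD d c Psi Psi' (s : F) e :
  raise d c (fun e => Psi e + s * Psi' e) e = raise d c Psi e + s * raise d c Psi' e.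
Proof.
rewrite /raise mulr_sumr -big_split /=; apply: eq_bigr => j _.
rewrite mulr_sumr -big_split /=; apply: eq_bigr => k _.
by rewrite mulrDr mulrCA.
Qed.

Lemma eq_raise D d c Psi Psi' e :
  (forall e, above (D + d) e -> Psi e = Psi' e) -> above D e ->
  raise d c Psi e = raise d c Psi' e.
Proof.
move=> eqP aD; apply: eq_bigr => j _; apply: eq_bigr => k _; rewrite eqP //.
by apply: (@above_le _ (D + k.+1)); [rewrite leq_add2l|apply: above_addat].
Qed.

Lemma above_occupied D d e : above D e -> injectiveb e -> (D + d <= n)%N ->
  forall v, (v < d)%N -> exists i, e i = v.
Proof.
move=> aD inj Dd v vd; have vn : (v < n)%N by lia.
by exists (Ordinal vn); rewrite (above_fixed aD) //=; lia.
Qed.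

(** Each of the [a] raisings that the lowering crosses leaves one scalar commutator. The inner steps
    read vectors displaced by a further [d], hence the room [a.+1 * d]. For [a = 0] the value of
    [a.-1] is immaterial, its coefficient being 0. *)
Lemma iter_raise_lower d c c' Psi a D e : alternating Psi -> above D e ->
  (D + a.+1 * d <= n)%N ->
  iter a (raise d c) (lower d c' Psi) e = lower d c' (iter a (raise d c) Psi) e +
   a%:R * (\sum_(k < d) k.+1%:R * (c k * c' k)) * iter a.-1 (raise d c) Psi e.
Proof.
move=> aP; set s := \sum_(k < d) _.
elim: a D e => [|a IH] D e aD Dn; first by rewrite !mul0r addr0.
transitivity (raise d c (fun e => lower d c' (iter a (raise d c) Psi) e +
    (a%:R * s) * iter a.-1 (raise d c) Psi e) e).
  by apply: (eq_raise (D := D)) => // e' aD'; apply: (IH (D + d)%N) => //; lia.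
rewrite raiseD /=.
have -> : raise d c (lower d c' (iter a (raise d c) Psi)) e =
  lower d c' (raise d c (iter a (raise d c) Psi)) e + s * iter a (raise d c) Psi e.
  have aPa := alternating_iter_raise d c a aP.
  have [inj|ninj] := boolP (injectiveb e).
    apply: raise_lower => //; apply: (above_occupied aD inj).
    by apply: leq_trans Dn; rewrite leq_add2l leq_pmull.
  (* On a vector with a repeated exponent all three amplitudes vanish. *)
  rewrite !(alternating_noninj _ ninj) ?mulr0 ?addr0 //;
    by do ?[exact: aPa|apply: alternating_raise|apply: alternating_lower].
rewrite -addrA; congr (_ + _); case: a {IH Dn} => [|a] /=.
  by rewrite !mul0r addr0 mul1r.
by rewrite -mulrDl -[in RHS]addn1 natrD -[X in X + _]mul1r -mulrDl addrC.
Qed.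

(** Lowering a particle of the filled sea either drops below level 0 or lands on an occupied
    level. *)
Lemma lower_ground d c Psi : alternating Psi -> lower d c Psi (ground n) = 0.
Proof.
move=> aP; apply: big1 => j _; apply: big1 => k _; case: ifP => kj; last by rewrite mulr0.
rewrite ffunE in kj; have jn : (j - k.+1 < n)%N by have := ltn_ord j; lia.
rewrite (@alternating_vanish _ _ Psi _ j (Ordinal jn)) ?mulr0 //.
  by apply/eqP => h; have := congr1 val h => /=; lia.
rewrite !ffunE eqxx /= mul1n; case: eqP => [h|]; last lia.
by have := congr1 val h => /=; lia.
Qed.

Lemma iter_raise_lower_ground d c c' Psi a b :
  alternating Psi -> (a.+2 * d <= n)%N ->
  iter a.+1 (raise d c) (iter b.+1 (lower d c') Psi) (ground n) =
  a.+1%:R * (\sum_(k < d) k.+1%:R * (c k * c' k)) *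
    iter a (raise d c) (iter b (lower d c') Psi) (ground n).
Proof.
move=> aP an; have aPb := alternating_iter_lower d c' b aP.
rewrite [iter b.+1 _ _]/= (@iter_raise_lower _ _ _ _ a.+1 0) ?above_ground //.
by rewrite lower_ground ?add0r //; apply: alternating_iter_raise.
Qed.

End Commutation.

(** Inner product, up to normalisation, of two Slater determinants when all levels have equal
    weight: the sign of the permutation carrying one vector to the other, and 0 if there is none or
    if a level repeats. *)
Definition overlap n (F : numFieldType) (e e' : {ffun 'I_n -> nat}) : F :=
  \det (\matrix_(i < n, j < n) (e i == e' j)%:R).

(** * Adjointness of raising and lowering; pairings of the ground state *)

Section Overlap.
Variables (n : nat) (F : numFieldType).
Implicit Types (e : {ffun 'I_n -> nat}) (Psi : {ffun 'I_n -> nat} -> F).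
Local Notation overlap := (overlap F).

Lemma overlap_perml e e' (s : 'S_n) :
  overlap (permexp e s) e' = (-1) ^+ s * overlap e e'.
Proof.
rewrite /overlap -det_perm -det_mulmx -row_permE; congr (\det _).
by apply/matrixP => i j; rewrite !mxE ffunE.
Qed.

Lemma overlap_sym e e' : overlap e e' = overlap e' e.
Proof.
rewrite /overlap -det_tr; congr (\det _).
by apply/matrixP => i j; rewrite !mxE eq_sym.
Qed.

Lemma alternating_overlapl e' : alternating (overlap^~ e').
Proof. by move=> e i j ij; rewrite overlap_perml odd_tperm ij expr1 mulN1r. Qed.

Lemma alternating_overlapr e : alternating (overlap e).
Proof.
move=> e' i j ij; rewrite overlap_sym (alternating_overlapl e e' ij).
by rewrite overlap_sym.
Qed.

Lemma overlap_neq0 e e' : overlap e e' != 0 -> exists s, e = permexp e' s.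
Proof.
move=> h; suff [s /forallP hs] : exists s : 'S_n, [forall i, e i == e' (s i)].
  by exists s; apply/ffunP => i; rewrite ffunE; apply/eqP.
apply/existsP; move: h; apply: contraR => /existsPn h.
rewrite /overlap /determinant big1 // => s _.
have /forallPn [i /negPf ei] := h s.
by rewrite (bigD1 i) //= mxE ei mul0r mulr0.
Qed.

Lemma overlap_id e : injectiveb e -> overlap e e = 1.
Proof.
move=> /injectiveP inj; rewrite -[RHS](det1 F n); congr (\det _).
by apply/matrixP => i j; rewrite !mxE (inj_eq inj).
Qed.

Lemma overlap_norm_le1 e e' : `|overlap e e'| <= 1.
Proof.
have [->|h] := eqVneq (overlap e e') 0; first by rewrite normr0.
have [s es] := overlap_neq0 h; rewrite es overlap_perml normrM normr_sign mul1r.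
have [inj|ninj] := boolP (injectiveb e'); first by rewrite overlap_id // normr1.
by rewrite (alternating_noninj (@alternating_overlapl e') ninj) normr0.
Qed.

(** Term by term in the Leibniz expansions: raising the column matched with row [j], or lowering row
    [j], imposes the same equation between exponents. *)
Lemma raise_overlap d c e e' :
  raise d c (overlap e) e' = lower d c (overlap^~ e') e.
Proof.
rewrite /raise /lower exchange_big [RHS]exchange_big /=.
apply: eq_bigr => k _; rewrite -!mulr_sumr; congr (_ * _).
rewrite /overlap /determinant exchange_big /=.
(* The test [k < e j] is turned into a 0/1 factor, so that the sum over permutations comes out. *)
under [RHS]eq_bigr => j _ do rewrite -[X in if _ then X else _]mul1r
  -[X in if _ then _ else X](mul0r (\sum_(s : 'S_n) (-1) ^+ s *
      \prod_(i < n) (\matrix_(i0, j0) (subat e j k.+1 i0 == e' j0)%:R) i (s i)))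
  -(fun_if (fun z => z * _)) mulr_sumr.
rewrite [RHS]exchange_big /=; apply: eq_bigr => s _.
rewrite (reindex_inj (@perm_inj _ s)) /=; apply: eq_bigr => j _.
rewrite [RHS]mulrCA; congr (_ * _).
rewrite (bigD1 j) // [X in _ * X](bigD1 j) //= mulrA; congr (_ * _); last first.
  apply: eq_bigr => i ij; rewrite !mxE !ffunE (inj_eq perm_inj) (negPf ij).
  by rewrite mul0n addn0 subn0.
rewrite !mxE !ffunE !eqxx !mul1n; case: ltnP => kj; rewrite ?mul1r ?mul0r.
  by congr (_%:R); lia.
by case: eqP => //; lia.
Qed.

Lemma eq_lower d c Psi Psi' : Psi =1 Psi' -> lower d c Psi =1 lower d c Psi'.
Proof.
by move=> eqP e; apply: eq_bigr => j _; apply: eq_bigr => k _; rewrite eqP.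
Qed.

Lemma eq_iter_lower d c b Psi Psi' : Psi =1 Psi' ->
  iter b (lower d c) Psi =1 iter b (lower d c) Psi'.
Proof. by move=> eqP; elim: b => //= b IH; apply: eq_lower. Qed.

Lemma raise_lowerC d c d' c' (G : {ffun 'I_n -> nat} -> {ffun 'I_n -> nat} -> F) e e' :
  raise d c (fun e' => lower d' c' (G^~ e') e) e' =
  lower d' c' (fun e => raise d c (G e) e') e.
Proof.
rewrite /raise /lower.
under eq_bigr => i _ do under eq_bigr => k _ do rewrite mulr_sumr.
under eq_bigr => i _ do rewrite exchange_big /=.
rewrite exchange_big /=; apply: eq_bigr => j _.
under eq_bigr => i _ do under eq_bigr => k _ do rewrite mulr_sumr.
under eq_bigr => i _ do rewrite exchange_big /=.
rewrite exchange_big /=; apply: eq_bigr => l _.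
case: ifP => _; last first.
  by rewrite mulr0; apply: big1 => i _; apply: big1 => k _; rewrite !mulr0.
rewrite mulr_sumr; apply: eq_bigr => i _; rewrite mulr_sumr.
by apply: eq_bigr => k _; rewrite mulrCA.
Qed.

Lemma raise_iter_lowerC d c d' c' b (G : {ffun 'I_n -> nat} -> {ffun 'I_n -> nat} -> F) e e' :
  raise d c (fun e' => iter b (lower d' c') (G^~ e') e) e' =
  iter b (lower d' c') (fun e => raise d c (G e) e') e.
Proof.
elim: b e => //= b IH e.
rewrite (raise_lowerC d c d' c' (fun e e' => iter b (lower d' c') (G^~ e') e)).
by apply: eq_lower => e0; rewrite IH.
Qed.

Lemma iter_raise_overlap d c b e e' :
  iter b (raise d c) (overlap e) e' = iter b (lower d c) (overlap^~ e') e.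
Proof.
elim: b e' => // b IH e'; rewrite iterS iterSr.
transitivity (raise d c (fun e' => iter b (lower d c) (overlap^~ e') e) e').
  by apply: eq_bigr => j _; apply: eq_bigr => k _; rewrite IH.
rewrite raise_iter_lowerC; apply: eq_iter_lower => e0.
exact: raise_overlap.
Qed.

(** [raise] reads [Psi] only at vectors of strictly larger total degree. *)
Lemma raise_degree0 d c Psi m e :
  (forall e, (m < \sum_(i < n) e i)%N -> Psi e = 0) ->
  (m <= \sum_(i < n) e i)%N -> raise d c Psi e = 0.
Proof.
move=> h me; apply: big1 => j _; apply: big1 => k _; rewrite h ?mulr0 //.
apply: leq_ltn_trans me _; rewrite (bigD1 j) //= [X in (_ < X)%N](bigD1 j) //=.
rewrite ffunE eqxx mul1n -addSn leq_add // ?leq_sum //.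
  by rewrite addnS ltnS leq_addr.
by move=> i _; rewrite ffunE leq_addr.
Qed.

Lemma overlap_degree e : (\sum_(i < n) ground n i < \sum_(i < n) e i)%N ->
  overlap e (ground n) = 0.
Proof.
move=> he; apply/eqP/negPn/negP => /overlap_neq0 [s es]; move: he.
rewrite [X in (X < _)%N](reindex_inj (@perm_inj _ s)) /= es.
by under [X in (_ < X)%N]eq_bigr => i _ do rewrite ffunE; rewrite ltnn.
Qed.

Lemma iter_raise_overlap_ground d c a :
  iter a.+1 (raise d c) (overlap^~ (ground n)) (ground n) = 0.
Proof.
rewrite iterS; apply: (@raise_degree0 _ _ _ (\sum_(i < n) ground n i)%N) => // {}e.
elim: a e => [|a IH] e he; last first.
  by apply: (@raise_degree0 _ _ _ (\sum_(i < n) ground n i)%N); rewrite 1?ltnW.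
exact: overlap_degree.
Qed.

(** Each use of [iter_raise_lower_ground] cancels one raising against one lowering. Leftover
    lowerings vanish at the filled sea, leftover raisings by comparing total degrees. *)
Lemma ground_pairing d c c' a b : (a.+1 * d <= n)%N ->
  iter a (raise d c) (iter b (lower d c') (overlap^~ (ground n))) (ground n) =
  (a == b)%:R * (a`!%:R * (\sum_(k < d) k.+1%:R * (c k * c' k)) ^+ a).
Proof.
have aP := @alternating_overlapl (ground n).
elim: a b => [|a IH] [|b] an.
- rewrite /= overlap_id ?expr0 ?mulr1 //; apply/injectiveP => i j.
  by rewrite !ffunE => /val_inj.
- by rewrite /= lower_ground ?mul0r //; apply: alternating_iter_lower.
- by rewrite iter_raise_overlap_ground mul0r.
- rewrite iter_raise_lower_ground // IH; last by apply: leq_trans an; rewrite leq_mul2r leqnSn orbT.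
  rewrite eqSS exprS factS natrM; ring.
Qed.

(** The bound is uniform in [n]: although [raise] sums over [n] particles, only those among the top
    [D'] levels can move without meeting another one. *)
Lemma iter_raise_bound d c Psi a D D' e (B : F) : alternating Psi -> 0 <= B ->
  (forall e, above D' e -> `|Psi e| <= B) ->
  above D e -> (D + a * d <= D')%N ->
  `|iter a (raise d c) Psi e| <= (D'%:R * \sum_(k < d) `|c k|) ^+ a * B.
Proof.
move=> aP B0 PsiB; elim: a D e => [|a IH] D e aD DD'.
  by rewrite expr0 mul1r PsiB // (above_le _ aD) //; lia.
have aPa := alternating_iter_raise d c a aP.
set C := D'%:R * _ in IH *; have C0 : 0 <= C.
  by rewrite mulr_ge0 // sumr_ge0.
rewrite /= /raise; apply: le_trans (ler_norm_sum _ _ _) _.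
(* The indicator discards the particles below level [n - D']: raising one of them breaks
   injectivity, by [above_fixed]. *)
apply: (@le_trans _ _ (\sum_(j < n) (n <= j + D')%N%:R * ((\sum_(k < d) `|c k|) * (C ^+ a * B)))).
  apply: ler_sum => j _; apply: le_trans (ler_norm_sum _ _ _) _.
  rewrite mulr_suml mulr_sumr; apply: ler_sum => k _.
  rewrite normrM mulrCA ler_wpM2l //.
  have aDk := above_addat j k.+1 aD.
  have [inj|ninj] := boolP (injectiveb (addat e j k.+1)); last first.
    by rewrite (alternating_noninj aPa ninj) normr0 mulr_ge0 // mulr_ge0 // exprn_ge0.
  have -> : (n <= j + D')%N.
    rewrite leqNgt; apply/negP => jn.
    have aD' : above D' (addat e j k.+1).
      by apply: above_le aDk; have := ltn_ord k; nia.
    have := above_fixed aD' inj jn.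
    move: aD => /andP[/forallP /(_ j)]; rewrite ffunE eqxx mul1n; lia.
  rewrite mul1r (IH (D + k.+1)%N) //; have := ltn_ord k; nia.
rewrite -mulr_suml exprS.
have -> : C * C ^+ a * B = D'%:R * ((\sum_(k < d) `|c k|) * (C ^+ a * B)).
  by rewrite /C -!mulrA.
rewrite ler_wpM2r //.
  by rewrite mulr_ge0 ?sumr_ge0 // mulr_ge0 // exprn_ge0.
rewrite -natr_sum ler_nat.
(* At most [D'] indices pass the indicator, also when [D'] exceeds [n]. *)
have [nD|nD] := leqP n D'.
  rewrite (leq_trans _ nD) // -[X in (_ <= X)%N]card_ord -sum1_card leq_sum // => i _.
  exact: leq_b1.
have -> : (\sum_(j < n) (n <= j + D') = \sum_(n - D' <= j < n) 1)%N.
  rewrite -(big_mkord xpredT (fun j => nat_of_bool (n <= j + D')%N)).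
  rewrite (@big_cat_nat _ _ _ (n - D')) ?leq_subr //= big_nat big1 ?add0n => [|i]; last by case: leqP; lia.
  by rewrite !big_nat; apply: eq_bigr => i; case: leqP; lia.
by rewrite sum_nat_const_nat; lia.
Qed.

End Overlap.

(** * Integrals and complex measurability *)

(** Integrability is bundled with the value, so that linearity holds without side conditions. *)
Definition has_int d (T : measurableType d) (R : realType)
    (mu : {measure set T -> \bar R}) (f : T -> R) (v : R) :=
  mu.-integrable setT (EFin \o f) /\ (\int[mu]_x (f x)%:E = v%:E)%E.

Section HasInt.
Context d (T : measurableType d) (R : realType) (mu : {measure set T -> \bar R}).
Implicit Types f g : T -> R.

Lemma has_int_integrable f : mu.-integrable setT (EFin \o f) ->
  has_int mu f (\int[mu]_x f x).
Proof.
by move=> fi; split=> //; rewrite /Rintegral fineK //; exact: integrable_fin_num.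
Qed.

Lemma has_int_Rintegral f v : has_int mu f v -> \int[mu]_x f x = v.
Proof. by case=> _; rewrite /Rintegral => ->. Qed.

Lemma has_int_measurable f v : has_int mu f v -> measurable_fun setT f.
Proof. by case=> /integrableP[/measurable_EFinP]. Qed.

Lemma has_int_ge0 f v : measurable_fun setT f -> (forall x, 0 <= f x) ->
  (\int[mu]_x (f x)%:E = v%:E)%E -> has_int mu f v.
Proof.
move=> mf f0 fv; split=> //; apply/integrableP; split; first exact/measurable_EFinP.
under eq_integral => x _ do rewrite /= ger0_norm //.
by rewrite fv ltry.
Qed.

Lemma eq_has_int f g v : f =1 g -> has_int mu f v -> has_int mu g v.
Proof. by move=> /funext ->. Qed.

Lemma has_int0 : has_int mu (fun=> 0) 0.
Proof. by split; [exact: integrable0|exact: integral0]. Qed.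

Lemma has_intD f g a b : has_int mu f a -> has_int mu g b ->
  has_int mu (fun x => f x + g x) (a + b).
Proof.
move=> [fi fa] [gi gb]; split.
  by apply: eq_integrable (integrableD _ fi gi) => // x _; rewrite /= EFinD.
under eq_integral => x _ do rewrite EFinD.
by rewrite integralD // fa gb EFinD.
Qed.

Lemma has_intZ f a (r : R) : has_int mu f a -> has_int mu (fun x => r * f x) (r * a).
Proof.
move=> [fi fa]; split.
  by apply: eq_integrable (integrableZl _ r fi) => // x _; rewrite /= EFinM.
under eq_integral => x _ do rewrite EFinM.
by rewrite integralZl // fa EFinM.
Qed.

Lemma has_intN f a : has_int mu f a -> has_int mu (fun x => - f x) (- a).
Proof.
move=> /(has_intZ (-1)); rewrite mulN1r; apply: eq_has_int => x.
by rewrite mulN1r.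
Qed.

Lemma has_intB f g a b : has_int mu f a -> has_int mu g b ->
  has_int mu (fun x => f x - g x) (a - b).
Proof. by move=> fa /has_intN; exact: has_intD. Qed.

Lemma has_int_sum (I : Type) (s : seq I) (P : pred I) (f : I -> T -> R) (v : I -> R) :
  (forall i, P i -> has_int mu (f i) (v i)) ->
  has_int mu (fun x => \sum_(i <- s | P i) f i x) (\sum_(i <- s | P i) v i).
Proof.
move=> fv; elim: s => [|i s IH].
  by rewrite big_nil; apply: eq_has_int has_int0 => x; rewrite big_nil.
rewrite big_cons; case: ifPn => Pi.
  by apply: eq_has_int (has_intD (fv i Pi) IH) => x; rewrite big_cons Pi.
by apply: eq_has_int IH => x; rewrite big_cons (negbTE Pi).
Qed.

Lemma has_int_le f g a b : has_int mu f a -> has_int mu g b ->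
  (forall x, f x <= g x) -> a <= b.
Proof.
move=> [fi fa] [gi gb] fg; rewrite -lee_fin -fa -gb.
by apply: le_integral => // x _; rewrite lee_fin.
Qed.

Lemma has_int_dom f g b : measurable_fun setT f -> has_int mu g b ->
  (forall x, `|f x| <= g x) -> has_int mu f (\int[mu]_x f x).
Proof.
move=> mf [gi _] fg; apply: has_int_integrable; apply: le_integrable gi => //.
  exact/measurable_EFinP.
by move=> x _; rewrite lee_fin (le_trans (fg x)) // ler_norm.
Qed.

Lemma has_int_uniq f a b : has_int mu f a -> has_int mu f b -> a = b.
Proof. by move=> [_ fa] [_]; rewrite fa => -[]. Qed.

End HasInt.

Lemma has_int_cst d (T : measurableType d) (R : realType) (P : probability T R)
  (k : R) : has_int P (fun=> k) k.
Proof.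
split; first exact: (@finite_measure_integrable_cst _ _ _ P setT k).
by rewrite integral_cst //= probability_setT mule1.
Qed.

Section Complex.
Context (R : realType).
Implicit Types z w : R[i].

Lemma ReD z w : complex.Re (z + w) = complex.Re z + complex.Re w.
Proof. by case: z w => [a b] [c d]. Qed.
Lemma ImD z w : complex.Im (z + w) = complex.Im z + complex.Im w.
Proof. by case: z w => [a b] [c d]. Qed.
Lemma ReN z : complex.Re (- z) = - complex.Re z. Proof. by case: z. Qed.
Lemma ReM z w : complex.Re (z * w) =
  complex.Re z * complex.Re w - complex.Im z * complex.Im w.
Proof. by case: z w => [a b] [c d]. Qed.
Lemma ImM z w : complex.Im (z * w) =
  complex.Re z * complex.Im w + complex.Im z * complex.Re w.
Proof. by case: z w => [a b] [c d]. Qed.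
Lemma ReJ z : complex.Re z^*%C = complex.Re z. Proof. by case: z. Qed.
Lemma ImJ z : complex.Im z^*%C = - complex.Im z. Proof. by case: z. Qed.

Lemma Re_sum (I : Type) (s : seq I) (P : pred I) (F : I -> R[i]) :
  complex.Re (\sum_(i <- s | P i) F i) = \sum_(i <- s | P i) complex.Re (F i).
Proof. exact: (big_morph _ ReD). Qed.
Lemma Im_sum (I : Type) (s : seq I) (P : pred I) (F : I -> R[i]) :
  complex.Im (\sum_(i <- s | P i) F i) = \sum_(i <- s | P i) complex.Im (F i).
Proof. exact: (big_morph _ ImD). Qed.

Lemma cmod_ge0 z : 0 <= cmod z. Proof. exact: sqrtr_ge0. Qed.

Lemma cmod_sqr z : cmod z ^+ 2 = complex.Re z ^+ 2 + complex.Im z ^+ 2.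
Proof. by rewrite /cmod sqr_sqrtr // addr_ge0 // sqr_ge0. Qed.

Lemma cmod_normc z : cmod z = Normc.normc z. Proof. by case: z. Qed.

Lemma cmodM z w : cmod (z * w) = cmod z * cmod w.
Proof. by rewrite !cmod_normc Normc.normcM. Qed.

Lemma cmodX z n : cmod (z ^+ n) = cmod z ^+ n.
Proof.
elim: n => [|n IH]; last by rewrite !exprS cmodM IH.
by rewrite !expr0 /cmod /= expr0n addr0 expr1n sqrtr1.
Qed.

Lemma cmodJ z : cmod z^*%C = cmod z.
Proof. by rewrite /cmod ReJ ImJ sqrrN. Qed.

Lemma Re_le_cmod z : `|complex.Re z| <= cmod z.
Proof.
rewrite -sqrtr_sqr /cmod ler_sqrt ?lerDl ?sqr_ge0 //.
by rewrite addr_ge0 // sqr_ge0.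
Qed.

Lemma Im_le_cmod z : `|complex.Im z| <= cmod z.
Proof.
rewrite -sqrtr_sqr /cmod ler_sqrt ?lerDr ?sqr_ge0 //.
by rewrite addr_ge0 // sqr_ge0.
Qed.

Lemma cmod2_conj z : (cmod z ^+ 2)%:C = z * z^*%C.
Proof.
rewrite cmod_sqr; case: z => a b /=; apply/eqP; rewrite eq_complex /=.
by rewrite mulrN opprK -!expr2 eqxx /= mulrN mulrC addNr.
Qed.

Lemma conjcM z w : (z * w)^*%C = z^*%C * w^*%C. Proof. exact: rmorphM. Qed.
Lemma conjcX z n : (z ^+ n)^*%C = z^*%C ^+ n. Proof. exact: rmorphXn. Qed.
Lemma conjc_sum (I : Type) (s : seq I) (P : pred I) (F : I -> R[i]) :
  (\sum_(i <- s | P i) F i)^*%C = \sum_(i <- s | P i) (F i)^*%C.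
Proof. exact: raddf_sum. Qed.
Lemma conjc_prod (I : Type) (s : seq I) (P : pred I) (F : I -> R[i]) :
  (\prod_(i <- s | P i) F i)^*%C = \prod_(i <- s | P i) (F i)^*%C.
Proof. exact: rmorph_prod. Qed.

Lemma realCM (x y : R) : (x * y)%:C = x%:C * y%:C. Proof. exact: rmorphM. Qed.
Lemma realCX (x : R) n : (x ^+ n)%:C = x%:C ^+ n. Proof. exact: rmorphXn. Qed.
Lemma realC_nat n : n%:R%:C = n%:R :> R[i]. Proof. exact: rmorph_nat. Qed.
Lemma realC_sum (I : Type) (s : seq I) (P : pred I) (F : I -> R) :
  (\sum_(i <- s | P i) F i)%:C = \sum_(i <- s | P i) (F i)%:C.
Proof. exact: raddf_sum. Qed.
Lemma Re_realM (x : R) z : complex.Re (x%:C * z) = x * complex.Re z.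
Proof. by rewrite ReM /= mul0r subr0. Qed.

End Complex.

Definition cmeasurable d (T : measurableType d) (R : realType) (h : T -> R[i]) :=
  measurable_fun setT (fun x => complex.Re (h x)) /\
  measurable_fun setT (fun x => complex.Im (h x)).

Section CMeasurable.
Context d (T : measurableType d) (R : realType).
Implicit Types h g : T -> R[i].

Lemma cmeasurable_cst (a : R[i]) : cmeasurable (fun _ : T => a).
Proof. by split; exact: measurable_cst. Qed.

Lemma cmeasurableD h g : cmeasurable h -> cmeasurable g ->
  cmeasurable (fun x => h x + g x).
Proof.
move=> [h1 h2] [g1 g2]; split.
  by under eq_fun do rewrite ReD; exact: measurable_funD.
by under eq_fun do rewrite ImD; exact: measurable_funD.
Qed.

Lemma cmeasurableM h g : cmeasurable h -> cmeasurable g ->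
  cmeasurable (fun x => h x * g x).
Proof.
move=> [h1 h2] [g1 g2]; split.
  by under eq_fun do rewrite ReM; apply: measurable_funB; exact: measurable_funM.
by under eq_fun do rewrite ImM; apply: measurable_funD; exact: measurable_funM.
Qed.

Lemma cmeasurableJ h : cmeasurable h -> cmeasurable (fun x => (h x)^*%C).
Proof.
move=> [h1 h2]; split; first by under eq_fun do rewrite ReJ.
by under eq_fun do rewrite ImJ; exact: measurableT_comp.
Qed.

Lemma cmeasurableX h n : cmeasurable h -> cmeasurable (fun x => h x ^+ n).
Proof.
move=> mh; elim: n => [|n IH].
  by under eq_fun do rewrite expr0; exact: cmeasurable_cst.
by under eq_fun do rewrite exprS; exact: cmeasurableM.
Qed.

Lemma cmeasurable_sum (I : Type) (s : seq I) (h : I -> T -> R[i]) :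
  (forall i, cmeasurable (h i)) -> cmeasurable (fun x => \sum_(i <- s) h i x).
Proof.
move=> mh; elim: s => [|i s IH].
  by under eq_fun do rewrite big_nil; exact: cmeasurable_cst.
by under eq_fun do rewrite big_cons; exact: cmeasurableD.
Qed.

Lemma cmeasurable_poly h (p : {poly R[i]}) : cmeasurable h ->
  cmeasurable (fun x => p.[h x]).
Proof.
move=> mh; under eq_fun do rewrite horner_coef.
apply: cmeasurable_sum => i; apply: cmeasurableM; first exact: cmeasurable_cst.
exact: cmeasurableX.
Qed.

Lemma cmeasurable_cmod2 h : cmeasurable h -> measurable_fun setT (fun x => cmod (h x) ^+ 2).
Proof.
move=> [h1 h2]; under eq_fun do rewrite cmod_sqr.
by apply: measurable_funD; exact: measurable_funX.
Qed.

Lemma cmeasurable_toC (h : T -> plane R) : measurable_fun setT h ->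
  cmeasurable (fun x => toC (h x)).
Proof. by move=> /measurable_fun_pairP. Qed.

Lemma measurable_ofC h : cmeasurable h -> measurable_fun setT (fun x => ofC (h x)).
Proof. by move=> mh; apply/measurable_fun_pairP. Qed.

End CMeasurable.

Definition cis (R : realType) (t : R) : R[i] := cos t +i* sin t.

Section Cis.
Context (R : realType).
Implicit Types s t : R.

Lemma cisD s t : cis (s + t) = cis s * cis t.
Proof. by rewrite /cis cosD sinD; apply/eqP; rewrite eq_complex /= eqxx addrC eqxx. Qed.

Lemma cisX t n : cis t ^+ n = cis (n%:R * t).
Proof.
elim: n => [|n IH]; first by rewrite mul0r expr0 /cis cos0 sin0.
by rewrite exprS IH -cisD -[in RHS]natr1 mulrDl mul1r addrC.
Qed.

Lemma cisJ t : (cis t)^*%C = cis (- t).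
Proof. by rewrite /cis cosN sinN. Qed.

Lemma cmod_cis t : cmod (cis t) = 1.
Proof. by rewrite /cmod /= cos2Dsin2 sqrtr1. Qed.

Lemma cis_pi : cis pi = -1 :> R[i].
Proof. by rewrite /cis cospi sinpi; apply/eqP; rewrite eq_complex /= oppr0 !eqxx. Qed.

Lemma cis_antipode (p q : nat) : p != q -> exists u : R[i],
  cmod u = 1 /\ u ^+ p * u^*%C ^+ q = -1.
Proof.
move=> pq; have pq0 : p%:R - q%:R != 0 :> R by rewrite subr_eq0 eqr_nat.
exists (cis (pi / (p%:R - q%:R))); split; first exact: cmod_cis.
rewrite cisJ !cisX -cisD -cis_pi; congr cis.
by rewrite mulrN -mulNr -mulrDl mulrCA mulfV ?mulr1.
Qed.

End Cis.

Lemma toCK (R : realType) : cancel (@ofC R) (@toC R). Proof. by case. Qed.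

(** * Rotation invariance, the projection kernel and Slater determinants *)

Definition rmoment (R : realType) (mu : {measure set (plane R) -> \bar R}) k : R :=
  fine (moment mu k).

Section RotationMoments.
Context (R : realType) (mu : probability (plane R) R) (N : nat).
Hypothesis rot : rotation_invariant mu.
Hypothesis finN : (moment mu (2 * N) < +oo)%E.

Let mZ : cmeasurable (@toC R : plane R -> R[i]).
Proof. by apply: cmeasurable_toC; exact: measurable_id. Qed.

Lemma measurable_cmodX k : measurable_fun setT (fun z : plane R => cmod (toC z) ^+ (2 * k)).
Proof.
under eq_fun do rewrite mulnC exprM -cmodX.
by apply: cmeasurable_cmod2; exact: cmeasurableX.
Qed.

Let has_momentN : has_int mu (fun z => cmod (toC z) ^+ (2 * N)) (rmoment mu (2 * N)).
Proof.
apply: has_int_ge0; first exact: measurable_cmodX.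
  by move=> z; rewrite exprn_ge0 // cmod_ge0.
rewrite /rmoment fineK // ge0_fin_numE //.
by apply: integral_ge0 => z _; rewrite lee_fin exprn_ge0 // cmod_ge0.
Qed.

Lemma expr_le_1D (x : R) (k m : nat) : 0 <= x -> (k <= m)%N -> x ^+ k <= 1 + x ^+ m.
Proof.
move=> x0 km; have [x1|x1] := leP x 1.
  by rewrite (le_trans (exprn_ile1 k x0 x1)) // lerDl exprn_ge0.
by rewrite (le_trans (ler_weXn2l (ltW x1) km)) // lerDr.
Qed.

Lemma has_moment k : (k <= N)%N ->
  has_int mu (fun z => cmod (toC z) ^+ (2 * k)) (rmoment mu (2 * k)).
Proof.
move=> kN; apply: has_int_dom; first exact: measurable_cmodX.
  exact: has_intD (has_int_cst mu 1) has_momentN.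
move=> z; rewrite ger0_norm ?exprn_ge0 ?cmod_ge0 //.
by apply: expr_le_1D; rewrite ?cmod_ge0 // leq_mul2l.
Qed.

Lemma moment_fin k : (k <= N)%N -> (moment mu (2 * k) < +oo)%E.
Proof. by move=> /has_moment[_]; rewrite /moment => ->; rewrite ltry. Qed.

Lemma has_int_rot (u : R[i]) (f : plane R -> R) v : cmod u = 1 ->
  has_int mu f v -> has_int mu (fun z => f (ofC (u * toC z))) v.
Proof.
move=> u1 fv; have mf := has_int_measurable fv.
pose phi (z : plane R) : plane R := ofC (u * toC z).
have mphi : measurable_fun setT phi.
  by apply: measurable_ofC; apply: cmeasurableM => //; exact: cmeasurable_cst.
have E A : measurable A -> A `<=` setT -> pushforward mu phi A = mu A.
  by move=> mA _; apply: rot.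
have [/integrableP[_ fi] fE] := fv.
have fi' : mu.-integrable setT (EFin \o (f \o phi)).
  apply/integrableP; split.
    by apply/measurable_EFinP; exact: measurableT_comp.
  have := ge0_integral_pushforward mphi mu measurableT (f := fun x => `|(f x)%:E|%E).
  rewrite preimage_setT => <- //; last 1 first.
    by do 2?apply: measurableT_comp => //.
  by rewrite (eq_measure_integral mu).
split => //; rewrite -fE.
have := integral_pushforward mphi (mu := mu) (D := setT) (f := EFin \o f).
rewrite preimage_setT => <- //; first exact: eq_measure_integral.
exact/measurable_EFinP.
Qed.

(** The factor [a] gives access to the imaginary part as well, through a = -i. Off the diagonal, the
    rotation of [cis_antipode] preserves the measure and reverses the sign of the integrand, so the
    integral equals its opposite. *)
Lemma has_int_mono (a : R[i]) (p q : nat) : (p <= N)%N -> (q <= N)%N ->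
  has_int mu (fun z => complex.Re (a * (toC z ^+ p * (toC z)^*%C ^+ q)))
    (complex.Re (a * ((p == q)%:R * (rmoment mu (2 * p))%:C))).
Proof.
move=> pN qN; have [<-|pq] := eqVneq p q.
  rewrite mulr1n mul1r [a * _]mulrC Re_realM mulrC.
  apply: eq_has_int (has_intZ _ (has_moment pN)) => z.
  by rewrite -conjcX -cmod2_conj cmodX -exprM [a * _]mulrC Re_realM mulrC mulnC.
rewrite !mul0r mulr0 /=.
have mf : measurable_fun setT (fun z : plane R =>
    complex.Re (a * (toC z ^+ p * (toC z)^*%C ^+ q))).
  suff [] : cmeasurable (fun z : plane R => a * (toC z ^+ p * (toC z)^*%C ^+ q)) by [].
  apply: cmeasurableM; first exact: cmeasurable_cst.
  apply: cmeasurableM; first exact: cmeasurableX.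
  by apply: cmeasurableX; exact: cmeasurableJ.
have := has_int_dom mf (has_intZ (cmod a)
  (has_intD (has_int_cst mu 1) has_momentN)).
set I := Rintegral _ _ _ => /(_ _) hI.
have {}hI : has_int mu (fun z : plane R =>
    complex.Re (a * (toC z ^+ p * (toC z)^*%C ^+ q))) I.
  apply: hI => z; apply: (le_trans (Re_le_cmod _)); rewrite !cmodM !cmodX cmodJ.
  rewrite ler_wpM2l ?cmod_ge0 // -exprD expr_le_1D ?cmod_ge0 //.
  by rewrite mul2n -addnn leq_add.
suff : I = - I by move/eqP; rewrite -addr_eq0 -mulr2n mulrn_eq0 /= => /eqP <-.
have [u [u1 ue]] := cis_antipode R pq.
apply: has_int_uniq (has_int_rot u1 hI) _.
apply: eq_has_int (has_intN hI) => z; rewrite toCK -ReN; congr complex.Re.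
rewrite conjcM !exprMn mulrACA ue mulN1r.
by rewrite mulrN.
Qed.

End RotationMoments.

Section PowerIntegral.
Context (R : realType) (mu : probability (plane R) R) (N : nat).
Hypothesis rot : rotation_invariant mu.
Hypothesis finN : (moment mu (2 * N) < +oo)%E.

(** The coefficients [a] are arbitrary so that the induction can absorb into them the factor of the
    outermost variable. *)
Lemma power_integral_mono n (I : finType) (a : I -> R[i]) (p q : I -> 'I_n -> nat) :
  (forall x i, p x i <= N)%N -> (forall x i, q x i <= N)%N ->
  power_integral mu (fun t : n.-tuple (plane R) =>
    (complex.Re (\sum_x a x * \prod_(i < n)
       (toC (tnth t i) ^+ p x i * (toC (tnth t i))^*%C ^+ q x i)))%:E) =
  (complex.Re (\sum_x a x * \prod_(i < n)
       ((p x i == q x i)%:R * (rmoment mu (2 * p x i))%:C)))%:E.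
Proof.
elim: n a p q => [|n IH] a p q pN qN.
  by rewrite /=; congr ((complex.Re _)%:E); apply: eq_bigr => x _; rewrite !big_ord0.
rewrite /=; pose kappa x := \prod_(i < n) ((p x (lift ord0 i) == q x (lift ord0 i))%:R *
  (rmoment mu (2 * p x (lift ord0 i)))%:C).
transitivity (\int[mu]_z (\sum_(x : I) complex.Re (a x * kappa x *
    (toC z ^+ p x ord0 * (toC z)^*%C ^+ q x ord0)))%:E)%E.
  apply: eq_integral => z _; rewrite -Re_sum; apply/esym.
  rewrite [X in complex.Re X](eq_bigr (fun x =>
    (a x * (toC z ^+ p x ord0 * (toC z)^*%C ^+ q x ord0)) * kappa x)) => [|x _]; last by rewrite mulrAC.
  rewrite -(IH (fun x => a x * (toC z ^+ p x ord0 * (toC z)^*%C ^+ q x ord0))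
    (fun x i => p x (lift ord0 i)) (fun x i => q x (lift ord0 i))) //.
  congr power_integral; apply/funext => t; congr ((complex.Re _)%:E).
  apply: eq_bigr => x _; rewrite big_ord_recl tnth0 -[LHS]mulrA; congr (_ * (_ * _)).
  by apply: eq_bigr => i _; rewrite tnthS.
have [|_ ->] := @has_int_sum _ _ _ mu I (index_enum I) xpredT
  (fun x z => complex.Re (a x * kappa x * (toC z ^+ p x ord0 * (toC z)^*%C ^+ q x ord0)))
  (fun x => complex.Re (a x * kappa x *
    ((p x ord0 == q x ord0)%:R * (rmoment mu (2 * p x ord0))%:C))).
  by move=> x _; apply: (has_int_mono rot finN).
rewrite -Re_sum; congr ((complex.Re _)%:E); apply: eq_bigr => x _.
by rewrite big_ord_recl mulrAC mulrA.
Qed.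

End PowerIntegral.

Section HasCint.
Context d (T : measurableType d) (R : realType) (mu : {measure set T -> \bar R}).
Implicit Types f g : T -> R[i].

Definition has_cint f (v : R[i]) :=
  has_int mu (fun x => complex.Re (f x)) (complex.Re v) /\
  has_int mu (fun x => complex.Im (f x)) (complex.Im v).

Lemma has_cintE f v : has_cint f v -> cint mu f = v.
Proof.
move=> [h1 h2]; rewrite /cint (has_int_Rintegral h1) (has_int_Rintegral h2).
by case: v {h1 h2}.
Qed.

Lemma eq_has_cint f g v : f =1 g -> has_cint f v -> has_cint g v.
Proof. by move=> /funext ->. Qed.

Lemma has_cintZ f v (a : R[i]) : has_cint f v -> has_cint (fun x => a * f x) (a * v).
Proof.
move=> [h1 h2]; split.
  rewrite ReM; apply: eq_has_int (has_intB (has_intZ _ h1) (has_intZ _ h2)) => x.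
  by rewrite ReM.
rewrite ImM; apply: eq_has_int (has_intD (has_intZ _ h2) (has_intZ _ h1)) => x.
by rewrite ImM.
Qed.

Lemma has_cintD f g v w : has_cint f v -> has_cint g w ->
  has_cint (fun x => f x + g x) (v + w).
Proof.
move=> [h1 h2] [h3 h4]; split.
  by rewrite ReD; apply: eq_has_int (has_intD h1 h3) => x; rewrite ReD.
by rewrite ImD; apply: eq_has_int (has_intD h2 h4) => x; rewrite ImD.
Qed.

Lemma has_cint_sum (I : Type) (s : seq I) (f : I -> T -> R[i]) (v : I -> R[i]) :
  (forall i, has_cint (f i) (v i)) ->
  has_cint (fun x => \sum_(i <- s) f i x) (\sum_(i <- s) v i).
Proof.
move=> fv; split.
  rewrite Re_sum; apply: eq_has_int (has_int_sum s (P := xpredT) (fun i _ => (fv i).1)) => x.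
  by rewrite Re_sum.
rewrite Im_sum; apply: eq_has_int (has_int_sum s (P := xpredT) (fun i _ => (fv i).2)) => x.
by rewrite Im_sum.
Qed.

End HasCint.

(** * The projection kernel and its determinant *)

Section Kernel.
Context (R : realType) (mu : probability (plane R) R) (n : nat).
Hypothesis rot : rotation_invariant mu.
Hypothesis finN : (moment mu (2 * n) < +oo)%E.
Hypothesis pos : forall k, (k < n)%N -> 0 < rmoment mu (2 * k).
Local Notation m k := (rmoment mu (2 * k)).

Lemma has_cint_mono p q : (p <= n)%N -> (q <= n)%N ->
  has_cint mu (fun z => toC z ^+ p * (toC z)^*%C ^+ q) ((p == q)%:R * (m p)%:C).
Proof.
move=> pN qN; split.
  have := has_int_mono rot finN 1 pN qN; rewrite mul1r; apply: eq_has_int => z.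
  by rewrite mul1r.
have ImE (z : R[i]) : complex.Im z = complex.Re ((0 -i* 1) * z).
  by rewrite ReM /= mul0r mulN1r opprK add0r.
rewrite ImE; apply: eq_has_int (has_int_mono rot finN _ pN qN) => z.
by rewrite [RHS]ImE.
Qed.

Lemma horner_widen (p : {poly R[i]}) z : (size p <= n)%N ->
  p.[z] = \sum_(k < n) p`_k * z ^+ k.
Proof. by move=> sp; rewrite (horner_coef_wide _ sp). Qed.

(** The conjugate of K(z, .) is a polynomial [q]. Projecting the monomial of degree k, which lies in
    the subspace, must return it; by orthogonality of monomials this determines the k-th coefficient
    of [q]. *)
Lemma projection_kernelE K : is_projection_kernel mu n K -> forall z w,
  K z w = \sum_(k < n) (m k)^-1%:C * (z ^+ k * w^*%C ^+ k).
Proof.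
move=> [_ K2 K3] z w; have [q sq qE] := K2 z.
rewrite -[LHS]conjcK qE (horner_widen _ sq) conjc_sum; apply: eq_bigr => k _.
rewrite conjcM conjcX mulrA; congr (_ * _).
have mk0 : (m k)%:C != 0.
  by rewrite (_ : 0 = 0%:C) // (inj_eq (@complexI R)) gt_eqF // pos.
suff : (q`_k)^*%C * (m k)%:C = z ^+ k.
  by move=> /(canRL (mulfK mk0)) ->; rewrite fmorphV mulrC.
have kn := ltn_ord k.
have sqk : square_integrable mu (fun z => toC z ^+ k).
  have [mr mi] : cmeasurable (fun z : plane R => toC z ^+ k).
    by apply: cmeasurableX; apply: cmeasurable_toC; exact: measurable_id.
  split => //; under eq_integral => x _ do rewrite cmodX -exprM mulnC.
  by have := moment_fin finN (ltnW kn).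
have [p [sp pK porth]] := K3 _ sqk.
(* Testing the orthogonality condition against each monomial of degree [l < n] gives the
   coefficients of [p]. *)
have pE : p = 'X^k.
  apply/polyP => l; rewrite coefXn; have [ln|ln] := ltnP l n; last first.
    by rewrite nth_default ?(leq_trans sp) // gtn_eqF // (leq_trans kn).
  have h1 : has_cint mu (fun z => (toC z ^+ k - p.[toC z]) * (('X^l).[toC z])^*%C)
      ((k == l :> nat)%:R * (m k)%:C +
       \sum_(j < n) (- p`_j * ((j == l :> nat)%:R * (m j)%:C))).
    apply: eq_has_cint (has_cintD (has_cint_mono (ltnW kn) (ltnW ln))
      (has_cint_sum (index_enum 'I_n)
        (fun j : 'I_n => has_cintZ (- p`_j) (has_cint_mono (ltnW (ltn_ord j)) (ltnW ln))))) => x.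
    rewrite hornerXn mulrBl conjcX; congr (_ + _).
    rewrite (horner_widen _ sp) -mulNr -sumrN mulr_suml; apply: eq_bigr => j _.
    by rewrite mulrA mulNr.
  have := has_cintE h1; rewrite porth ?size_polyXn //.
  rewrite (bigD1 (Ordinal ln)) //= eqxx mul1r big1 => [|j jl]; last first.
    have -> : (j == l :> nat) = false.
      by apply/eqP => jl'; move/eqP: jl; apply; apply: val_inj.
    by rewrite mul0r mulr0.
  have ml0 : (m l)%:C != 0.
    by rewrite (_ : 0 = 0%:C) // (inj_eq (@complexI R)) gt_eqF // pos.
  rewrite addr0; have [<-|kl] := eqVneq (k : nat) l => /esym/eqP.
    by rewrite mulr1n -mulrDl mulf_eq0 (negPf mk0) orbF subr_eq0 => /eqP <-.
  by rewrite mul0r add0r mulf_eq0 (negPf ml0) orbF oppr_eq0 => /eqP ->.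
(* Reproducing property: integrating K(z, w) w^k over w returns z^k, and only the k-th coefficient
   of [q] survives in the integral. *)
have := pK z; rewrite pE hornerXn => <-.
have h : has_cint mu (fun w0 => K z (toC w0) * toC w0 ^+ k)
    (\sum_(j < n) ((q`_j)^*%C * ((k == j :> nat)%:R * (m k)%:C))).
  apply: eq_has_cint (has_cint_sum (index_enum 'I_n)
        (fun j : 'I_n => has_cintZ (q`_j)^*%C (has_cint_mono (ltnW kn) (ltnW (ltn_ord j))))) => x.
  rewrite -[K z _]conjcK qE (horner_widen _ sq) conjc_sum mulr_suml.
  by apply: eq_bigr => j _; rewrite conjcM conjcX -mulrA [X in _ * X]mulrC.
rewrite (has_cintE h) (bigD1 k) //= eqxx mul1r big1 ?addr0 // => j jk.
have -> : (k == j :> nat) = false.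
  by apply/eqP => jk'; move/eqP: jk; apply; apply: val_inj.
by rewrite mul0r mulr0.
Qed.

End Kernel.

Definition slater n (F : fieldType) (t : 'I_n -> F) (e : {ffun 'I_n -> nat}) : F :=
  \det (\matrix_(i < n, j < n) t i ^+ e j).

Lemma det_projection_kernel (R : realType) (mu : probability (plane R) R) (n : nat) K :
  rotation_invariant mu -> (moment mu (2 * n) < +oo)%E ->
  (forall k, (k < n)%N -> 0 < rmoment mu (2 * k)) ->
  is_projection_kernel mu n K -> forall t : 'I_n -> R[i],
  \det (\matrix_(i < n, j < n) K (t i) (t j)) =
  (cmod (slater t (ground n)) ^+ 2 * \prod_(k < n) (rmoment mu (2 * k))^-1)%:C.
Proof.
move=> rot fin pos KK t; pose V := \matrix_(i < n, j < n) t i ^+ ground n j.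
have -> : \matrix_(i < n, j < n) K (t i) (t j) =
  V *m diag_mx (\row_k (rmoment mu (2 * (k : 'I_n)))^-1%:C) *m (map_mx conjc V)^T.
  apply/matrixP => i j; rewrite !mxE (projection_kernelE rot fin pos KK).
  apply: eq_bigr => k _; rewrite mul_mx_diag !mxE !ffunE conjcX.
  by rewrite mulrA [_ * t i ^+ _]mulrC.
have realM (x y : R) : (x * y)%:C = x%:C * y%:C by exact: rmorphM.
rewrite !det_mulmx det_tr det_map_mx det_diag realM cmod2_conj mulrAC.
rewrite /slater -/V; congr (_ * _); rewrite -[RHS]/(real_complex R _) rmorph_prod.
by apply: eq_bigr => k _; rewrite mxE.
Qed.

(** In a term of the Leibniz expansion, the factor [t i ^+ k.+1] raises the exponent of column
    [s i]; summing over rows is summing over columns. *)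
Lemma raise_slater n (F : numFieldType) d (c : nat -> F) (t : 'I_n -> F) e :
  raise d c (slater t) e = (\sum_(i < n) \sum_(k < d) c k * t i ^+ k.+1) * slater t e.
Proof.
rewrite /raise /slater exchange_big /= [X in X * _]exchange_big mulr_suml /=.
apply: eq_bigr => k _; rewrite -!mulr_sumr -mulrA; congr (_ * _).
rewrite /determinant exchange_big mulr_sumr /=; apply: eq_bigr => s _.
rewrite (reindex_inj (@perm_inj _ s)) /= mulr_suml; apply: eq_bigr => i _.
rewrite [RHS]mulrCA; congr (_ * _); rewrite (bigD1 i) // [X in _ * X](bigD1 i) //=.
rewrite !mxE !ffunE eqxx mul1n addnC exprD mulrA; congr (_ * _).
apply: eq_bigr => j ji; rewrite !mxE !ffunE (inj_eq perm_inj) (negPf ji).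
by rewrite mul0n addn0.
Qed.

Lemma iter_raise_slater n (F : numFieldType) d (c : nat -> F) (t : 'I_n -> F) a e :
  iter a (raise d c) (slater t) e =
  (\sum_(i < n) \sum_(k < d) c k * t i ^+ k.+1) ^+ a * slater t e.
Proof.
elim: a e => [|a IH] e; first by rewrite mul1r.
rewrite iterS exprS -mulrA -[slater t e]mul1r mulrCA mul1r.
transitivity ((\sum_(i < n) \sum_(k < d) c k * t i ^+ k.+1) ^+ a * raise d c (slater t) e).
  rewrite {1}/raise /raise mulr_sumr; apply: eq_bigr => j _.
  by rewrite mulr_sumr; apply: eq_bigr => k _; rewrite IH mulrCA.
by rewrite raise_slater.
Qed.

Section RaiseTerms.
Variables (n : nat) (F : numFieldType) (d : nat) (c : nat -> F).
Implicit Types (e : {ffun 'I_n -> nat}).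

(** An iterated raising as an explicit list of coefficients and exponent vectors, the form in which
    squared moduli are expanded. *)
Fixpoint raise_terms (a : nat) e : seq (F * {ffun 'I_n -> nat}) :=
  if a is a'.+1 then
    flatten [seq flatten [seq [seq (c k * x.1, x.2) |
      x <- raise_terms a' (addat e j k.+1)] | k : 'I_d <- index_enum 'I_d] | j : 'I_n <- index_enum 'I_n]
  else [:: (1, e)].

Lemma iter_raise_terms a e Psi :
  iter a (raise d c) Psi e = \sum_(x <- raise_terms a e) x.1 * Psi x.2.
Proof.
elim: a e => [|a IH] e; first by rewrite /= big_seq1 mul1r.
rewrite iterS /raise big_flatten /= big_map; apply: eq_bigr => j _.
rewrite big_flatten /= big_map; apply: eq_bigr => k _.
by rewrite IH big_map mulr_sumr; apply: eq_bigr => x _; rewrite mulrA.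
Qed.

Lemma raise_terms_above a D e x : above D e -> x \in raise_terms a e ->
  above (D + a * d) x.2.
Proof.
elim: a D e x => [|a IH] D e x aD; first by rewrite inE addn0 => /eqP ->.
move=> /flatten_mapP [j _ /flatten_mapP [k _ /mapP [y yt ->]]] /=.
have := IH _ _ _ (above_addat j k.+1 aD) yt; apply: above_le.
by have := ltn_ord k; nia.
Qed.

End RaiseTerms.

Section PowerIntegralSlater.
Context (R : realType) (mu : probability (plane R) R) (N : nat).
Hypothesis rot : rotation_invariant mu.
Hypothesis finN : (moment mu (2 * N) < +oo)%E.
Local Notation m k := (rmoment mu (2 * k)).

Definition weight n (e : {ffun 'I_n -> nat}) : R[i] := \prod_(i < n) (m (e i))%:C.

(** Substituting [s * u] for [u] makes the inner sum independent of [s], whence the factor n!. *)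
Lemma sum_perm_pairs n (e e' : {ffun 'I_n -> nat}) :
  \sum_(s : 'S_n) \sum_(u : 'S_n) (-1) ^+ s * (-1) ^+ u *
    \prod_(i < n) ((e (s i) == e' (u i))%:R * (m (e (s i)))%:C) =
  n`!%:R * (weight e * overlap _ e e') :> R[i].
Proof.
rewrite (eq_bigr (fun=> weight e * overlap _ e e')) => [|s _].
  by rewrite sumr_const mulr_natl card_Sn.
rewrite (reindex_inj (mulgI s)) /= /overlap /determinant mulr_sumr.
apply: eq_bigr => u _; rewrite odd_permM signr_addb mulrA -signr_addb addbb mul1r.
rewrite mulrCA; congr (_ * _); rewrite big_split /= mulrC; congr (_ * _).
  by rewrite /weight [RHS](reindex_inj (@perm_inj _ s)).
rewrite [RHS](reindex_inj (@perm_inj _ s)); apply: eq_bigr => i _.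
by rewrite mxE permM.
Qed.

(** [rho] stands for the constant of the kernel determinant. The squared modulus is expanded over
    pairs of a term and a permutation (the type [J]), which leaves monomials to integrate. *)
Lemma power_integral_slater n (I : finType) (g : I -> R[i])
    (e : I -> {ffun 'I_n -> nat}) (rho : R) :
  (forall x i, e x i <= N)%N ->
  power_integral mu (fun t : n.-tuple (plane R) =>
    (cmod (\sum_x g x * slater (fun i => toC (tnth t i)) (e x)) ^+ 2 * rho)%:E) =
  (rho * (n`!%:R * complex.Re (\sum_x \sum_y
     g x * (g y)^*%C * (weight (e x) * overlap _ (e x) (e y)))))%:E.
Proof.
move=> eN.
pose J : finType := ((I * 'S_n) * (I * 'S_n))%type.
pose a (z : J) := (rho%:C * (g z.1.1 * (g z.2.1)^*%C) * ((-1) ^+ z.1.2 * (-1) ^+ z.2.2) : R[i]).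
have slaterE t x : g x * slater t (e x) =
    \sum_(s : 'S_n) g x * (-1) ^+ s * \prod_(i < n) t i ^+ e x (s i) :> R[i].
  rewrite /slater /determinant mulr_sumr; apply: eq_bigr => s _; rewrite mulrA.
  by congr (_ * _); apply: eq_bigr => i _; rewrite mxE.
have shuffle (r b s A c u B : R[i]) :
    r * (b * s * A) * (c * u * B) = r * (b * c) * (s * u) * (A * B).
  by rewrite -!mulrA (mulrCA A c) (mulrCA s c) (mulrCA A u).
have signJ (s : 'S_n) : ((-1) ^+ s : R[i])^*%C = (-1) ^+ s.
  by rewrite conjcX rmorphN rmorph1.
transitivity (power_integral mu (fun t : n.-tuple (plane R) =>
    (complex.Re (\sum_(z : J) a z * \prod_(i < n)
       (toC (tnth t i) ^+ e z.1.1 (z.1.2 i) * (toC (tnth t i))^*%C ^+ e z.2.1 (z.2.2 i))))%:E)).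
  congr power_integral; apply/funext => t; congr (_%:E).
  rewrite mulrC -[LHS]/(complex.Re (rho * cmod _ ^+ 2)%:C).
  have -> (x y : R) : (x * y)%:C = x%:C * y%:C by exact: rmorphM.
  rewrite cmod2_conj; congr complex.Re.
  under eq_bigr => x _ do rewrite slaterE.
  rewrite pair_bigA /= conjc_sum mulr_suml mulr_sumr.
  under [LHS]eq_bigr => x _ do rewrite mulrA mulr_sumr.
  rewrite pair_bigA /=; apply: eq_bigr => -[[x s] [y u]] _ /=.
  rewrite !conjcM signJ conjc_prod big_split /= /a /=.
  under [X in _ * (_ * X)]eq_bigr => i _ do rewrite conjcX.
  exact: shuffle.
rewrite (power_integral_mono rot finN) => [|z i|z i]; rewrite ?eN //.
congr (_%:E).
have natC (k : nat) : (k%:R : R[i]) = (k%:R : R)%:C by rewrite -[RHS]/(real_complex R _) rmorph_nat.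
rewrite -[X in rho * X]Re_realM -Re_realM -natC; congr complex.Re.
rewrite [RHS]mulrA mulr_sumr.
rewrite -(pair_bigA _ (fun (x y : I * 'S_n) => a (x, y) * \prod_(i < n)
   ((e x.1 (x.2 i) == e y.1 (y.2 i))%:R * (m (e x.1 (x.2 i)))%:C))) /=.
rewrite -(pair_bigA _ (fun (x : I) (s : 'S_n) => \sum_y a ((x, s), y) * \prod_(i < n)
   ((e x (s i) == e y.1 (y.2 i))%:R * (m (e x (s i)))%:C))) /=.
apply: eq_bigr => x _.
under eq_bigr => s _ do rewrite -(pair_bigA _ (fun (y : I) (u : 'S_n) =>
   a ((x, s), (y, u)) * \prod_(i < n)
   ((e x (s i) == e y (u i))%:R * (m (e x (s i)))%:C))) /=.
rewrite exchange_big mulr_sumr /=; apply: eq_bigr => y _.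
rewrite -mulrA [_%:R * (_ * _)]mulrCA -sum_perm_pairs mulrA mulr_sumr; apply: eq_bigr => s _.
by rewrite mulr_sumr; apply: eq_bigr => u _; rewrite /a /= !mulrA.
Qed.

End PowerIntegralSlater.

(** * Mixed moments of the linear statistic *)

Definition powersum n (F : pzRingType) d (c : nat -> F) (t : 'I_n -> F) : F :=
  \sum_(i < n) \sum_(k < d) c k * t i ^+ k.+1.

Lemma powersum_perm n (F : pzRingType) d (c : nat -> F) (t : 'I_n -> F) (s : 'I_n -> 'I_n) :
  injective s -> powersum d c (fun i => t (s i)) = powersum d c t.
Proof. by move=> inj; rewrite /powersum [RHS](reindex_inj inj). Qed.

Lemma conj_iter_raise (R : rcfType) n d (c : nat -> R[i]) Psi a (e : {ffun 'I_n -> nat}) :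
  (iter a (raise d c) Psi e)^*%C =
  iter a (raise d (fun k => (c k)^*%C)) (fun e => (Psi e)^*%C) e.
Proof.
elim: a e => // a IH e; rewrite !iterS {1}/raise /raise raddf_sum; apply: eq_bigr => j _.
rewrite raddf_sum; apply: eq_bigr => k _.
by rewrite -IH; exact: rmorphM.
Qed.

Lemma conj_overlap (R : rcfType) n (e e' : {ffun 'I_n -> nat}) :
  (overlap R[i] e e')^*%C = overlap R[i] e e'.
Proof.
rewrite /overlap -det_map_mx; congr (\det _); apply/matrixP => i j.
by rewrite !mxE rmorph_nat.
Qed.

Section Expectation.
Context (R : realType) (mu : probability (plane R) R) (n : nat).
Context (d0 : measure_display) (T : measurableType d0) (P : probability T R)
  (Z : 'I_n -> {RV P >-> plane R}).
Variables (D d : nat) (c : nat -> R[i]) (K : R[i] -> R[i] -> R[i]).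
Hypothesis rot : rotation_invariant mu.
Hypothesis fin : (moment mu (2 * (n + D)) < +oo)%E.
Hypothesis pos : forall k, (k < n)%N -> 0 < rmoment mu (2 * k).
Hypothesis KK : is_projection_kernel mu n K.
Hypothesis ZK : has_determinantal_intensities mu K Z.
Local Notation m k := (rmoment mu (2 * k)).
Local Notation conjs := (fun k => (c k)^*%C).

Let X (w : T) : R[i] := powersum d c (fun i => toC (Z i w)).

(** Weight relative to the ground vector, as produced by the normalisation of the density:
    undisplaced levels of nonzero moment contribute a factor 1. *)
Definition rweight (e : {ffun 'I_n -> nat}) : R := \prod_(i < n) (m (e i) / m i).

Lemma weight_ground_inv e :
  ((\prod_(k < n) (m k)^-1)%:C * weight mu e = (rweight e)%:C)%R.
Proof.
rewrite /rweight /weight -[(_)%:C]/(real_complex R _) -[RHS]/(real_complex R _).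
rewrite !rmorph_prod -big_split /=; apply: eq_bigr => i _.
by rewrite mulrC -[RHS]/(real_complex R _) rmorphM.
Qed.

(** The intensity of order n is tested on the squared modulus of [G]. By symmetry of [G] the n!
    labellings give the same value, and [G] times the Vandermonde determinant in the density is a
    combination of Slater determinants. *)
Lemma has_int_slater (G : ('I_n -> R[i]) -> R[i]) (L : seq (R[i] * {ffun 'I_n -> nat})) :
  (forall x, x \in L -> forall i, x.2 i <= n + D)%N ->
  (forall t, G t * slater t (ground n) = \sum_(x <- L) x.1 * slater t x.2) ->
  (forall t (s : 'I_n -> 'I_n), injective s -> G (fun i => t (s i)) = G t) ->
  cmeasurable (fun t : n.-tuple (plane R) => G (fun i => toC (tnth t i))) ->
  cmeasurable (fun w => G (fun i => toC (Z i w))) ->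
  has_int P (fun w => cmod (G (fun i => toC (Z i w))) ^+ 2)
    (complex.Re (\sum_(x <- L) \sum_(y <- L)
       x.1 * (y.1)^*%C * ((rweight x.2)%:C * overlap _ x.2 y.2))).
Proof.
move=> LD GL Gsym mG mGZ; apply: has_int_ge0.
  exact: cmeasurable_cmod2.
  by move=> w; rewrite sqr_ge0.
have fact0 : n`!%:R != 0 :> R by rewrite pnatr_eq0 -lt0n fact_gt0.
pose h (t : n.-tuple (plane R)) : \bar R := (cmod (G (fun i => toC (tnth t i))) ^+ 2)%:E.
have mh : measurable_fun setT h.
  by apply/measurable_EFinP; exact: cmeasurable_cmod2.
have h0 t : (0 <= h t)%E by rewrite lee_fin sqr_ge0.
have := ZK mh h0.
have -> : (\int[P]_w \sum_(s : {ffun 'I_n -> 'I_n} | injectiveb s)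
    h [tuple Z (s j) w | j < n] =
    n`!%:R%:E * \int[P]_w (cmod (G (fun i => toC (Z i w))) ^+ 2)%:E)%E.
  rewrite -ge0_integralZl_EFin //; last first.
  - by apply/measurable_EFinP; exact: cmeasurable_cmod2.
  - by move=> w _; rewrite lee_fin sqr_ge0.
  apply: eq_integral => w _.
  rewrite (eq_bigr (fun=> (cmod (G (fun i => toC (Z i w))) ^+ 2)%:E)) => [|s /injectiveP inj].
    rewrite sumEFin -EFinM; congr (_%:E).
    rewrite sumr_const mulr_natl; congr (_ *+ _).
    by have := card_inj_ffuns 'I_n 'I_n; rewrite cardsE !card_ord ffactnn => <-.
  rewrite -[in RHS](Gsym _ _ inj) /h; congr ((cmod (G _) ^+ 2)%:E).
  by apply/funext => j; rewrite tnth_mktuple.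
pose g (x : 'I_(size L)) := (tnth (in_tuple L) x).1.
pose e (x : 'I_(size L)) := (tnth (in_tuple L) x).2.
have eD x i : (e x i <= n + D)%N by apply: LD; exact: mem_tnth.
pose rho := \prod_(k < n) (m k)^-1.
have -> : power_integral mu (fun t => h t * (complex.Re (\det (\matrix_(i < n, j < n)
    K (toC (tnth t i)) (toC (tnth t j)))))%:E)%E =
  power_integral mu (fun t : n.-tuple (plane R) =>
    (cmod (\sum_x g x * slater (fun i => toC (tnth t i)) (e x)) ^+ 2 * rho)%:E).
  congr power_integral; apply/funext => t; rewrite /h -EFinM; congr (_%:E).
  have fin0 : (moment mu (2 * n) < +oo)%E by have := moment_fin fin (leq_addr D n).
  rewrite (det_projection_kernel rot fin0 pos KK (fun i => toC (tnth t i))) /=.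
  rewrite mulrA -exprMn -cmodM GL; congr (cmod _ ^+ 2 * _).
  by rewrite [LHS]big_tnth.
have E := power_integral_slater rot fin g rho eD.
move=> /(fun h => etrans h E) /(congr1 (fun x => (n`!%:R^-1)%:E * x)%E).
rewrite muleA -EFinM mulVf // mul1e => ->; congr (_%:E).
rewrite mulrCA mulKf // -Re_realM; congr complex.Re.
rewrite [RHS]big_tnth mulr_sumr; apply: eq_bigr => x _.
rewrite [RHS]big_tnth mulr_sumr; apply: eq_bigr => y _.
rewrite mulrCA; congr (_ * _); rewrite mulrA; congr (_ * _).
exact: weight_ground_inv.
Qed.

(** Polarisation: recovers the real part of a product from nonnegative functions, the only ones that
    the intensities accept. *)
Lemma sum_cmod2_diff (x y : R[i]) :
  cmod (x + y) ^+ 2 - cmod (x - y) ^+ 2 = 4%:R * complex.Re (x * y^*%C).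
Proof. by rewrite !cmod_sqr; case: x => a b; case: y => e f /=; ring. Qed.

(* The value of E(X^a conj(X)^b); with [rweight] replaced by 1 it becomes the
   left-hand side of [ground_pairing]. *)
Definition pairing a b : R[i] :=
  iter a (raise d c) (fun e => (rweight e)%:C *
    iter b (lower d conjs) ((overlap R[i])^~ (ground n)) e) (ground n).

(** Adjointness turns the lowerings of the first argument of [overlap] into raisings of the second,
    whose expansion carries the conjugate coefficients. *)
Lemma pairingE a b : pairing a b =
  \sum_(x <- raise_terms d c a (ground n)) \sum_(y <- raise_terms d c b (ground n))
    x.1 * (y.1)^*%C * ((rweight x.2)%:C * overlap _ x.2 y.2).
Proof.
rewrite /pairing iter_raise_terms; apply: eq_bigr => x _.
rewrite -iter_raise_overlap.
have -> : iter b (raise d conjs) (overlap R[i] x.2) (ground n) =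
    (iter b (raise d c) (overlap R[i] x.2) (ground n))^*%C.
  rewrite conj_iter_raise; congr (iter b _ _ _).
  by apply/funext => e; rewrite conj_overlap.
rewrite iter_raise_terms conjc_sum !mulr_sumr; apply: eq_bigr => y _.
by rewrite conjcM conj_overlap -!mulrA; congr (_ * _); rewrite mulrCA.
Qed.

Let mX : cmeasurable X.
Proof.
apply: cmeasurable_sum => i; apply: cmeasurable_sum => k.
apply: cmeasurableM; first exact: cmeasurable_cst.
by apply: cmeasurableX; exact: cmeasurable_toC.
Qed.

Let mXt : cmeasurable (fun t : n.-tuple (plane R) => powersum d c (fun i => toC (tnth t i))).
Proof.
apply: cmeasurable_sum => i; apply: cmeasurable_sum => k.
apply: cmeasurableM; first exact: cmeasurable_cst.
by apply: cmeasurableX; apply: cmeasurable_toC; exact: measurable_tnth.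
Qed.

Let has_int_pm (eps : R[i]) a b : (a * d <= D)%N -> (b * d <= D)%N ->
  has_int P (fun w => cmod (X w ^+ a + eps * X w ^+ b) ^+ 2)
    (complex.Re (pairing a a + eps^*%C * pairing a b + eps * pairing b a +
       eps * eps^*%C * pairing b b)).
Proof.
move=> aD bD; pose La := raise_terms d c a (ground n).
pose Lb := [seq (eps * x.1, x.2) | x <- raise_terms d c b (ground n)].
have LD k : (k * d <= D)%N -> forall x, x \in raise_terms d c k (ground n) ->
    forall i, (x.2 i <= n + D)%N.
  move=> kD x xL i; have := above_bound i (raise_terms_above (above_ground n 0) xL).
  by move=> /leq_trans -> //; rewrite leq_add2l.
have -> : pairing a a + eps^*%C * pairing a b + eps * pairing b a +
       eps * eps^*%C * pairing b b =
    \sum_(x <- La ++ Lb) \sum_(y <- La ++ Lb)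
       x.1 * (y.1)^*%C * ((rweight x.2)%:C * overlap _ x.2 y.2).
  rewrite big_cat /=.
  under eq_bigr => x _ do rewrite big_cat /=.
  under [X in _ = _ + X]eq_bigr => x _ do rewrite big_cat /=.
  rewrite !big_split /= -!addrA !pairingE; congr (_ + (_ + (_ + _))).
  - rewrite mulr_sumr; apply: eq_bigr => x _; rewrite big_map mulr_sumr.
    by apply: eq_bigr => y _ /=; rewrite conjcM !mulrA [x.1 * _]mulrC.
  - rewrite big_map mulr_sumr; apply: eq_bigr => x _; rewrite mulr_sumr.
    by apply: eq_bigr => y _ /=; rewrite !mulrA.
  - rewrite big_map mulr_sumr; apply: eq_bigr => x _; rewrite big_map mulr_sumr.
    by apply: eq_bigr => y _ /=; rewrite conjcM !mulrA [eps * x.1 * _]mulrAC.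
apply: (@has_int_slater (fun t => powersum d c t ^+ a + eps * powersum d c t ^+ b)).
- move=> x; rewrite mem_cat => /orP[/(LD _ aD) //|/mapP [y yb ->] /=].
  exact: (LD _ bD).
- move=> t; rewrite big_cat big_map /= mulrDl -!iter_raise_terms.
  rewrite -(iter_raise_slater d c t a); congr (_ + _).
  rewrite -mulrA -(iter_raise_slater d c t b) iter_raise_terms mulr_sumr.
  by apply: eq_bigr => x _; rewrite mulrA.
- by move=> t s inj; rewrite powersum_perm.
- apply: cmeasurableD; first exact: cmeasurableX.
  by apply: cmeasurableM; [exact: cmeasurable_cst|exact: cmeasurableX].
- apply: cmeasurableD; first exact: cmeasurableX.
  by apply: cmeasurableM; [exact: cmeasurable_cst|exact: cmeasurableX].
Qed.

(** Polarising with the signs 1 and -1 gives the average of the two orders of [a] and [b]; both have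
    the same limit. *)
Lemma has_int_powersum a b : (a * d <= D)%N -> (b * d <= D)%N ->
  has_int P (fun w => complex.Re (X w ^+ a * (X w ^+ b)^*%C))
    ((complex.Re (pairing a b) + complex.Re (pairing b a)) / 2).
Proof.
move=> aD bD; have h1 := has_int_pm 1 aD bD; have h2 := has_int_pm (-1) aD bD.
have -> : (complex.Re (pairing a b) + complex.Re (pairing b a)) / 2 =
  4^-1 * (complex.Re (pairing a a + 1^*%C * pairing a b + 1 * pairing b a +
       1 * 1^*%C * pairing b b) -
   complex.Re (pairing a a + (-1)^*%C * pairing a b + (-1) * pairing b a +
       (-1) * (-1)^*%C * pairing b b)).
  rewrite !(rmorphN, rmorph1) !mulN1r !mul1r !opprK !mul1r !ReD !ReN.
  by field.
apply: eq_has_int (has_intZ 4^-1 (has_intB h1 h2)) => w.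
by rewrite mul1r mulN1r sum_cmod2_diff mulrA mulVf ?mul1r // pnatr_eq0.
Qed.

End Expectation.

(** * Comparison with equal weights *)

Section NearOne.
Context (R : realFieldType).
Implicit Types (delta : R).

Lemma prod_near1 (I : Type) (s : seq I) (P : pred I) (x : I -> R) delta :
  0 <= delta -> (forall i, P i -> `|x i - 1| <= delta) ->
  `|\prod_(i <- s | P i) x i - 1| <= (1 + delta) ^+ count P s - 1.
Proof.
move=> d0 xP; elim: s => [|i s IH] /=; first by rewrite big_nil expr0 !subrr normr0.
rewrite big_cons; case: ifPn => Pi //; rewrite add1n exprS.
set p := \prod_(_ <- _ | _) _ in IH *.
have -> : x i * p - 1 = (x i - 1) * (p - 1) + (x i - 1) + (p - 1) by ring.
apply: le_trans (ler_normD _ _) _; apply: le_trans (lerD (ler_normD _ _) (lexx _)) _.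
rewrite normrM; have := xP i Pi; set u := `|x i - 1|; set v := `|p - 1| in IH *.
have u0 : 0 <= u by exact: normr_ge0.
have v0 : 0 <= v by exact: normr_ge0.
by move=> ud; have := ler_pM u0 v0 ud IH; nra.
Qed.

(** Chord bound for the convex function (1 + x)^k on [0, 1]. *)
Lemma expr_near1 delta k : 0 <= delta <= 1 -> (1 + delta) ^+ k - 1 <= (2 ^+ k - 1) * delta.
Proof.
move=> /andP[d0 d1]; elim: k => [|k IH]; first by rewrite !expr0 !subrr mul0r.
have k1 : 1 <= 2 ^+ k :> R by rewrite exprn_ege1 // ler1n.
rewrite !exprS; move: IH k1; set y := (1 + delta) ^+ k; set z := 2 ^+ k => IH k1.
have z1 : 0 <= (z - 1) * delta by rewrite mulr_ge0 // subr_ge0.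
have h1 : (z - 1) * delta * delta <= (z - 1) * delta by rewrite ler_piMr.
have h2 : (1 + delta) * (y - 1) <= (1 + delta) * ((z - 1) * delta).
  by rewrite ler_wpM2l // addr_ge0.
by lra.
Qed.

Lemma prod_near1_le (I : Type) (s : seq I) (P : pred I) (x : I -> R) delta D :
  0 <= delta <= 1 -> (count P s <= D)%N -> (forall i, P i -> `|x i - 1| <= delta) ->
  `|\prod_(i <- s | P i) x i - 1| <= 2 ^+ D * delta.
Proof.
move=> d01 cD xP; have /andP[d0 d1] := d01.
apply: le_trans (prod_near1 s d0 xP) _; apply: le_trans (expr_near1 _ d01) _.
rewrite ler_wpM2r //; apply: (@le_trans _ _ (2 ^+ count P s)); first by rewrite gerBl.
by rewrite ler_weXn2l // ler1n.
Qed.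

(** The constant 4 comes from |x - y| <= 2 delta and y >= 1/2. *)
Lemma ratio_near1 (x y delta : R) : `|x - 1| <= delta -> `|y - 1| <= delta ->
  delta <= 2^-1 -> `|x / y - 1| <= 4 * delta.
Proof.
rewrite !ler_norml => /andP[x1 x2] /andP[y1 y2] d2.
have y0 : 0 < y by lra.
rewrite -(ler_pM2r y0) -[X in _ && X](ler_pM2r y0) mulrBl divfK ?gt_eqF //.
by apply/andP; split; nra.
Qed.

End NearOne.

Section PairingLimit.
Context (R : realType) (mu : probability (plane R) R) (n D d : nat) (c : nat -> R[i]).
Local Notation m k := (rmoment mu (2 * k)).
Local Notation conjs := (fun k => (c k)^*%C).
Variable (delta : R).
Hypothesis delta0 : 0 <= delta.
Hypothesis Ddelta : 2 ^+ D * delta <= 2^-1.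
Hypothesis Dn : (D + d <= n)%N.
Hypothesis mn0 : m n != 0.
Hypothesis near1 : forall j, (n <= j + D)%N -> (j <= n + D)%N -> `|m j / m n - 1| <= delta.

Lemma delta_le1 : delta <= 2^-1.
Proof.
apply: le_trans Ddelta; rewrite ler_peMl //.
by rewrite exprn_ege1 // ler1n.
Qed.

Hypothesis pos : forall k, (k < n)%N -> m k != 0.

Lemma rweight_perm (e : {ffun 'I_n -> nat}) s :
  rweight mu (permexp e s) = rweight mu e.
Proof.
rewrite /rweight !prodf_div; congr (_ / _).
rewrite [RHS](reindex_inj (@perm_inj _ s)); apply: eq_bigr => i _.
by rewrite ffunE.
Qed.

(** Levels below n - D contribute 1. For the others, at most D, numerators and denominators are
    compared separately with [m n]; each product is within 2^D delta of 1, and [Ddelta] keeps the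
    denominator at least 1/2. *)
Lemma rweight_near1 (e : {ffun 'I_n -> nat}) : above D e -> injectiveb e ->
  `|rweight mu e - 1| <= 4 * (2 ^+ D * delta).
Proof.
move=> aD inj.
have d01 : 0 <= delta <= 1.
  by rewrite delta0 (le_trans delta_le1) // invf_le1 // ler1n.
have cD : (count (fun i : 'I_n => n <= i + D)%N (index_enum 'I_n) <= D)%N.
  rewrite -sum1_count; apply: leq_trans (_ : (\sum_(n - D <= j < n) 1 <= _)%N); last first.
    by rewrite sum_nat_const_nat; lia.
  rewrite -(big_mkord (fun i => n <= i + D)%N (fun=> 1%N)).
  rewrite (@big_cat_nat _ _ _ (n - D)) ?leq_subr //= big_nat_cond big1 ?add0n => [|i]; last lia.
  by rewrite [X in (X <= _)%N]big_mkcond; apply: leq_sum => i _; case: ifP.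
have -> : rweight mu e = (\prod_(i < n | (n <= i + D)%N) (m (e i) / m n)) /
    (\prod_(i < n | (n <= i + D)%N) (m i / m n)).
  rewrite -prodf_div /rweight (bigID (fun i : 'I_n => n <= i + D)%N) /=.
  rewrite [X in _ * X]big1 ?mulr1 => [|i]; last first.
    by rewrite -ltnNge => iD; rewrite (above_fixed aD inj iD) divff // pos.
  apply: eq_bigr => i iD; rewrite invf_div mulrA -[_ / m n * m n]mulrA.
  by rewrite mulVf // mulr1.
apply: ratio_near1 => //; apply: prod_near1_le => // i iD; apply: near1 => //.
- move: aD => /andP[/forallP /(_ i) ie _]; lia.
- exact: above_bound.
- by have := ltn_ord i; lia.
Qed.

(** By linearity the error is the same expression with [rweight - 1] in place of [rweight], which is
    small on the vectors with distinct exponents that are reached. [iter_raise_bound] serves twice: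
    for the [a] raisings and, through adjointness, for the [b] lowerings. *)
Lemma pairing_near a b : (a.+1 * d <= D)%N -> (b * d <= D)%N ->
  `|pairing mu n d c a b -
    (a == b)%:R * (a`!%:R * (\sum_(k < d) k.+1%:R * (c k * (c k)^*%C)) ^+ a)| <=
  (D%:R * \sum_(k < d) `|c k|) ^+ a *
    ((4 * (2 ^+ D * delta))%:C * (D%:R * \sum_(k < d) `|(c k)^*%C|) ^+ b).
Proof.
move=> aD bD; have aDn : (a.+1 * d <= n)%N by lia.
rewrite -(ground_pairing c conjs b aDn).
pose Phi e := iter b (lower d conjs) ((overlap R[i])^~ (ground n)) e.
have aPhi : alternating Phi.
  by apply: alternating_iter_lower; apply: alternating_overlapl.
have -> : pairing mu n d c a b - iter a (raise d c) Phi (ground n) =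
   iter a (raise d c) (fun e => ((rweight mu e)%:C - 1) * Phi e) (ground n).
  rewrite /pairing !iter_raise_terms -sumrB; apply: eq_bigr => x _.
  by rewrite -mulrBr mulrBl mul1r.
have B0 : 0 <= (4 * (2 ^+ D * delta))%:C * (D%:R * \sum_(k < d) `|(c k)^*%C|) ^+ b.
  rewrite mulr_ge0 ?exprn_ge0 ?mulr_ge0 ?sumr_ge0 // ler0c.
  by rewrite mulr_ge0 // mulr_ge0 // exprn_ge0.
apply: (@iter_raise_bound _ _ _ _ _ a 0) => //; last 2 first.
- exact: above_ground.
- by rewrite add0n (leq_trans _ aD) // leq_mul2r leqnSn orbT.
- by move=> e i j ij; rewrite rweight_perm aPhi // mulrN.
move=> e aDe; have [inj|ninj] := boolP (injectiveb e); last first.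
  by rewrite (alternating_noninj aPhi ninj) mulr0 normr0.
rewrite normrM ler_pM //.
  have -> : (rweight mu e)%:C - 1 = (rweight mu e - 1)%:C.
    by rewrite -[RHS]/(real_complex R _) rmorphB rmorph1.
  rewrite normc_def /= expr0n addr0 sqrtr_sqr lecR.
  exact: rweight_near1.
rewrite /Phi -iter_raise_overlap -[X in _ <= X]mulr1.
apply: (@iter_raise_bound _ _ _ _ _ b 0 D) => //.
- exact: alternating_overlapr.
- by move=> *; exact: overlap_norm_le1.
- exact: above_ground.
Qed.

End PairingLimit.

(** * Integrability at the points and the mean of the statistic *)

Section ExpectationLinear.
Context (R : realType) (mu : probability (plane R) R) (n : nat).
Context (d0 : measure_display) (T : measurableType d0) (P : probability T R)
  (Z : 'I_n -> {RV P >-> plane R}).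
Variables (D : nat) (K : R[i] -> R[i] -> R[i]).
Hypothesis rot : rotation_invariant mu.
Hypothesis fin : (moment mu (2 * (n + D)) < +oo)%E.
Hypothesis pos : forall k, (k < n)%N -> 0 < rmoment mu (2 * k).
Hypothesis KK : is_projection_kernel mu n K.
Hypothesis ZK : has_determinantal_intensities mu K Z.
Local Notation m k := (rmoment mu (2 * k)).

(** The one-point intensity controls the sum over all points, which dominates each labelled one.
    Since K(z, z) is a combination of |z|^(2j) with j < n, moments up to level n + D suffice. *)
Lemma point_moment k (i : 'I_n) : (k <= D)%N ->
  (\int[P]_w (cmod (toC (Z i w)) ^+ (2 * k))%:E < +oo)%E.
Proof.
move=> kD.
have mh : measurable_fun setT (fun t : 1.-tuple (plane R) =>
    (cmod (toC (tnth t ord0)) ^+ (2 * k))%:E).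
  apply/measurable_EFinP; apply: (measurableT_comp (@measurable_cmodX R k)).
  exact: measurable_tnth.
have h0 (t : 1.-tuple (plane R)) : (0 <= (cmod (toC (tnth t ord0)) ^+ (2 * k))%:E)%E.
  by rewrite lee_fin exprn_ge0 // cmod_ge0.
have mZ (j : 'I_n) : measurable_fun setT (fun w => (cmod (toC (Z j w)) ^+ (2 * k))%:E).
  apply/measurable_EFinP; apply: (measurableT_comp (@measurable_cmodX R k)).
  by [].
apply: (@le_lt_trans _ _ (\int[P]_w \sum_(s : {ffun 'I_1 -> 'I_n} | injectiveb s)
  (cmod (toC (tnth [tuple Z (s j) w | j < 1] ord0)) ^+ (2 * k))%:E)%E).
  apply: ge0_le_integral => //.
  - by move=> w _; rewrite lee_fin exprn_ge0 // cmod_ge0.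
  - rewrite (_ : (fun w => _) = (fun w => \sum_(s <- [seq s : {ffun 'I_1 -> 'I_n} <- index_enum {ffun 'I_1 -> 'I_n} | injectiveb s])
      (cmod (toC (Z (s ord0) w)) ^+ (2 * k))%:E)%E).
      by apply: emeasurable_sum => s.
    apply/funext => w; rewrite big_filter; apply: eq_bigr => s _.
    by rewrite tnth_mktuple.
  - move=> w _; pose s0 : {ffun 'I_1 -> 'I_n} := [ffun=> i].
    have s0i : injectiveb s0 by apply/injectiveP => x y _; rewrite (ord1 x) (ord1 y).
    rewrite (bigD1 s0) //= tnth_mktuple ffunE leeDl //.
    by apply: sume_ge0 => s _; rewrite lee_fin exprn_ge0 // cmod_ge0.
rewrite (ZK mh h0) /=.
have fin0 : (moment mu (2 * n) < +oo)%E by have := moment_fin fin (leq_addr D n).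
have h : has_int mu (fun z => \sum_(j < n) (m j)^-1 * cmod (toC z) ^+ (2 * (k + j)))
    (\sum_(j < n) (m j)^-1 * m (k + j)).
  apply: has_int_sum => j _; apply: has_intZ; apply: (has_moment fin).
  by have := ltn_ord j; lia.
have -> : (\int[mu]_z ((cmod (toC (tnth [tuple of z :: [tuple]] ord0)) ^+ (2 * k))%:E *
    (complex.Re (\det (\matrix_(i0 < 1, j < 1) K (toC (tnth [tuple of z :: [tuple]] i0))
      (toC (tnth [tuple of z :: [tuple]] j)))))%:E) =
   \int[mu]_z (\sum_(j < n) (m j)^-1 * cmod (toC z) ^+ (2 * (k + j)))%:E)%E.
  apply: eq_integral => z _; rewrite det_mx11 mxE tnth0.
  rewrite (projection_kernelE rot fin0 pos KK) -EFinM; congr (_%:E).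
  rewrite Re_sum mulr_sumr; apply: eq_bigr => j _.
  rewrite Re_realM mulrCA; congr (_ * _).
  by rewrite -conjcX -cmod2_conj /= cmodX -exprM -exprD (mulnC j) mulnDr.
by case: h => _ ->; rewrite ltry.
Qed.

Lemma integrable_mono k (i : 'I_n) (a : R[i]) : (k <= D)%N ->
  has_cint P (fun w => a * toC (Z i w) ^+ k) (cint P (fun w => a * toC (Z i w) ^+ k)).
Proof.
move=> kD; have := point_moment i kD; set v := (\int[P]_w _)%E => vfin.
have mZk : measurable_fun setT (fun w => cmod (toC (Z i w)) ^+ (2 * k)).
  apply: (measurableT_comp (@measurable_cmodX R k)); by [].
have hv : has_int P (fun w => cmod (toC (Z i w)) ^+ (2 * k)) (fine v).
  apply: has_int_ge0 => //; first by move=> w; rewrite exprn_ge0 // cmod_ge0.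
  rewrite fineK // ge0_fin_numE //; apply: integral_ge0 => w _.
  by rewrite lee_fin exprn_ge0 // cmod_ge0.
have [m1 m2] : cmeasurable (fun w => a * toC (Z i w) ^+ k).
  apply: cmeasurableM; first exact: cmeasurable_cst.
  by apply: cmeasurableX; exact: cmeasurable_toC.
have dom := has_intZ (cmod a) (has_intD (has_int_cst P 1) hv).
have le1 w : cmod (a * toC (Z i w) ^+ k) <= cmod a * (1 + cmod (toC (Z i w)) ^+ (2 * k)).
  rewrite cmodM cmodX ler_wpM2l ?cmod_ge0 // expr_le_1D ?cmod_ge0 //; lia.
split; [apply: (has_int_dom m1 dom)|apply: (has_int_dom m2 dom)] => w.
  exact: le_trans (Re_le_cmod _) (le1 w).
exact: le_trans (Im_le_cmod _) (le1 w).
Qed.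

Lemma integrable_poly (f : {poly R[i]}) (i : 'I_n) : (size f <= D.+1)%N ->
  has_cint P (fun w => f.[toC (Z i w)]) (cint P (fun w => f.[toC (Z i w)])).
Proof.
move=> sf.
have h : has_cint P (fun w => f.[toC (Z i w)])
   (\sum_(k < size f) cint P (fun w => f`_k * toC (Z i w) ^+ k)).
  apply: (eq_has_cint _ (has_cint_sum (index_enum 'I_(size f)) (fun k : 'I_(size f) =>
    integrable_mono i f`_k (_ : (k <= D)%N)))) => [w|k].
    by rewrite horner_coef.
  by have := ltn_ord k; lia.
by rewrite (has_cintE h).
Qed.

Variables (d : nat) (c : nat -> R[i]).
Hypothesis dD : (d <= D)%N.

Lemma pairing01 c' : pairing mu n d c' 0 1 = 0.
Proof. by rewrite /pairing /= lower_ground ?mulr0 //; exact: alternating_overlapl. Qed.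

Lemma pairing10 c' : pairing mu n d c' 1 0 = 0.
Proof.
rewrite /pairing /=; apply: (@raise_degree0 _ _ _ _ _ (\sum_(i < n) ground n i)%N) => // e he.
by rewrite overlap_degree // mulr0.
Qed.

(** The case a = 1, b = 0 of the mixed moments. With the coefficients left arbitrary, the imaginary
    part is the real part for the coefficients multiplied by -i. *)
Lemma has_int_Re_powersum c' :
  has_int P (fun w => complex.Re (powersum d c' (fun i => toC (Z i w)))) 0.
Proof.
have d1 : (1 * d <= D)%N by rewrite mul1n.
have := has_int_powersum c' rot fin pos KK ZK (a := 1) (b := 0) d1 (leq0n _).
rewrite pairing01 pairing10 /= addr0 mul0r; apply: eq_has_int => w.
by rewrite expr1 -[1 -i* 0]/(conjc 1) conjc1 mulr1.
Qed.

Lemma has_cint_powersum : has_cint P (fun w => powersum d c (fun i => toC (Z i w))) 0.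
Proof.
split; first exact: has_int_Re_powersum.
apply: eq_has_int (has_int_Re_powersum (fun k => (0 -i* 1) * c k)) => w.
have ImE (z : R[i]) : complex.Im z = complex.Re ((0 -i* 1) * z).
  by rewrite ReM /= mul0r mulN1r opprK add0r.
rewrite ImE; congr complex.Re; rewrite /powersum mulr_sumr; apply: eq_bigr => i _.
by rewrite mulr_sumr; apply: eq_bigr => k _; rewrite mulrA.
Qed.

End ExpectationLinear.

Section MomentPositivity.
Context (R : realType) (mu : probability (plane R) R) (n : nat).
Hypothesis fin : (moment mu (2 * n) < +oo)%E.
Hypothesis neq0 : rmoment mu (2 * n) != 0.

(** If a moment of positive order vanished, z would be 0 almost everywhere and the moment of order
    2n would vanish too; the moment of order 0 is 1. *)
Lemma rmoment_gt0 k : (k <= n)%N -> 0 < rmoment mu (2 * k).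
Proof.
move=> kn; have [h0 hE] := has_moment fin kn.
have m0 : 0 <= rmoment mu (2 * k).
  by rewrite -lee_fin -hE; apply: integral_ge0 => z _; rewrite lee_fin exprn_ge0 // cmod_ge0.
rewrite lt_neqAle m0 andbT eq_sym; apply/eqP => mk0; rewrite mk0 in hE.
case: k => [|k] in kn h0 hE {m0 mk0} *.
  move: hE; rewrite muln0; under eq_integral => z _ do rewrite expr0.
  by have [_ ->] := has_int_cst mu 1; move/eqP; rewrite eqe oner_eq0.
have ae0 : ae_eq mu setT (fun z => (cmod (toC z) ^+ (2 * k.+1))%:E) (cst 0%E).
  apply/ae_eq_integral_abs => //.
    by apply/measurable_EFinP; exact: measurable_cmodX.
  rewrite -[RHS]hE; apply: eq_integral => z _.
  by rewrite gee0_abs // lee_fin exprn_ge0 // cmod_ge0.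
have [hn hnE] := has_moment fin (leqnn n).
move: neq0 => /eqP; apply; apply: EFin_inj; rewrite -hnE.
rewrite (ge0_ae_eq_integral (g := cst 0%E)) //.
- exact: integral0.
- by apply/measurable_EFinP; exact: measurable_cmodX.
- by move=> z _; rewrite lee_fin exprn_ge0 // cmod_ge0.
apply: filterS ae0 => z zE _; have /eqP := zE I.
rewrite /= eqe expf_eq0 /= => /eqP ->; rewrite expr0n muln_eq0 /=.
by case: (n) kn.
Qed.

End MomentPositivity.

Section Eventually.
Context (R : realType) (mu : nat -> probability (plane R) R).
Hypothesis mu_ratio : forall m : int,
  moment_ratio (mu n) n m @[n --> \oo] --> (1 : R).

Lemma near_moments D (delta : R) : 0 < delta -> \forall n \near \oo,
  [/\ (moment (mu n) (2 * (n + D)) < +oo)%E,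
      forall k, (k <= n)%N -> 0 < rmoment (mu n) (2 * k) &
      forall j, (n <= j + D)%N -> (j <= n + D)%N ->
        `|rmoment (mu n) (2 * j) / rmoment (mu n) (2 * n) - 1| <= delta].
Proof.
(* Staying within 1/2 of 1 excludes the ratio 0, hence vanishing moments and also infinite ones,
   whose [fine] is 0. *)
move=> delta0; pose dl := Num.min delta 2^-1.
have dl0 : 0 < dl by rewrite lt_min delta0 invr_gt0 ltr0n.
(* The finitely many shifts from -D to D are treated simultaneously. *)
have near1 : \forall n \near \oo, forall i : 'I_(D + D).+1,
    `|moment_ratio (mu n) n (i%:Z - D%:Z) - 1| <= dl.
  apply: filter_forall => i.
  have := mu_ratio (i%:Z - D%:Z) => /cvgr_distC_le /(_ _ dl0); apply: filterS => n.
  by rewrite distrC.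
near=> n.
have nD : (D < n)%N by near: n; exact: nbhs_infty_gt.
have n1 : forall i : 'I_(D + D).+1, `|moment_ratio (mu n) n (i%:Z - D%:Z) - 1| <= dl.
  by near: n.
have ratioE j : (n <= j + D)%N -> (j <= n + D)%N ->
    `|rmoment (mu n) (2 * j) / rmoment (mu n) (2 * n) - 1| <= dl.
  move=> j1 j2; have iD : (j + D - n < (D + D).+1)%N by lia.
  have := n1 (Ordinal iD); rewrite /moment_ratio /rmoment.
  congr (is_true (`|fine (moment _ _) / _ - 1| <= _)).
  by rewrite /=; lia.
have neq0 j : (n <= j + D)%N -> (j <= n + D)%N -> rmoment (mu n) (2 * j) != 0.
  move=> j1 j2; apply/eqP => mj0; have := ratioE j j1 j2.
  rewrite mj0 mul0r sub0r normrN1 => h.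
  have : dl <= 2^-1 by rewrite ge_min lexx orbT.
  by lra.
have finD : (moment (mu n) (2 * (n + D)) < +oo)%E.
  have := neq0 (n + D)%N; rewrite /rmoment ltey => h.
  by apply/negP => /eqP E; move: h; rewrite E /= eqxx; lia.
split => //.
- have fin0 : (moment (mu n) (2 * n) < +oo)%E.
    by have := moment_fin finD (leq_addr D n).
  by move=> k kn; apply: (@rmoment_gt0 R (mu n) n) => //; apply: neq0; lia.
- move=> j j1 j2; apply: le_trans (ratioE j j1 j2) _.
  by rewrite ge_min lexx.
Unshelve. all: by end_near.
Qed.

Lemma near_pairing d (c : nat -> R[i]) a b (eps : R) : 0 < eps ->
  \forall n \near \oo, `|complex.Re (pairing (mu n) n d c a b) -
    (a == b)%:R * (a`!%:R * (\sum_(k < d) k.+1%:R * cmod (c k) ^+ 2) ^+ a)| <= eps.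
Proof.
(* Large enough for the [a.+1] steps that [pairing_near] asks for on one side and the [b] on the
   other. *)
move=> eps0; pose D := ((a.+1 + b) * d)%N.
pose C := (D%:R * \sum_(k < d) cmod (c k)) ^+ a * (D%:R * \sum_(k < d) cmod (c k)) ^+ b.
have C0 : 0 <= C.
  by rewrite mulr_ge0 // exprn_ge0 // mulr_ge0 // sumr_ge0 // => k _; exact: cmod_ge0.
(* The first bound gives 2^D delta <= 1/2, the second makes the error 4 2^D delta C at most eps; C +
   1 avoids a division by 0. *)
pose delta := Num.min (2 ^+ D.+1)^-1 (eps / (4 * 2 ^+ D * (C + 1))).
have p0 k : 0 < 2 ^+ k :> R by rewrite exprn_gt0.
have C1 : 0 < C + 1 by rewrite ltr_wpDl.
have delta0 : 0 < delta.
  by rewrite lt_min invr_gt0 p0 divr_gt0 // mulr_gt0 // mulr_gt0.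
near=> n.
have [fin pos n1] : [/\ (moment (mu n) (2 * (n + D)) < +oo)%E,
      forall k, (k <= n)%N -> 0 < rmoment (mu n) (2 * k) &
      forall j, (n <= j + D)%N -> (j <= n + D)%N ->
        `|rmoment (mu n) (2 * j) / rmoment (mu n) (2 * n) - 1| <= delta].
  by near: n; exact: near_moments.
have Dd : 2 ^+ D * delta <= 2^-1.
  apply: le_trans (_ : 2 ^+ D * (2 ^+ D.+1)^-1 <= _).
    by rewrite ler_pM2l // ge_min lexx.
  by rewrite exprS invfM mulrCA divff ?mulr1 // gt_eqF.
have nD : (D + d <= n)%N by near: n; exact: nbhs_infty_ge.
have := @pairing_near R (mu n) n D d c delta (ltW delta0) Dd nD _ n1 _ a b _ _.
have -> : \sum_(k < d) k.+1%:R * (c k * (c k)^*%C) =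
    (\sum_(k < d) k.+1%:R * cmod (c k) ^+ 2)%:C.
  by rewrite realC_sum; apply: eq_bigr => k _; rewrite -cmod2_conj realCM realC_nat.
have normE (z : R[i]) : `|z| = (cmod z)%:C by rewrite normc_def.
have -> : \sum_(k < d) `|c k| = (\sum_(k < d) cmod (c k))%:C.
  by rewrite realC_sum; apply: eq_bigr => k _; rewrite normE.
have -> : \sum_(k < d) `|(c k)^*%C| = (\sum_(k < d) cmod (c k))%:C.
  by rewrite realC_sum; apply: eq_bigr => k _; rewrite normE cmodJ.
set S := \sum_(k < d) cmod _; set s := \sum_(k < d) _ * _.
move=> /(_ _ _ _ _) h.
have {}h : `|pairing (mu n) n d c a b - ((a == b)%:R * (a`!%:R * s ^+ a))%:C| <=
    (4 * (2 ^+ D * delta) * C)%:C.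
  have -> : ((a == b)%:R * (a`!%:R * s ^+ a))%:C = (a == b)%:R * (a`!%:R * s%:C ^+ a).
    by rewrite !(realCM, realCX, realC_nat).
  have -> : (4 * (2 ^+ D * delta) * C)%:C =
     (D%:R * S%:C) ^+ a * ((4 * (2 ^+ D * delta))%:C * (D%:R * S%:C) ^+ b).
    by rewrite /C mulrCA [LHS]realCM; congr (_ * _); rewrite !(realCM, realCX, realC_nat).
  apply: h.
  - by rewrite gt_eqF // pos.
  - by move=> k kn; rewrite gt_eqF // pos // ltnW.
  - by rewrite /D leq_mul2r leq_addr orbT.
  - by rewrite /D leq_mul2r leq_addl orbT.
rewrite normE lecR in h.
apply: le_trans (_ : 4 * (2 ^+ D * delta) * C <= _).
  apply: le_trans h; apply: le_trans (Re_le_cmod _).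
  by rewrite ReD ReN.
have : delta <= eps / (4 * 2 ^+ D * (C + 1)) by rewrite ge_min lexx orbT.
rewrite ler_pdivlMr; last by rewrite mulr_gt0 // mulr_gt0.
have q0 : 0 <= 4 * 2 ^+ D * delta by rewrite mulr_ge0 ?(ltW delta0) // mulr_ge0 // ltW.
apply: le_trans; have -> : delta * (4 * 2 ^+ D * (C + 1)) =
  4 * (2 ^+ D * delta) * C + 4 * 2 ^+ D * delta by ring.
by rewrite lerDl.
Unshelve. all: by end_near.
Qed.

End Eventually.

(** * From moments to convergence in distribution *)

Section NormalMoments.
Context (R : realType).
Local Notation leb := (@lebesgue_measure R).
Local Notation phi := (@normal_pdf R 0 1).

Lemma normal_pdf01E x :
  phi x = normal_peak 1 * expR (((- 2^-1)%:P * 'X^2 : {poly R}).[x]).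
Proof.
rewrite normal_pdfE ?oner_eq0 // /normal_fun; congr (_ * expR _).
by rewrite hornerM hornerC hornerXn subr0 expr1n; field.
Qed.

Lemma is_derive_normal_pdf (x : R) : is_derive x 1 phi (- x * phi x).
Proof.
rewrite normal_pdf01E (funext normal_pdf01E).
have := is_deriveZ (normal_peak 1) (is_derive1_comp (is_derive_expR _)
  (is_derive_poly ((- 2^-1)%:P * 'X^2 : {poly R}) x)).
set v := (_ *: _) => h; suff <- : v = - x * (normal_peak 1 *
  expR ((- 2^-1)%:P * 'X^2 : {poly R}).[x]) by exact: h.
rewrite /v derivM derivC mul0r add0r derivXn !hornerM !hornerC hornerMn !hornerXn.
by rewrite -[_ *: _]/(_ * _) expr1; field.
Qed.

Lemma is_derive_mono_pdf k (x : R) :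
  is_derive x 1 (fun y => y ^+ k * phi y) (k%:R * x ^+ k.-1 * phi x - x ^+ k.+1 * phi x).
Proof.
have := is_deriveM (is_derive_poly ('X^k : {poly R}) x) (is_derive_normal_pdf x).
set v := (_ + _) => h; suff <- : v = k%:R * x ^+ k.-1 * phi x - x ^+ k.+1 * phi x.
  by have -> : (fun y => y ^+ k * phi y) = horner 'X^k * phi;
    [apply/funext => y; rewrite -[RHS]/(_ * _) hornerXn|exact: h].
by rewrite /v derivXn hornerMn !hornerXn -![_ *: _]/(_ * _) exprS; ring.
Qed.

Lemma continuous_mono_pdf k : continuous (fun x : R => x ^+ k * phi x).
Proof.
move=> x; apply: cvgM; first by have := @continuous_horner _ ('X^k : {poly R}) x;
  rewrite (_ : horner 'X^k = fun y => y ^+ k) //; apply/funext => y; rewrite hornerXn.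
exact: continuous_normal_pdf (oner_neq0 _) _.
Qed.

Lemma integrable_mono_pdf k (A : R) :
  leb.-integrable `[- A, A]%classic (EFin \o (fun x => x ^+ k * phi x)).
Proof.
apply: continuous_compact_integrable; first exact: segment_compact.
by apply: continuous_subspaceT; exact: continuous_mono_pdf.
Qed.

(** Integration by parts from phi' = - x phi. The boundary terms cancel for moments of odd order and
    tend to 0 for those of even order. *)
Lemma mono_pdf_parts k (A : R) : 0 < A ->
  (\int[leb]_(x in `[(- A)%R, A]) (x ^+ k.+1 * phi x)%:E =
   k%:R%:E * \int[leb]_(x in `[(- A)%R, A]) (x ^+ k.-1 * phi x)%:E -
   (A ^+ k * phi A - (- A) ^+ k * phi (- A))%:E)%E.
Proof.
move=> A0; have AA : - A < A by rewrite gtrN.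
have := @continuous_FTC2 R (fun x => k%:R * x ^+ k.-1 * phi x - x ^+ k.+1 * phi x)
  (fun y => y ^+ k * phi y) (- A) A AA _ _ _.
have c1 : continuous (fun y : R => y ^+ k * phi y) by exact: continuous_mono_pdf.
move=> /(_ _ _ _) h.
have {h} : (\int[leb]_(x in `[(- A)%R, A]) (k%:R * x ^+ k.-1 * phi x - x ^+ k.+1 * phi x)%:E =
  (A ^+ k * phi A - (- A) ^+ k * phi (- A))%:E)%E.
  rewrite h ?EFinB //.
  - apply: continuous_subspaceT => x; apply: cvgB; last exact: continuous_mono_pdf.
    rewrite -mulrA; under eq_fun do rewrite -mulrA.
    by apply: cvgM; [exact: cvg_cst|exact: continuous_mono_pdf].
  - split; [by move=> x _; have [] := is_derive_mono_pdf k x| |].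
      by apply: cvg_at_right_filter; exact: c1.
    by apply: cvg_at_left_filter; exact: c1.
  - by move=> x _; rewrite derive1E; have [_ ->] := is_derive_mono_pdf k x.
move=> <-; have i1 := integrable_mono_pdf k.-1 A; have i2 := integrable_mono_pdf k.+1 A.
have -> : (\int[leb]_(x in `[(- A)%R, A]) (k%:R * x ^+ k.-1 * phi x - x ^+ k.+1 * phi x)%:E =
  k%:R%:E * \int[leb]_(x in `[(- A)%R, A]) (x ^+ k.-1 * phi x)%:E -
  \int[leb]_(x in `[(- A)%R, A]) (x ^+ k.+1 * phi x)%:E)%E.
  rewrite -integralZl //= -integralB //; last exact: integrableZl.
  by apply: eq_integral => x _; rewrite -EFinM -EFinB mulrA.
have f1 : (\int[leb]_(x in `[(- A)%R, A]) (x ^+ k.-1 * phi x)%:E \is a fin_num)%E.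
  exact: integrable_fin_num i1.
have f2 : (\int[leb]_(x in `[(- A)%R, A]) (x ^+ k.+1 * phi x)%:E \is a fin_num)%E.
  exact: integrable_fin_num i2.
rewrite -(fineK f1) -(fineK f2) -!(EFinM, EFinB); congr (_%:E).
by rewrite opprB addrC subrK.
Qed.

Lemma normal_pdfN (x : R) : phi (- x) = phi x.
Proof. rewrite !normal_pdf01E; congr (_ * expR _).
by rewrite [LHS]hornerM [RHS]hornerM !hornerXn !hornerC sqrrN. Qed.

(** From exp(A^2/2) >= (A^2/2)^(k+1) / (k+1)!: what remains is C / A^(k+1), at most C / A for A >=
    1. *)
Lemma mono_pdf_le k : exists2 C : R, 0 <= C & forall A, 1 <= A ->
  A ^+ k.+1 * phi A <= C / A.
Proof.
exists (normal_peak 1 * ((k.+1)`!%:R * 2 ^+ k.+1)) => [|A A1].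
  by rewrite mulr_ge0 ?normal_peak_ge0 // mulr_ge0 // exprn_ge0.
have A0 : 0 < A by rewrite (lt_le_trans ltr01).
have p0 j : 0 < A ^+ j by rewrite exprn_gt0.
rewrite normal_pdf01E mulrCA -mulrA ler_wpM2l ?normal_peak_ge0 //.
rewrite hornerM hornerC hornerXn mulNr expRN.
have y0 : 0 <= 2^-1 * A ^+ 2 by rewrite mulr_ge0 // ltW.
have e1 : A ^+ k.+1 * A ^+ k.+1 / ((k.+1)`!%:R * 2 ^+ k.+1) <= expR (2^-1 * A ^+ 2).
  apply: le_trans (expR_ge1Dxn k y0); apply: le_trans (_ : (2^-1 * A ^+ 2) ^+ k.+1 / (k.+1)`!%:R <= _).
    rewrite exprMn exprVn -exprM mul2n -addnn exprD invfM le_eqVlt; apply/orP; left.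
    by apply/eqP; rewrite [_^-1 * _]mulrC [LHS]mulrA; congr (_ * _); rewrite mulrC.
  by rewrite lerDr.
have q0 : 0 < (k.+1)`!%:R * 2 ^+ k.+1 :> R.
  by rewrite mulr_gt0 ?exprn_gt0 // ltr0n fact_gt0.
rewrite ler_pdivrMr ?expR_gt0 //.
apply: le_trans (_ : (k.+1)`!%:R * 2 ^+ k.+1 / A *
   (A ^+ k.+1 * A ^+ k.+1 / ((k.+1)`!%:R * 2 ^+ k.+1)) <= _); last first.
  by rewrite ler_wpM2l // divr_ge0 // ltW.
have Ak : A <= A ^+ k.+1 by rewrite exprS ler_peMr ?(ltW A0) // exprn_ege1.
move: q0; set q := (X in 0 < X) => q0; set a := A ^+ k.+1.
have -> : q / A * (a * a / q) = a * (a / A) by field; rewrite !gt_eqF.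
by rewrite ler_peMr ?(ltW (p0 _)) // ler_pdivlMr // mul1r.
Qed.

Lemma cvg_mono_pdf k : (n.+1%:R ^+ k.+1 * phi n.+1%:R) @[n --> \oo] --> (0 : R).
Proof.
have [C C0 CP] := mono_pdf_le k.
apply: (@squeeze_cvgr _ _ _ _ (fun=> 0) (fun n => C / n.+1%:R)).
- near=> n; rewrite CP ?ler1n // andbT mulr_ge0 ?exprn_ge0 //.
  exact: normal_pdf_ge0.
- exact: cvg_cst.
- rewrite -[X in _ --> X](mulr0 C); apply: cvgM; first exact: cvg_cst.
  exact: cvg_harmonic.
Unshelve. all: by end_near.
Qed.

(** For even k this is the double factorial (k - 1)!!, in the form that cancels against the k! of a
    Taylor series. *)
Definition normal_moment (k : nat) : R :=
  if odd k then 0 else k`!%:R / (2 ^+ k./2 * (k./2)`!%:R).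

Local Notation symitv n := `[(- n.+1%:R)%R : R, n.+1%:R]%classic.

Lemma bigcup_symitv : \bigcup_(n : nat) symitv n = setT.
Proof.
apply/seteqP; split => // x _; exists (Num.bound `|x|) => //=.
have h : `|x| <= (Num.bound `|x|).+1%:R.
  rewrite (le_trans (ltW (archi_boundP (normr_ge0 x)))) // ler_nat.
  exact: leqnSn.
by rewrite in_itv /= -ler_norml.
Qed.

Lemma cvg_integral_symitv (f : measurableTypeR R -> R) : measurable_fun setT f -> (forall x, 0 <= f x) ->
  (\int[leb]_(x in symitv n) (f x)%:E)%E @[n --> \oo] --> (\int[leb]_x (f x)%:E)%E.
Proof.
move=> mf f0.
have := @ge0_nondecreasing_set_cvg_integral _ (measurableTypeR R) R (fun n => symitv n) (EFin \o f) leb.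
rewrite bigcup_symitv; apply => //.
- move=> m n mn; apply/subsetPset => x /=; rewrite !in_itv /= => /andP[x1 x2].
  have mn' : m.+1%:R <= n.+1%:R :> R by rewrite ler_nat.
  by rewrite (le_trans _ x1) ?lerN2 // (le_trans x2).
- by move=> n; apply/measurable_EFinP; exact: measurable_funS mf.
- by move=> n x _; rewrite lee_fin.
Qed.

Let b k n := fine (\int[leb]_(x in symitv n) (x ^+ k * phi x)%:E)%E.

Let bE k n : (\int[leb]_(x in symitv n) (x ^+ k * phi x)%:E)%E = (b k n)%:E.
Proof.
rewrite /b fineK //; have := integrable_mono_pdf k n.+1%:R => i.
exact: integrable_fin_num i.
Qed.

Let b_parts k n : b k.+1 n = k%:R * b k.-1 n -
  (n.+1%:R ^+ k * phi n.+1%:R - (- n.+1%:R) ^+ k * phi (- n.+1%:R)).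
Proof.
have n0 : 0 < n.+1%:R :> R by rewrite ltr0n.
by have := mono_pdf_parts k n0; rewrite !bE -EFinM -EFinB => -[].
Qed.

Lemma normal_moment_rec k : normal_moment k.+2 = k.+1%:R * normal_moment k.
Proof.
rewrite /normal_moment /= negbK; case: ifPn => [_|ek]; first by rewrite mulr0.
have p0 j : 2 ^+ j != 0 :> R by rewrite expf_neq0 // pnatr_eq0.
have f0 j : j`!%:R != 0 :> R by rewrite pnatr_eq0 -lt0n fact_gt0.
have E : k.+2%:R = 2 * (k./2).+1%:R :> R.
  by rewrite -natrM; congr (_%:R); have := odd_double_half k; lia.
have h0 : (k./2).+1%:R != 0 :> R by rewrite pnatr_eq0.
rewrite !factS !natrM E exprS.
move: (p0 k./2) (f0 k./2) h0; move: (2 ^+ k./2 : R) ((k./2)`!%:R : R) ((k./2).+1%:R : R).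
by move=> x y z x0 y0 z0; field; rewrite x0 y0 z0.
Qed.

Let b_even j : b j.*2 n @[n --> \oo] --> normal_moment j.*2.
Proof.
elim: j => [|j IH].
  have -> : normal_moment 0.*2 = 1 by rewrite /normal_moment /= !mulr1 divr1.
  have := @cvg_integral_symitv phi (measurable_normal_pdf 0 1) (normal_pdf_ge0 0 1).
  rewrite integral_normal_pdf => /fine_cvgP[_]; apply: cvg_trans; apply: near_eq_cvg.
  near=> n; rewrite /b /=; congr (fine _).
  by apply: eq_integral => x _; rewrite expr0 mul1r.
rewrite doubleS normal_moment_rec.
rewrite (_ : b _ = fun n => j.*2.+1%:R * b j.*2 n - (n.+1%:R ^+ j.*2.+1 * phi n.+1%:R) * 2).
  rewrite -[X in _ --> X]subr0 -[X in _ --> _ - X](mul0r 2).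
  apply: cvgB; first by apply: cvgM; [exact: cvg_cst|exact: IH].
  by apply: cvgM; [exact: cvg_mono_pdf|exact: cvg_cst].
apply/funext => n; rewrite b_parts /= normal_pdfN; congr (_ - _).
by rewrite exprNn -signr_odd /= odd_double expr1; ring.
Unshelve. all: by end_near.
Qed.

Let b_odd k n : odd k -> b k n = 0.
Proof.
elim: k {-2}k (leqnn k) => [|m IH] [|[|k]] // km ok; rewrite b_parts /=.
  by rewrite mul0r expr0 normal_pdfN subrr subr0.
have ok' : odd k by move: ok; rewrite /= negbK.
rewrite IH ?mulr0 //; last by apply: ltnW.
by rewrite normal_pdfN exprNn -signr_odd /= ok' expr0 mul1r subrr subr0.
Qed.

Lemma integral_even_mono j :
  (\int[leb]_x (x ^+ j.*2 * phi x)%:E = (normal_moment j.*2)%:E)%E.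
Proof.
have mf : measurable_fun setT (fun x : measurableTypeR R => x ^+ j.*2 * phi x).
  by apply: measurable_funM; [exact: measurable_funX|exact: measurable_normal_pdf].
have f0 (x : R) : 0 <= x ^+ j.*2 * phi x.
  by rewrite mulr_ge0 ?normal_pdf_ge0 // exprn_even_ge0 // odd_double.
have h := cvg_integral_symitv mf f0.
have h2 : (\int[leb]_(x in symitv n) (x ^+ j.*2 * phi x)%:E)%E @[n --> \oo] -->
    (normal_moment j.*2)%:E.
  have -> : (fun n => \int[leb]_(x in symitv n) (x ^+ j.*2 * phi x)%:E)%E =
    fun n => (b j.*2 n)%:E by apply/funext => n; rewrite bE.
  by apply: cvg_EFin; [exact: nearW|exact: b_even].
exact: (cvg_unique _ h h2).
Qed.

(** The Radon-Nikodym derivative of the normal law agrees almost everywhere with the density, both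
    having the same integral over every measurable set. *)
Lemma ge0_integral_std_normal (f : measurableTypeR R -> R) : measurable_fun setT f ->
  (forall x, 0 <= f x) ->
  (\int[std_normal R]_x (f x)%:E = \int[leb]_x (f x * phi x)%:E)%E.
Proof.
move=> mf f0; have dom : std_normal R `<< leb by exact: normal_prob_dominates.
have f0' x : (0 <= (f x)%:E)%E by rewrite lee_fin.
have mf' : measurable_fun setT (EFin \o f) by exact/measurable_EFinP.
rewrite -(Radon_Nikodym_SigmaFinite.change_of_variables dom f0' measurableT mf').
under [RHS]eq_integral do rewrite EFinM.
have mphi : measurable_fun setT (EFin \o phi).
  by apply/measurable_EFinP; exact: measurable_normal_pdf.
have iRN := Radon_Nikodym_SigmaFinite.f_integrable dom.
apply: ae_eq_integral => //.
- by apply: emeasurable_funM; [exact/measurable_EFinP|exact: measurable_int iRN].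
- by apply: emeasurable_funM => //; exact/measurable_EFinP.
- apply: ae_eqe_mul2l; apply: integral_ae_eq => //.
  by move=> E _ mE; rewrite -(Radon_Nikodym_SigmaFinite.f_integral dom).
Qed.

Lemma has_int_std_normal k : has_int (std_normal R) (fun x => x ^+ k) (normal_moment k).
Proof.
have even j : has_int (std_normal R) (fun x => x ^+ j.*2) (normal_moment j.*2).
  apply: has_int_ge0; first exact: measurable_funX.
    by move=> x; rewrite exprn_even_ge0 // odd_double.
  rewrite ge0_integral_std_normal; first exact: integral_even_mono.
    exact: measurable_funX.
  by move=> x; rewrite exprn_even_ge0 // odd_double.
have [ok|ek] := boolP (odd k); last first.
  by rewrite -(odd_double_half k) (negbTE ek) add0n; exact: even.
have nk0 : normal_moment k = 0 by rewrite /normal_moment ok.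
(* Odd moments are read off the nonnegative function [1 + x^k + x^(2k)]. *)
pose g (x : measurableTypeR R) : R := 1 + x ^+ k + x ^+ k.*2.
have g0 x : 0 <= g x.
  rewrite /g -muln2 exprM; set y := x ^+ k.
  have -> : 1 + y + y ^+ 2 = (y + 2^-1) ^+ 2 + 3 / 4 by field.
  by rewrite addr_ge0 ?sqr_ge0 // divr_ge0.
have mg : measurable_fun setT g.
  by apply: measurable_funD; [apply: measurable_funD|]; [exact: measurable_cst|exact: measurable_funX|exact: measurable_funX].
have mgphi : measurable_fun setT (fun x => g x * phi x).
  by apply: measurable_funM => //; exact: measurable_normal_pdf.
have gphi0 x : 0 <= g x * phi x by rewrite mulr_ge0 ?normal_pdf_ge0.
have gE : (\int[leb]_x (g x * phi x)%:E = (1 + normal_moment k.*2)%:E)%E.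
  have h2 : (\int[leb]_(x in symitv n) (g x * phi x)%:E)%E @[n --> \oo] -->
      (1 + normal_moment k.*2)%:E.
    have -> : (fun n => \int[leb]_(x in symitv n) (g x * phi x)%:E)%E =
        fun n => (b 0 n + b k.*2 n)%:E.
      apply/funext => n; have -> : b 0 n + b k.*2 n = b 0 n + b k n + b k.*2 n.
        by rewrite (b_odd n ok) addr0.
      rewrite !EFinD -!bE.
      have i j := integrable_mono_pdf j n.+1%:R.
      rewrite -integralD //; [|exact: i..].
      rewrite -integralD //; [|exact: integrableD (i 0) (i k)|exact: i].
      by apply: eq_integral => x _; rewrite /= -!EFinD /g !mulrDl expr0.
    apply: cvg_EFin; first exact: nearW.
    apply: cvgD; last exact: b_even.
    by have := @b_even 0%N; rewrite [normal_moment _]/normal_moment /= !mulr1 divr1.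
  exact: (cvg_unique _ (cvg_integral_symitv mgphi gphi0) h2).
have hg : has_int (std_normal R) g (1 + normal_moment k.*2).
  by apply: has_int_ge0 => //; rewrite ge0_integral_std_normal.
have -> : normal_moment k = 1 + normal_moment k.*2 - 1 - normal_moment k.*2.
  by rewrite nk0; ring.
apply: eq_has_int (has_intB (has_intB hg (has_int_cst (std_normal R) 1)) (even k)) => x.
by rewrite /g; ring.
Qed.

End NormalMoments.

(** * Taylor expansion of the cosine and the method of moments *)

Section CosTaylor.
Context (R : realType).

Lemma le_integrated_mono (h h' : R -> R) m (x : R) :
  (forall x, is_derive x (1 : R) h (h' x)) -> h 0 = 0 ->
  (forall t, 0 <= t -> h' t <= t ^+ m / m`!%:R) -> 0 <= x ->
  h x <= x ^+ m.+1 / (m.+1)`!%:R.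
Proof.
move=> dh h0 h'le x0.
pose p : {poly R} := (m.+1)`!%:R^-1 *: 'X^(m.+1).
have dg t : is_derive t (1 : R) (horner p - h) (p^`().[t] - h' t).
  exact: is_deriveB (is_derive_poly p t) (dh t).
have pE t : p^`().[t] = t ^+ m / m`!%:R.
  rewrite /p derivZ derivXn hornerZ hornerMn hornerXn factS natrM invfM.
  rewrite mulrC -[_ *+ _]mulr_natr -mulrA; congr (_ * _).
  by rewrite mulrA divff ?mul1r // pnatr_eq0.
have cg : {within `[0, x]%classic, continuous (horner p - h)}.
  by apply: derivable_within_continuous => t _; have [] := dg t.
have := @ger0_derive1_le R (horner p - h) 0 x _ _ true false cg 0 x.
rewrite !in_itv /= !lexx x0 => H.
have : (horner p - h) 0 <= (horner p - h) x.
  apply: H => // t; rewrite in_itv /= => /andP[t0 _]; rewrite derive1E (@derive_val _ _ _ _ _ _ _ (dg t)).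
  by rewrite subr_ge0 pE h'le // ltW.
rewrite -[(_ - _) 0]/(p.[0] - h 0) -[(_ - _) x]/(p.[x] - h x) h0 subr0.
by rewrite /p !hornerZ !hornerXn expr0n /= mulr0 subr_ge0 mulrC.
Qed.

Lemma norm_integrated_mono (h h' : R -> R) m (x : R) :
  (forall x, is_derive x (1 : R) h (h' x)) -> h 0 = 0 ->
  (forall t, `|h' t| <= `|t| ^+ m / m`!%:R) ->
  `|h x| <= `|x| ^+ m.+1 / (m.+1)`!%:R.
Proof.
move=> dh h0 h'le.
have pos (g g' : R -> R) t : (forall x, is_derive x (1 : R) g (g' x)) -> g 0 = 0 ->
    (forall t, `|g' t| <= `|t| ^+ m / m`!%:R) -> 0 <= t ->
    `|g t| <= `|t| ^+ m.+1 / (m.+1)`!%:R.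
  move=> dg g0 g'le t0; rewrite (ger0_norm t0) ler_norml; apply/andP; split.
    rewrite lerNl; apply: (@le_integrated_mono (- g) (fun x => - g' x)) => //.
    - by rewrite -[(- g) 0]/(- g 0) g0 oppr0.
    - by move=> s s0; apply: le_trans (ler_norm _) _; rewrite normrN (le_trans (g'le s)) // ger0_norm.
  apply: (@le_integrated_mono g g') => // s s0.
  by apply: le_trans (ler_norm _) _; rewrite (le_trans (g'le s)) // ger0_norm.
have [x0|x0] := leP 0 x; first exact: (pos h h').
have := @pos (h \o -%R) (fun t => - h' (- t)) (- x); rewrite /= opprK normrN; apply.
- move=> y; have := is_derive1_comp (dh (- y)) (is_deriveN (is_derive_id y (1 : R))).
  by rewrite mulrN1.
- by rewrite oppr0.
- by move=> t; rewrite normrN (le_trans (h'le _)) // normrN.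
- by rewrite oppr_ge0 ltW.
Qed.

(** The k-th derivative of cos at theta is cos(theta + k pi/2). *)
Definition cos_taylor m (theta : R) : {poly R} :=
  \poly_(k < m) (cos (theta + k%:R * (pi / 2)) / k`!%:R).

(** The derivative of the remainder of order [m.+1] at theta is the remainder of order [m] at theta
    + pi/2, so the bound |cos| <= 1 is integrated [m] times. *)
Lemma cos_taylor_remainder m (theta x : R) :
  `|cos (theta + x) - (cos_taylor m theta).[x]| <= `|x| ^+ m / m`!%:R.
Proof.
elim: m theta x => [|m IH] theta x.
  by rewrite /cos_taylor poly_def big_ord0 horner0 subr0 expr0 fact0 divr1 ler_norml cos_geN1 cos_le1.
have dtheta y : is_derive y (1 : R) (fun y => cos (theta + y)) (- sin (theta + y)).
  have := is_derive1_comp (is_derive_cos (theta + y))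
    (is_deriveD (is_derive_cst theta y (1 : R)) (is_derive_id y (1 : R))).
  by rewrite add0r mulr1.
apply: (@norm_integrated_mono (fun y => cos (theta + y) - (cos_taylor m.+1 theta).[y])
  (fun y => cos (theta + pi / 2 + y) - (cos_taylor m (theta + pi / 2)).[y])) => //.
- move=> y.
  have := is_deriveB (dtheta y) (is_derive_poly (cos_taylor m.+1 theta) y).
  set v := (X in is_derive _ _ _ X) => h; suff <- : v = cos (theta + pi / 2 + y) -
    (cos_taylor m (theta + pi / 2)).[y] by exact: h.
  rewrite /v addrAC cosDpihalf; congr (_ - _.[_]).
  apply/polyP => k; rewrite coef_deriv !coef_poly ltnS; case: ifP => _; last by rewrite mul0rn.
  have -> : theta + k.+1%:R * (pi / 2) = theta + pi / 2 + k%:R * (pi / 2).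
    by rewrite -natr1; ring.
  rewrite -[LHS]mulr_natr factS natrM invfM -mulrA; congr (_ * _).
  by rewrite mulrC mulrA divff ?mul1r // pnatr_eq0.
- rewrite addr0 horner_coef0 coef_poly /= mul0r addr0 fact0 divr1.
  exact: subrr.
Qed.

End CosTaylor.

Section CharacteristicFunction.
Context (R : realType).

Definition gaussian_moment (tau : R) k : R := tau ^+ k * normal_moment R k.

Lemma cosDnpi (theta : R) n : cos (theta + n%:R * pi) = (-1) ^+ n * cos theta.
Proof.
elim: n => [|n IH]; first by rewrite mul0r addr0 mul1r.
by rewrite -natr1 mulrDl mul1r addrA cosDpi IH exprS mulN1r mulNr.
Qed.

Lemma normal_moment_even j : normal_moment R j.*2 / j.*2`!%:R = (2 ^+ j * j`!%:R)^-1.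
Proof.
rewrite /normal_moment odd_double doubleK mulrAC divff ?mul1r //.
Qed.

(** Odd terms vanish; in the even ones cos(theta + j pi) = (-1)^j cos theta, and the moment divided
    by (2j)! is (tau^2/2)^j / j!. *)
Lemma taylor_gaussian_moment theta tau N :
  \sum_(k < N.*2) cos (theta + k%:R * (pi / 2)) / k`!%:R * gaussian_moment tau k =
  cos theta * \sum_(j < N) (- (tau ^+ 2 / 2)) ^+ j / j`!%:R.
Proof.
elim: N => [|N IH]; first by rewrite !big_ord0 mulr0.
rewrite doubleS 2!big_ord_recr /= [in RHS]big_ord_recr /= mulrDr -IH -addrA; congr (_ + _).
rewrite [X in _ + X](_ : _ = 0) ?addr0; last first.
  by rewrite /gaussian_moment /normal_moment /= odd_double !mulr0.
have -> : N.*2%:R * (pi / 2) = N%:R * pi :> R by rewrite -muln2 natrM; field.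
rewrite cosDnpi /gaussian_moment.
have -> : (-1) ^+ N * cos theta / N.*2`!%:R * (tau ^+ N.*2 * normal_moment R N.*2) =
    cos theta * ((-1) ^+ N * tau ^+ N.*2 * (normal_moment R N.*2 / N.*2`!%:R)).
  by set u := _^-1; ring.
congr (_ * _).
rewrite normal_moment_even [in RHS]exprNn [in RHS]exprMn exprVn -mul2n exprM invfM.
by rewrite !mulrA.
Qed.

(** For even [m] the Taylor remainder is bounded by Y^m / m! without absolute value, hence in
    expectation by a moment. *)
Lemma cos_expectation d (T : measurableType d) (P : probability T R) (Y : T -> R)
    (v : nat -> R) m theta : ~~ odd m -> measurable_fun setT Y ->
  (forall k, (k <= m)%N -> has_int P (fun w => Y w ^+ k) (v k)) ->
  has_int P (fun w => cos (theta + Y w)) (\int[P]_w cos (theta + Y w)) /\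
  `|\int[P]_w cos (theta + Y w) -
    \sum_(k < m) cos (theta + k%:R * (pi / 2)) / k`!%:R * v k| <= v m / m`!%:R.
Proof.
move=> em mY hv.
have hI : has_int P (fun w => cos (theta + Y w)) (\int[P]_w cos (theta + Y w)).
  apply: has_int_dom (has_int_cst P 1) _ => [|w].
    apply: measurableT_comp; last exact: measurable_funD.
    by apply: continuous_measurable_fun; exact: continuous_cos.
  by rewrite ler_norml cos_geN1 cos_le1.
split => //; set S := \sum_(k < m) _.
have hS : has_int P (fun w => (cos_taylor m theta).[Y w]) S.
  apply: eq_has_int (has_int_sum (index_enum 'I_m) (P := xpredT) (fun (k : 'I_m) _ =>
    has_intZ (cos (theta + k%:R * (pi / 2)) / k`!%:R) (hv k (ltnW (ltn_ord k))))) => w.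
  by rewrite horner_poly.
have hd := has_intB hI hS; have hm := has_intZ m`!%:R^-1 (hv m (leqnn m)).
have dom w : `|cos (theta + Y w) - (cos_taylor m theta).[Y w]| <= m`!%:R^-1 * Y w ^+ m.
  have := cos_taylor_remainder m theta (Y w).
  by rewrite -normrX [X in _ <= X / _]ger0_norm ?exprn_even_ge0 // [X in _ <= X]mulrC.
rewrite ler_norml mulrC; apply/andP; split.
  by apply: has_int_le (has_intN hm) hd _ => w; have := dom w; rewrite ler_norml => /andP[].
by apply: has_int_le hd hm _ => w; have := dom w; rewrite ler_norml => /andP[].
Qed.

Lemma cvg_taylor_gaussian theta tau (eps : R) : 0 < eps -> exists N,
  gaussian_moment tau N.*2 / N.*2`!%:R <= eps /\
  `|\sum_(k < N.*2) cos (theta + k%:R * (pi / 2)) / k`!%:R * gaussian_moment tau k -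
    cos theta * expR (- (tau ^+ 2 / 2))| <= eps.
Proof.
move=> eps0; set x := tau ^+ 2 / 2.
have h1 : x ^+ n / n`!%:R @[n --> \oo] --> (0 : R) by exact: pi_irrational.exp_fact.
have h2 : cos theta * (\sum_(j < n) (- x) ^+ j / j`!%:R) @[n --> \oo] -->
    cos theta * expR (- x).
  apply: cvgM; first exact: cvg_cst.
  have := is_cvg_series_exp_coeff (- x); rewrite /expR => h.
  rewrite (_ : (fun n => _) = series (exp_coeff (- x))) //.
  by apply/funext => n; rewrite /series /= big_mkord.
near \oo => N; exists N; split.
  have -> : gaussian_moment tau N.*2 / N.*2`!%:R = x ^+ N / N`!%:R.
    rewrite /gaussian_moment -mulrA normal_moment_even /x exprMn exprVn -mul2n exprM invfM.
    by rewrite mulrA.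
  have : `|0 - x ^+ N / N`!%:R| <= eps by near: N; exact: cvgr_dist_le.
  by rewrite sub0r normrN => /(le_trans (ler_norm _)).
rewrite taylor_gaussian_moment distrC -/x.
by near: N; apply: cvgr_dist_le.
Unshelve. all: by end_near.
Qed.

(** The order of expansion depends on the Gaussian limit alone, so convergence of finitely many
    moments, including the one that bounds the remainder, is enough. *)
Lemma cvg_cos_expectation (d : nat -> measure_display) (T : forall n, measurableType (d n))
    (P : forall n, probability (T n) R) (Y : forall n, T n -> R) theta tau :
  (forall n, measurable_fun setT (Y n)) ->
  (forall k (eps : R), 0 < eps -> \forall n \near \oo, exists2 v,
     has_int (P n) (fun w => Y n w ^+ k) v & `|v - gaussian_moment tau k| <= eps) ->
  forall eps : R, 0 < eps -> \forall n \near \oo,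
    `|\int[P n]_w cos (theta + Y n w) - cos theta * expR (- (tau ^+ 2 / 2))| <= eps.
Proof.
move=> mY hY eps eps0; have e4 : 0 < eps / 4 by rewrite divr_gt0.
have [N [N1 N2]] := cvg_taylor_gaussian theta tau e4.
pose c k := cos (theta + k%:R * (pi / 2)) / k`!%:R.
pose C := \sum_(k < N.*2) `|c k|.
have C0 : 0 <= C by exact: sumr_ge0.
(* Makes the change in the Taylor sum at most eps/4; the remainder takes eps/2 and the Gaussian
   series the last eps/4. *)
pose delta := eps / 4 / (C + 1).
have delta0 : 0 < delta by rewrite divr_gt0 // ltr_wpDl.
have near1 : \forall n \near \oo, forall k : 'I_(N.*2.+1), exists2 v,
     has_int (P n) (fun w => Y n w ^+ k) v & `|v - gaussian_moment tau k| <= delta.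
  by apply: filter_forall => k; exact: hY.
apply: filterS near1 => n hn.
pose v k := \int[P n]_w (Y n w ^+ k).
have hv k : (k <= N.*2)%N -> has_int (P n) (fun w => Y n w ^+ k) (v k) /\
    `|v k - gaussian_moment tau k| <= delta.
  move=> kN; have [u hu1 hu2] := hn (Ordinal (kN : (k < N.*2.+1)%N)).
  by rewrite /v (has_int_Rintegral hu1).
have eN : ~~ odd N.*2 by rewrite odd_double.
have [_] := @cos_expectation _ _ (P n) (Y n) v N.*2 theta eN (mY n) (fun k kN => (hv k kN).1).
set I := Rintegral _ _ _; set S := \sum_(k < _) _ => IS.
move: N2; set S' := \sum_(k < _) _; set L := cos theta * _ => N2.
have SS' : `|S - S'| <= eps / 4.
  rewrite /S /S' -sumrB; apply: le_trans (ler_norm_sum _ _ _) _.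
  apply: le_trans (_ : \sum_(k < N.*2) `|c k| * delta <= _).
    apply: ler_sum => k _; rewrite -mulrBr normrM ler_wpM2l //.
    by have [] := hv k (ltnW (ltn_ord k)).
  rewrite -mulr_suml -/C /delta mulrCA ler_piMr ?(ltW e4) //.
  by rewrite ler_pdivrMr ?mul1r ?lerDl // ltr_wpDl.
have vN : v N.*2 / N.*2`!%:R <= eps / 4 + eps / 4.
  have [_ h] := hv _ (leqnn N.*2).
  have : v N.*2 <= gaussian_moment tau N.*2 + delta.
    by move: h; rewrite ler_distl => /andP[].
  have f1 : 1 <= N.*2`!%:R :> R by rewrite ler1n fact_gt0.
  have f0 : 0 < N.*2`!%:R :> R by rewrite (lt_le_trans ltr01).
  rewrite -(ler_pM2r (_ : 0 < N.*2`!%:R^-1)) ?invr_gt0 // => /le_trans; apply.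
  rewrite mulrDl lerD //; apply: le_trans (_ : delta <= _).
    by rewrite ler_piMr ?(ltW delta0) // invf_le1.
  by rewrite /delta ler_pdivrMr ?ltr_wpDl // ler_peMr ?(ltW e4) // lerDr.
have -> : I - L = (I - S) + (S - S') + (S' - L) by ring.
apply: le_trans (ler_normD _ _) _; apply: le_trans (lerD (ler_normD _ _) (lexx _)) _.
by have := le_trans IS vN; lra.
Qed.

Lemma std_normal_cos theta alpha :
  has_int (std_normal R) (fun x => cos (theta + alpha * x))
    (cos theta * expR (- (alpha ^+ 2 / 2))).
Proof.
have mY : measurable_fun setT (fun x : measurableTypeR R => alpha * x).
  exact: measurable_funM.
have hv k : has_int (std_normal R) (fun x => (alpha * x) ^+ k) (gaussian_moment alpha k).
  by apply: eq_has_int (has_intZ _ (has_int_std_normal R k)) => x; rewrite exprMn.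
have [h _] := @cos_expectation _ _ (std_normal R) _ _ 0 theta isT mY (fun k _ => hv k).
suff <- : \int[std_normal R]_x cos (theta + alpha * x) =
  cos theta * expR (- (alpha ^+ 2 / 2)) by [].
apply/eqP; rewrite -subr_eq0 -normr_le0; apply/ler_addgt0Pr => eps eps0; rewrite add0r.
(* For a constant sequence the convergence statement becomes an identity. *)
have := @cvg_cos_expectation _ _ (fun=> std_normal R) (fun=> fun x => alpha * x) theta alpha
  (fun=> mY) _ eps eps0.
case=> [k e e0|N _ /(_ N (leqnn N)) //].
by apply: nearW => n; exists (gaussian_moment alpha k) => //; rewrite subrr normr0 ltW.
Qed.

End CharacteristicFunction.

(** * Approximation by trigonometric polynomials *)

Section Bernstein.
Context (R : realFieldType).
Implicit Types (u : R) (f g : nat -> R).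

(* The expectation of [f] under the binomial law with parameters [N] and [u]. *)
Fixpoint bernstein (N : nat) u f : R :=
  if N is N'.+1
  then (1 - u) * bernstein N' u f + u * bernstein N' u (fun j => f j.+1)
  else f 0%N.

Lemma bernsteinD N u f g :
  bernstein N u (fun j => f j + g j) = bernstein N u f + bernstein N u g.
Proof. by elim: N f g => //= N IH f g; rewrite !IH; ring. Qed.

Lemma bernsteinZ N u (a : R) f : bernstein N u (fun j => a * f j) = a * bernstein N u f.
Proof. by elim: N f => //= N IH f; rewrite !IH; ring. Qed.

Lemma bernstein_cst N u (a : R) : bernstein N u (fun=> a) = a.
Proof. by elim: N => //= N IH; rewrite IH; ring. Qed.

Lemma le_bernstein N u f g : 0 <= u <= 1 -> (forall j, (j <= N)%N -> f j <= g j) ->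
  bernstein N u f <= bernstein N u g.
Proof.
move=> /andP[u0 u1]; elim: N f g => [|N IH] f g fg /=; first exact: fg.
apply: lerD; apply: ler_wpM2l => //; rewrite ?subr_ge0 //; apply: IH => j jN; apply: fg => //.
exact: leqW.
Qed.

Lemma eq_bernstein N u f g : f =1 g -> bernstein N u f = bernstein N u g.
Proof.
elim: N f g => [|N IH] f g fg /=; first exact: fg.
by rewrite (IH _ _ fg) (IH _ _ (fun j => fg j.+1)).
Qed.

Lemma bernstein_mean N u : bernstein N u (fun j => j%:R) = N%:R * u.
Proof.
elim: N => [|N IH] /=; first by rewrite mul0r.
rewrite [X in _ + _ * X](eq_bernstein _ _ (g := fun j => j%:R + 1)) => [|j]; last by rewrite natr1.
by rewrite bernsteinD bernstein_cst IH -natr1; ring.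
Qed.

Lemma bernstein_variance N u :
  bernstein N u (fun j => (j%:R - N%:R * u) ^+ 2) = N%:R * (u * (1 - u)).
Proof.
elim: N => [|N IH] /=; first by rewrite !mul0r subrr expr0n.
rewrite [X in _ * X + _](eq_bernstein _ _ (g := fun j => (j%:R - N%:R * u) ^+ 2 +
   (- 2 * u * j%:R + (2 * N%:R * u ^+ 2 + u ^+ 2)))) => [|j]; last by rewrite -natr1; ring.
rewrite [X in _ + _ * X](eq_bernstein _ _ (g := fun j => (j%:R - N%:R * u) ^+ 2 +
   (2 * (1 - u) * j%:R + (- 2 * (1 - u) * N%:R * u + (1 - u) ^+ 2)))) => [|j]; last by rewrite -!natr1; ring.
by rewrite !bernsteinD !bernsteinZ !bernstein_cst bernstein_mean IH -natr1; ring.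
Qed.

Lemma bernstein_sqdist N u : (0 < N)%N -> 0 <= u <= 1 ->
  bernstein N u (fun j => (j%:R / N%:R - u) ^+ 2) <= N%:R^-1.
Proof.
move=> N0 /andP[u0 u1]; have Nne : N%:R != 0 :> R by rewrite pnatr_eq0 -lt0n.
rewrite (eq_bernstein _ _ (g := fun j => N%:R^-1 ^+ 2 * (j%:R - N%:R * u) ^+ 2)) => [|j]; last first.
  by rewrite -exprMn mulrBr mulrA mulVf // mul1r mulrC.
rewrite bernsteinZ bernstein_variance.
have -> : N%:R^-1 ^+ 2 * (N%:R * (u * (1 - u))) = N%:R^-1 * (u * (1 - u)) by field.
by rewrite ler_piMr ?invr_ge0 //; nra.
Qed.

End Bernstein.

Section TrigPoly.
Context (R : realType).

(** The free phase covers sines as well, and products reduce to sums by the formula for cos A cos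
    B. *)
Inductive trigpoly : (R -> R -> R) -> Prop :=
| trigpoly_cos a s t theta : trigpoly (fun x y => a * cos (theta + (s * x + t * y)))
| trigpoly_add f g : trigpoly f -> trigpoly g -> trigpoly (fun x y => f x y + g x y).

Lemma eq_trigpoly f g : trigpoly f -> (forall x y, f x y = g x y) -> trigpoly g.
Proof. by move=> tf fg; rewrite (_ : g = f) //; apply/funext => x; apply/funext => y. Qed.

Lemma trigpoly_mul f g : trigpoly f -> trigpoly g -> trigpoly (fun x y => f x y * g x y).
Proof.
move=> tf; elim: tf g => [a s t theta|f1 f2 _ IH1 _ IH2] g tg; last first.
  by apply: (eq_trigpoly (trigpoly_add (IH1 _ tg) (IH2 _ tg))) => x y; rewrite mulrDl.
elim: tg => [b s' t' theta'|g1 g2 _ IH1 _ IH2]; last first.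
  by apply: (eq_trigpoly (trigpoly_add IH1 IH2)) => x y; rewrite mulrDr.
apply: (eq_trigpoly (trigpoly_add
  (trigpoly_cos (a * b / 2) (s + s') (t + t') (theta + theta'))
  (trigpoly_cos (a * b / 2) (s - s') (t - t') (theta - theta')))) => x y.
set A := theta + (s * x + t * y); set B := theta' + (s' * x + t' * y).
have -> : theta + theta' + ((s + s') * x + (t + t') * y) = A + B by rewrite /A /B; ring.
have -> : theta - theta' + ((s - s') * x + (t - t') * y) = A - B by rewrite /A /B; ring.
by rewrite cosD cosB; field.
Qed.

Lemma trigpoly_cst a : trigpoly (fun _ _ => a).
Proof.
by apply: (eq_trigpoly (trigpoly_cos a 0 0 0)) => x y; rewrite !mul0r !addr0 cos0 mulr1.
Qed.

Lemma trigpoly_bernstein N U (F : nat -> R -> R -> R) : trigpoly U ->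
  (forall j, trigpoly (F j)) ->
  trigpoly (fun x y => bernstein N (U x y) (fun j => F j x y)).
Proof.
move=> tU; elim: N F => [|N IH] F tF /=; first exact: tF.
apply: trigpoly_add; apply: trigpoly_mul => //; last 2 first.
- exact: IH.
- by apply: (IH (fun j => F j.+1)).
apply: (eq_trigpoly (trigpoly_add (trigpoly_cst 1) (trigpoly_mul (trigpoly_cst (-1)) tU))) => x y.
by rewrite mulN1r.
Qed.

End TrigPoly.

Section Approximation.
Context (R : realType).

(** Uniform continuity serves nearby points; for distant ones the bound 2M is dominated by the
    quadratic term. A quadratic modulus is what [bernstein_sqdist] can average. *)
Lemma unif_modulus (G : R * R -> R) M (eta : R) : continuous G ->
  (forall z, `|G z| <= M) -> 0 < eta ->
  exists2 C, 0 <= C & forall p q : R * R, 0 <= p.1 <= 1 -> 0 <= p.2 <= 1 ->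
    `|G p - G q| <= eta + C * ((p.1 - q.1) ^+ 2 + (p.2 - q.2) ^+ 2).
Proof.
move=> cG GM eta0; have M0 : 0 <= M := le_trans (normr_ge0 _) (GM (0, 0)).
have cK : compact (`[0 : R, 1]%classic `*` `[0 : R, 1]%classic).
  by apply: compact_setX; exact: segment_compact.
(* Compactness as a covering property: a [delta] that works near each point yields one for the whole
   square. *)
have /compact_near_coveringP ncK := cK.
have := ncK R (0^'+) (fun delta p => forall q : R * R, `|p.1 - q.1| < delta ->
  `|p.2 - q.2| < delta -> `|G p - G q| <= eta) _.
have step : forall x : R * R, (`[0 : R, 1]%classic `*` `[0 : R, 1]%classic) x ->
  \forall x' \near x & delta \near 0^'+, forall q : R * R, `|x'.1 - q.1| < delta ->
  `|x'.2 - q.2| < delta -> `|G x' - G q| <= eta.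
  move=> x _; have /cvgr_dist_lt/(_ (eta / 2)) := cG x.
  rewrite divr_gt0 // => /(_ isT) /nbhs_ballP [r /= r0 rG].
  have r2 : 0 < r / 2 by rewrite divr_gt0.
  near=> x' delta => /= q q1 q2.
  have [x1 x2] : ball x (r / 2) x' by near: x'; apply: nbhsx_ballx.
  have dr : delta < r / 2 by near: delta; exact: nbhs_right_lt.
  rewrite /ball /= in x1 x2.
  have Gx' : `|G x - G x'| < eta / 2.
    by apply: rG; split; rewrite /ball /=; lra.
  have Gq : `|G x - G q| < eta / 2.
    apply: rG; split; rewrite /ball /=.
      by have := ler_distD x'.1 x.1 q.1; lra.
    by have := ler_distD x'.2 x.2 q.2; lra.
  by have := ler_distD (G x) (G x') (G q); rewrite (distrC (G x') (G x)); lra.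
move=> /(_ _ step) H.
have [delta /= delta0 Hd] : exists2 delta : R, 0 < delta & forall p q : R * R,
    0 <= p.1 <= 1 -> 0 <= p.2 <= 1 -> `|p.1 - q.1| < delta -> `|p.2 - q.2| < delta ->
    `|G p - G q| <= eta.
  near (0 : R)^'+ => delta; exists delta; first by near: delta; exact: nbhs_right_gt.
  move=> p q p1 p2; have : (`[0 : R, 1]%classic `*` `[0 : R, 1]%classic) `<=`
      (fun p => forall q : R * R, `|p.1 - q.1| < delta ->
       `|p.2 - q.2| < delta -> `|G p - G q| <= eta) by near: delta; exact: H.
  by apply; split; rewrite /= in_itv.
have d2 : 0 < delta ^+ 2 by rewrite exprn_gt0.
exists (2 * M / delta ^+ 2) => [|p q p1 p2]; first by rewrite divr_ge0 ?mulr_ge0 // ltW.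
have C0 : 0 <= 2 * M / delta ^+ 2 by rewrite divr_ge0 ?mulr_ge0 // ltW.
have far : forall a b : R, delta <= `|a| -> 2 * M <= 2 * M / delta ^+ 2 * (a ^+ 2 + b ^+ 2).
  move=> a b ad; rewrite mulrAC ler_pdivlMr // ler_wpM2l ?mulr_ge0 //.
  apply: le_trans (_ : a ^+ 2 <= _); last by rewrite lerDl sqr_ge0.
  by rewrite -[a ^+ 2]real_normK ?num_real // lerXn2r // ?nnegrE // ltW.
have GG : `|G p - G q| <= 2 * M.
  by apply: le_trans (ler_normB _ _) _; have := GM p; have := GM q; lra.
have [q1|q1] := ltP `|p.1 - q.1| delta; last first.
  by apply: le_trans GG _; apply: le_trans (far _ (p.2 - q.2) q1) _; rewrite lerDr ltW.
have [q2|q2] := ltP `|p.2 - q.2| delta; last first.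
  apply: le_trans GG _; apply: le_trans (far _ (p.1 - q.1) q2) _.
  by rewrite [X in _ * X]addrC lerDr ltW.
apply: le_trans (Hd _ _ p1 p2 q1 q2) _.
by rewrite lerDl mulr_ge0 // addr_ge0 // sqr_ge0.
Unshelve. all: by end_near.
Qed.

(** Truncation to [-s, s], written with absolute values so that continuity is immediate. *)
Definition clamp (s t : R) : R := (`|t + s| - `|t - s|) / 2.

Lemma clamp_id s t : `|t| <= s -> clamp s t = t.
Proof.
rewrite ler_norml => /andP[t1 t2]; rewrite /clamp ger0_norm; last lra.
by rewrite ler0_norm; [field|lra].
Qed.

Lemma clamp_bound s t : 0 <= s -> `|clamp s t| <= s.
Proof.
move=> s0; rewrite /clamp normrM [X in _ * X]ger0_norm ?invr_ge0 // ler_pdivrMr //.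
apply: le_trans (ler_dist_dist _ _) _.
have -> : t + s - (t - s) = s * 2 by ring.
by rewrite ger0_norm // mulr_ge0.
Qed.

Lemma continuous_clamp s : continuous (clamp s).
Proof.
move=> t; apply: cvgM; last exact: cvg_cst.
apply: cvgB; apply: cvg_norm.
  by apply: cvgD; [exact: cvg_id|exact: cvg_cst].
by apply: cvgB; [exact: cvg_id|exact: cvg_cst].
Qed.

(** The map U(x) = (1 + sin(c x))/2 sends the line into [0, 1] and is inverted by [alpha] on
    [-L, L]. Bernstein polynomials of g composed with [alpha], taken at U(x) and U(y), are
    trigonometric polynomials; being averages of values of g, they stay bounded by M on the whole
    plane. *)
Lemma trig_approximation (g : R * R -> R) M (eta L : R) : continuous g ->
  (forall z, `|g z| <= M) -> 0 < eta -> 0 < L -> exists T : R -> R -> R,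
  [/\ trigpoly T, forall x y, `|T x y| <= M &
      forall x y, `|x| <= L -> `|y| <= L -> `|g (x, y) - T x y| <= eta].
Proof.
(* With this [c], |x| <= L gives |c x| <= pi/4; the sine is then at most [s0 < 1] in modulus, where
   [asin] is continuous. *)
move=> cg gM eta0 L0; pose c := pi / (4 * L); pose s0 := sin (pi / 4 : R).
have c0 : 0 < c by rewrite divr_gt0 ?pi_gt0 // mulr_gt0.
have s01 : 0 < s0 < 1.
  have pi0 := pi_gt0 R; apply/andP; split.
    by apply: sin_gt0_pi; rewrite divr_gt0 //=; lra.
  by rewrite -sin_pihalf /s0 ltr_sin ?in_itv /=; lra.
pose alpha (a : R) := asin (clamp s0 (2 * a - 1)) / c.
have calpha : continuous alpha.
  move=> a; apply: cvgM; last exact: cvg_cst.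
  apply: (@continuous_cvg _ R R _ _ (fun a => clamp s0 (2 * a - 1)) (@asin R)).
    apply: continuous_asin; rewrite -ltr_norml.
    by apply: le_lt_trans (clamp_bound _ _) _; lra.
  apply: (@continuous_cvg _ R R _ _ (fun a => 2 * a - 1) (clamp s0)); first exact: continuous_clamp.
  by apply: cvgB; [apply: cvgM; [exact: cvg_cst|exact: cvg_id]|exact: cvg_cst].
pose U (x : R) := (1 + sin (c * x)) / 2.
have U01 x : 0 <= U x <= 1.
  by rewrite /U; have := sin_geN1 (c * x); have := sin_le1 (c * x); lra.
have alphaU x : `|x| <= L -> alpha (U x) = x.
  move=> xL; have cx : `|c * x| <= pi / 4.
    rewrite normrM gtr0_norm // /c -[X in _ <= X]mulr1 -[X in _ <= _ * X](@divff _ L) ?gt_eqF //.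
    have -> : pi / 4 * (L / L) = pi / (4 * L) * L by field; rewrite gt_eqF.
    by rewrite ler_wpM2l // ltW.
  have pi0 := pi_gt0 R.
  have : `|sin (c * x)| <= s0.
    move: cx; rewrite !ler_norml => /andP[x1 x2].
    by rewrite /s0 -sinN !leNgt !ltr_sin ?in_itv /=; lra.
  rewrite /alpha /U => h; have -> : 2 * ((1 + sin (c * x)) / 2) - 1 = sin (c * x) by field.
  rewrite clamp_id // sinK; first by rewrite mulrC mulKf // gt_eqF.
  by move: cx; rewrite in_itv /= ler_norml; lra.
pose G (p : R * R) := g (alpha p.1, alpha p.2).
have cG : continuous G.
  move=> p; apply: (@continuous_cvg _ _ _ _ _ (fun p : R * R => (alpha p.1, alpha p.2)) g); first exact: cg.
  have c1 : (alpha q.1 @[q --> p]) --> alpha p.1.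
    by apply: (@continuous_cvg _ R R _ _ fst alpha); [exact: calpha|exact: cvg_fst].
  have c2 : (alpha q.2 @[q --> p]) --> alpha p.2.
    by apply: (@continuous_cvg _ R R _ _ snd alpha); [exact: calpha|exact: cvg_snd].
  exact: (cvg_pair c1 c2).
have e2 : 0 < eta / 2 by rewrite divr_gt0.
have [C C0 GC] := unif_modulus cG (fun p => gM _) e2.
have [N N0 NC] : exists2 N, (0 < N)%N & C * (N%:R^-1 + N%:R^-1) <= eta / 2.
  pose N := (Num.bound (4 * C / eta)).+1; exists N => //.
  have CN : 4 * C / eta <= N%:R.
    rewrite /N (le_trans (ltW (archi_boundP _))) ?ler_nat // divr_ge0 ?mulr_ge0 //; lra.
  have Np : 0 < N%:R :> R by rewrite ltr0n.
  have -> : C * (N%:R^-1 + N%:R^-1) = 2 * C / N%:R by ring.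
  rewrite ler_pdivrMr //.
  by move: CN; rewrite ler_pdivrMr //; lra.
pose T x y := bernstein N (U x) (fun j => bernstein N (U y) (fun k => G (j%:R / N%:R, k%:R / N%:R))).
exists T; split.
- have tU (a b : R) : trigpoly (fun x y => (1 + sin (a * x + b * y)) / 2).
    apply: (eq_trigpoly (trigpoly_add (trigpoly_cst 2^-1) (trigpoly_cos 2^-1 a b (- (pi / 2))))) => x y.
    by rewrite addrC [- _ + _]addrC cosBpihalf; field.
  apply: (@trigpoly_bernstein _ N (fun x y => U x) (fun j x y =>
    bernstein N (U y) (fun k => G (j%:R / N%:R, k%:R / N%:R)))).
    by apply: (eq_trigpoly (tU c 0)) => x y; rewrite mul0r addr0.
  move=> j; apply: (@trigpoly_bernstein _ N (fun x y => U y) (fun k x y => G (j%:R / N%:R, k%:R / N%:R))).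
    by apply: (eq_trigpoly (tU 0 c)) => x y; rewrite mul0r add0r.
  by move=> k; exact: trigpoly_cst.
- move=> x y; rewrite ler_norml; apply/andP; split.
    rewrite -[X in X <= _](bernstein_cst N (U x)); apply: le_bernstein => // j _.
    rewrite -[X in X <= _](bernstein_cst N (U y)); apply: le_bernstein => // k _.
    by have := gM (alpha (j%:R / N%:R), alpha (k%:R / N%:R)); rewrite ler_norml => /andP[].
  rewrite -[X in _ <= X](bernstein_cst N (U x)); apply: le_bernstein => // j _.
  rewrite -[X in _ <= X](bernstein_cst N (U y)); apply: le_bernstein => // k _.
  by have := gM (alpha (j%:R / N%:R), alpha (k%:R / N%:R)); rewrite ler_norml => /andP[].
move=> x y xL yL.
have Np : 0 < N%:R :> R by rewrite ltr0n.
(* Error at one node; averaging it over both binomial laws leaves eta/2 and two variances, together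
   at most eta/2. *)
pose E j k : R := eta / 2 + C * ((j%:R / N%:R - U x) ^+ 2 + (k%:R / N%:R - U y) ^+ 2).
have GE j k : (j <= N)%N -> (k <= N)%N -> `|g (x, y) - G (j%:R / N%:R, k%:R / N%:R)| <= E j k.
  move=> jN kN; rewrite distrC; have := GC (j%:R / N%:R, k%:R / N%:R) (U x, U y).
  rewrite /G /= !alphaU //; apply.
    by rewrite divr_ge0 //= ler_pdivrMr // mul1r ler_nat.
  by rewrite divr_ge0 //= ler_pdivrMr // mul1r ler_nat.
have EE : bernstein N (U x) (fun j => bernstein N (U y) (E j)) <= eta.
  rewrite (eq_bernstein _ _ (g := fun j => (eta / 2 + C * bernstein N (U y) (fun k => (k%:R / N%:R - U y) ^+ 2)) +
     C * (j%:R / N%:R - U x) ^+ 2)) => [|j]; last first.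
    rewrite (eq_bernstein _ _ (g := fun k => (eta / 2 + C * (j%:R / N%:R - U x) ^+ 2) +
      C * (k%:R / N%:R - U y) ^+ 2)) => [|k]; last by rewrite /E; ring.
    by rewrite bernsteinD bernsteinZ bernstein_cst; ring.
  rewrite bernsteinD bernsteinZ bernstein_cst.
  have b1 := ler_wpM2l C0 (bernstein_sqdist N0 (U01 x)).
  have b2 := ler_wpM2l C0 (bernstein_sqdist N0 (U01 y)).
  by move: NC; rewrite mulrDr; lra.
apply: le_trans EE; rewrite ler_norml; apply/andP; split.
  have -> : - bernstein N (U x) (fun j => bernstein N (U y) (E j)) =
      bernstein N (U x) (fun j => bernstein N (U y) (fun k => -1 * E j k)).
    rewrite [RHS](eq_bernstein _ _ (g := fun j => -1 * bernstein N (U y) (E j))) => [|j].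
      by rewrite bernsteinZ mulN1r.
    by rewrite bernsteinZ.
  rewrite lerBrDr -[X in _ <= X](bernstein_cst N (U x)) /T -bernsteinD.
  apply: le_bernstein => // j jN; rewrite -bernsteinD.
  rewrite -[X in _ <= X](bernstein_cst N (U y)); apply: le_bernstein => // k kN.
  by have := GE j k jN kN; rewrite ler_norml; lra.
rewrite lerBlDr -[X in X <= _](bernstein_cst N (U x)) /T -bernsteinD.
apply: le_bernstein => // j jN; rewrite -bernsteinD.
rewrite -[X in X <= _](bernstein_cst N (U y)); apply: le_bernstein => // k kN.
by have := GE j k jN kN; rewrite ler_norml; lra.
Qed.

(** The error grows quadratically, so it integrates to O(eta) against every law with bounded second
    moment. *)
Lemma trig_approximation_global (g : R * R -> R) M (eta : R) : continuous g ->
  (forall z, `|g z| <= M) -> 0 < eta -> exists2 T : R -> R -> R,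
  trigpoly T & forall x y, `|g (x, y) - T x y| <= eta * (1 + (x ^+ 2 + y ^+ 2)).
Proof.
move=> cg gM eta0; have M0 : 0 <= M := le_trans (normr_ge0 _) (gM (0, 0)).
(* For |x| > L one has 2M <= eta L <= eta x^2, the last step because L >= 1. *)
pose L := 1 + 2 * M / eta.
have L1 : 1 <= L by rewrite lerDl divr_ge0 ?mulr_ge0 // ltW.
have L0 : 0 < L by rewrite (lt_le_trans ltr01).
have [T [tT TM TL]] := trig_approximation cg gM eta0 L0; exists T => // x y.
have xy0 : 0 <= x ^+ 2 + y ^+ 2 by rewrite addr_ge0 ?sqr_ge0.
have far (a b : R) : L < `|a| -> 2 * M <= eta * (1 + (a ^+ 2 + b ^+ 2)).
  move=> La; have ML : 2 * M <= eta * L.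
    by rewrite /L mulrDr mulr1 mulrCA divff ?gt_eqF // mulr1 lerDr ltW.
  apply: le_trans ML _; rewrite ler_pM2l //.
  have La2 : L <= a ^+ 2.
    rewrite -[a ^+ 2]real_normK ?num_real // expr2.
    have := ltW La; move: L1; set t := `|a|; nra.
  by have := sqr_ge0 b; lra.
have gT : `|g (x, y) - T x y| <= 2 * M.
  by apply: le_trans (ler_normB _ _) _; have := gM (x, y); have := TM x y; lra.
have [xL|xL] := leP `|x| L; last exact: le_trans gT (far _ _ xL).
have [yL|yL] := leP `|y| L; last first.
  by apply: le_trans gT _; rewrite [x ^+ 2 + _]addrC; exact: far.
by apply: le_trans (TL _ _ xL yL) _; rewrite ler_peMr ?(ltW eta0) // lerDl.
Qed.

End Approximation.

(** * Integrals of monomials over the disc *)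

Section Disc.
Context (R : realType).
Local Notation leb := (@lebesgue_measure R).
Local Notation leb2 := (leb \x leb)%E.

Definition disc_ind (z : plane R) : R := (z.1 ^+ 2 + z.2 ^+ 2 < 1)%R%:R.

Lemma disc_section (x y : R) :
  (x ^+ 2 + y ^+ 2 < 1) = (- Num.sqrt (1 - y ^+ 2) < x < Num.sqrt (1 - y ^+ 2)).
Proof.
rewrite -ltr_norml -sqrtr_sqr -ltrBrDr.
have [h|h] := ltP 0 (1 - y ^+ 2); first by rewrite ltr_sqrt.
rewrite (ler0_sqrtr h) ltNge (le_trans h (sqr_ge0 x)) /=.
by rewrite ltNge sqrtr_ge0.
Qed.

Lemma measurable_disc : measurable [set z : plane R | (z.1 ^+ 2 + z.2 ^+ 2 < 1)%R].
Proof.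
have mf : measurable_fun setT (fun z : plane R => z.1 ^+ 2 + z.2 ^+ 2).
  apply: measurable_funD; apply: measurable_funX; [exact: measurable_fst|exact: measurable_snd].
rewrite (_ : [set _ | _] = setT `&` (fun z : plane R => z.1 ^+ 2 + z.2 ^+ 2) @^-1` `]-oo, 1[%classic).
  by apply: mf => //; exact: measurable_itv.
by rewrite setTI; apply/seteqP; split => z /=; rewrite in_itv.
Qed.

Lemma disc_indE : disc_ind = \1_[set z : plane R | (z.1 ^+ 2 + z.2 ^+ 2 < 1)%R].
Proof.
apply/funext => z; rewrite indicE /disc_ind; congr ((nat_of_bool _)%:R).
by apply/idP/idP; rewrite inE.
Qed.

Lemma measurable_disc_ind : measurable_fun setT disc_ind.
Proof. by rewrite disc_indE; apply: measurable_indic; exact: measurable_disc. Qed.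

Lemma integral_sqrt_section (y : R) :
  (\int[leb]_x (disc_ind (x, y))%:E = (2 * Num.sqrt (1 - y ^+ 2))%:E)%E.
Proof.
set s := Num.sqrt _; have s0 : 0 <= s by exact: sqrtr_ge0.
rewrite (eq_integral (fun x : measurableTypeR R => (\1_(`](- s), s[%classic : set (measurableTypeR R)) x)%:E)) => [|x _]; last first.
  rewrite /disc_ind indicE disc_section; congr ((nat_of_bool _)%:R%:E).
  by apply/idP/idP; rewrite inE /= in_itv.
rewrite integral_indic //=.
rewrite setIT lebesgue_measure_itv /= lte_fin; case: ltP => h.
  by rewrite -EFinB; congr (_%:E); ring.
by have -> : s = 0; [lra|rewrite mulr0].
Qed.

(** Substituting x = sin t gives 2 cos^2 t, whose primitive is t + sin t cos t. *)
Lemma integral_semicircle :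
  (\int[leb]_x (2 * Num.sqrt (1 - x ^+ 2))%:E = pi%:E)%E.
Proof.
have pi0 := pi_gt0 R.
have csq : continuous (fun x : R => 2 * Num.sqrt (1 - x ^+ 2)).
  move=> x; apply: cvgM; first exact: cvg_cst.
  apply: (@continuous_cvg _ R R _ _ (fun x => 1 - x ^+ 2) Num.sqrt).
    exact: sqrt_continuous.
  by apply: cvgB; [exact: cvg_cst|exact: exprn_continuous].
(* Off [-1, 1] the argument is negative and [Num.sqrt] is 0. *)
transitivity (\int[leb]_(x in `[(- 1)%R, 1%R]) (2 * Num.sqrt (1 - x ^+ 2))%:E)%E.
  rewrite [RHS]integral_mkcond; apply: eq_integral => x _; rewrite patchE.
  case: ifPn => //; rewrite notin_setE /= in_itv /= => /negP h.
  rewrite ler0_sqrtr ?mulr0 // subr_le0.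
  have x1 : 1 < `|x| by rewrite ltNge; apply: contra h; rewrite ler_norml.
  by rewrite -real_normK ?num_real // exprn_ege1 // ltW.
have s1 : sin (- (pi / 2)) = -1 :> R by rewrite sinN sin_pihalf.
have s2 : sin (pi / 2) = 1 :> R by exact: sin_pihalf.
have dsin : (@sin R)^`()%classic = cos.
  by apply/funext => x; rewrite derive1E; have [_ ->] := is_derive_sin x.
have csin : continuous (@sin R) by exact: continuous_sin.
have := @integration_by_substitution_increasing R sin
  (fun x => 2 * Num.sqrt (1 - x ^+ 2)) (- (pi / 2)) (pi / 2).
rewrite s1 s2 dsin => ->; last first.
- exact: continuous_subspaceT.
- split; first by move=> x _; have [] := is_derive_sin x.
    by apply: cvg_at_right_filter; exact: csin.
  by apply: cvg_at_left_filter; exact: csin.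
- by apply/cvg_ex; exists (cos (pi / 2)); apply: cvg_at_left_filter; exact: continuous_cos.
- by apply/cvg_ex; exists (cos (- (pi / 2))); apply: cvg_at_right_filter; exact: continuous_cos.
- by move=> x _; exact: continuous_cos.
- by move=> x y hx hy xy; rewrite ltr_sin.
- by lra.
have dF (x : R) : is_derive x (1 : R) (fun x => x + sin x * cos x) (2 * cos x ^+ 2).
  have := is_deriveD (is_derive_id x (1 : R)) (is_deriveM (is_derive_sin x) (is_derive_cos x)).
  set v := (X in is_derive _ _ _ X) => h; suff <- : v = 2 * cos x ^+ 2 by exact: h.
  rewrite /v -![_ *: _]/(_ * _); have := cos2Dsin2 x; nra.
rewrite (eq_integral (fun x : measurableTypeR R => (2 * cos x ^+ 2)%:E)) => [|x]; last first.
  rewrite inE /= in_itv /= => xpi; congr (_%:E).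
  rewrite -[LHS]/(2 * Num.sqrt (1 - sin x ^+ 2) * cos x) -(cos2Dsin2 x) addrK sqrtr_sqr ger0_norm.
    by rewrite expr2 mulrA.
  exact: cos_ge0_pihalf.
rewrite (@continuous_FTC2 _ _ (fun x => x + sin x * cos x)).
- rewrite sinN cosN sin_pihalf cos_pihalf !mulr0 !addr0 -EFinB; congr (_%:E); lra.
- lra.
- apply: continuous_subspaceT => x; apply: cvgM; first exact: cvg_cst.
  by apply: (@continuous_cvg _ R R _ _ cos (fun y => y ^+ 2)); [exact: exprn_continuous|exact: continuous_cos].
- have cF : continuous (fun x : R => x + sin x * cos x).
    move=> x; apply: cvgD; first exact: cvg_id.
    by apply: cvgM; [exact: continuous_sin|exact: continuous_cos].
  split; first by move=> x _; have [] := dF x.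
    by apply: cvg_at_right_filter; exact: cF.
  by apply: cvg_at_left_filter; exact: cF.
- by move=> x _; rewrite derive1E; have [_ ->] := dF x.
Qed.

Lemma integral_disc : has_int leb2 disc_ind pi.
Proof.
apply: has_int_ge0; first exact: measurable_disc_ind.
  by move=> z; rewrite /disc_ind.
rewrite fubini_tonelli2; last 2 first.
- by apply/measurable_EFinP; exact: measurable_disc_ind.
- by move=> z; rewrite lee_fin.
rewrite -integral_semicircle; apply: eq_integral => y _.
exact: integral_sqrt_section.
Qed.

Lemma disc_ind_sym (z : plane R) : disc_ind (z.2, z.1) = disc_ind z.
Proof. by rewrite /disc_ind addrC. Qed.

(* The divergence theorem on a section of the disc. *)
Lemma integral_section_deriv (p : {poly R}) (y : R) :
  p.[Num.sqrt (1 - y ^+ 2)] = 0 -> p.[- Num.sqrt (1 - y ^+ 2)] = 0 ->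
  (\int[leb]_x (disc_ind (x, y) * p^`().[x])%:E = 0)%E.
Proof.
set s := Num.sqrt _ => p1 p2; have s0 : 0 <= s by exact: sqrtr_ge0.
transitivity (\int[leb]_(x in `](- s)%R, s[) (p^`().[x])%:E)%E.
  rewrite [RHS]integral_mkcond; apply: eq_integral => x _.
  rewrite patchE /disc_ind disc_section mem_setE in_itv /= -/s.
  by case: ifP => _; rewrite ?mul1r ?mul0r.
have [s1|s1] := ltP 0 s; last first.
  by rewrite set_itv_ge ?integral_set0 // bnd_simp -leNgt; lra.
rewrite -(@integral_itv_bndoo _ _ _ _ true false); last first.
  by apply/measurable_EFinP/measurable_funTS; apply: continuous_measurable_fun; exact: continuous_horner.
rewrite (@continuous_FTC2 _ _ (horner p)).
- by rewrite p1 p2 -EFinB subrr.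
- lra.
- by apply: continuous_subspaceT; exact: continuous_horner.
- split; first by move=> x _; exact: derivable_horner.
    by apply: cvg_at_right_filter; exact: continuous_horner.
  by apply: cvg_at_left_filter; exact: continuous_horner.
- by move=> x _; rewrite -derivE.
Qed.

End Disc.

Section DiscMoments.
Context (R : realType).
Local Notation leb := (@lebesgue_measure R).
Local Notation leb2 := (leb \x leb)%E.
Implicit Types (P : {poly R[i]}).

(** Transfers a complex polynomial on the real axis to a real one, to which the fundamental theorem
    of calculus applies. *)
Definition re_poly P : {poly R} := \poly_(k < size P) complex.Re P`_k.

Lemma coef_re_poly P k : (re_poly P)`_k = complex.Re P`_k.
Proof. by rewrite coef_poly; case: ltnP => // h; rewrite nth_default. Qed.

Lemma horner_re_poly P (x : R) : (re_poly P).[x] = complex.Re P.[x%:C].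
Proof.
rewrite horner_poly horner_coef Re_sum; apply: eq_bigr => k _.
by rewrite -realCX [_ * _%:C]mulrC Re_realM mulrC.
Qed.

Lemma deriv_re_poly P : (re_poly P)^`() = re_poly P^`().
Proof.
apply/polyP => k; rewrite coef_deriv !coef_re_poly coef_deriv.
by move: P`_k.+1 => z; elim: k.+1 => [|n IH]; rewrite ?mulr0n // !mulrS IH ReD.
Qed.

Definition zmono a b (z : plane R) : R[i] := toC z ^+ a * (toC z)^*%C ^+ b.

Definition disc_mono a b : R[i] := cint leb2 (fun z => (disc_ind z)%:C * zmono a b z).

Lemma cmod_toC (z : plane R) : cmod (toC z) ^+ 2 = z.1 ^+ 2 + z.2 ^+ 2.
Proof. by rewrite cmod_sqr. Qed.

Lemma has_cint_disc_mono a b :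
  has_cint leb2 (fun z => (disc_ind z)%:C * zmono a b z) (disc_mono a b).
Proof.
have [m1 m2] : cmeasurable (fun z => (disc_ind z)%:C * zmono a b z).
  have mZ : cmeasurable (@toC R : plane R -> R[i]).
    by apply: cmeasurable_toC; exact: measurable_id.
  apply: cmeasurableM.
    by split; [exact: measurable_disc_ind|exact: measurable_cst].
  by apply: cmeasurableM; apply: cmeasurableX => //; exact: cmeasurableJ.
have le z : cmod ((disc_ind z)%:C * zmono a b z) <= disc_ind z.
  rewrite cmodM /zmono cmodM !cmodX cmodJ -exprD /disc_ind.
  case: ltP => h; last by rewrite {1}/cmod /= expr0n addr0 sqrtr0 mul0r.
  rewrite {1}/cmod /= expr0n addr0 expr1n sqrtr1 mul1r.
  apply: exprn_ile1; first exact: cmod_ge0.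
  have h2 : cmod (toC z) ^+ 2 <= 1 by rewrite cmod_toC ltW.
  by rewrite -(@expr_le1 _ 2) ?cmod_ge0.
split; [apply: (has_int_dom m1 (integral_disc R))|apply: (has_int_dom m2 (integral_disc R))] => z.
  exact: le_trans (Re_le_cmod _) (le z).
exact: le_trans (Im_le_cmod _) (le z).
Qed.

(** By Fubini it suffices that every horizontal chord integrates to 0: there [H] is the derivative
    of a polynomial vanishing at both ends. *)
Lemma green_Re (H : plane R -> R[i]) v :
  has_int leb2 (fun z => complex.Re ((disc_ind z)%:C * H z)) v ->
  (forall y, y ^+ 2 <= 1 -> exists P, [/\ P.[(Num.sqrt (1 - y ^+ 2))%:C] = 0,
     P.[(- Num.sqrt (1 - y ^+ 2))%:C] = 0 & forall x, H (x, y) = P^`().[x%:C]]) ->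
  v = 0.
Proof.
move=> [Hi Hv] HP; apply: EFin_inj; rewrite -Hv -(integral21_prod_meas1 Hi).
rewrite (eq_integral (fun=> 0%E)) ?integral0 // => y _.
have [y1|y1] := leP (y ^+ 2) 1; last first.
  rewrite /fubini_G (eq_integral (fun=> 0%E)) ?integral0 // => x _ /=.
  by rewrite /disc_ind ltNge /= (le_trans (ltW y1)) ?lerDr ?sqr_ge0 //= mul0r.
have [P [P1 P2 HE]] := HP y y1.
rewrite -[RHS](@integral_section_deriv R (re_poly P) y); last 2 first.
- by rewrite horner_re_poly P1.
- by rewrite horner_re_poly P2.
apply: eq_integral => x _ /=; rewrite Re_realM HE.
by rewrite deriv_re_poly horner_re_poly.
Qed.

Lemma green_Re_sym (H : plane R -> R[i]) v :
  has_int leb2 (fun z => complex.Re ((disc_ind z)%:C * H z)) v ->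
  (forall x, x ^+ 2 <= 1 -> exists P, [/\ P.[(Num.sqrt (1 - x ^+ 2))%:C] = 0,
     P.[(- Num.sqrt (1 - x ^+ 2))%:C] = 0 & forall y, H (x, y) = P^`().[y%:C]]) ->
  v = 0.
Proof.
move=> [Hi Hv] HP; apply: EFin_inj; rewrite -Hv -(integral12_prod_meas1 Hi).
rewrite (eq_integral (fun=> 0%E)) ?integral0 // => x _.
have [x1|x1] := leP (x ^+ 2) 1; last first.
  rewrite /fubini_F (eq_integral (fun=> 0%E)) ?integral0 // => y _ /=.
  by rewrite /disc_ind ltNge /= (le_trans (ltW x1)) ?lerDl ?sqr_ge0 //= mul0r.
have [P [P1 P2 HE]] := HP x x1.
rewrite -[RHS](@integral_section_deriv R (re_poly P) x); last 2 first.
- by rewrite horner_re_poly P1.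
- by rewrite horner_re_poly P2.
apply: eq_integral => y _ /=; rewrite Re_realM HE.
by rewrite deriv_re_poly horner_re_poly -disc_ind_sym.
Qed.

(* Derivative of (1 - |z|^2) z^a conj(z)^b along a line on which z has
   derivative [al] and its conjugate has derivative [be]. *)
Definition green_integrand (F : comNzRingType) (al be : F) a b (z w : F) : F :=
  al * (a%:R * (z ^+ a.-1 * w ^+ b) - a.+1%:R * (z ^+ a * w ^+ b.+1)) +
  be * (b%:R * (z ^+ a * w ^+ b.-1) - b.+1%:R * (z ^+ a.+1 * w ^+ b)).

Lemma green_integrandE (F : comNzRingType) (al be z0 w0 : F) a b t :
  ((1 - (z0%:P + al *: 'X) * (w0%:P + be *: 'X)) *
    ((z0%:P + al *: 'X) ^+ a * (w0%:P + be *: 'X) ^+ b))^`().[t] =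
  green_integrand al be a b (z0 + al * t) (w0 + be * t).
Proof.
have dB (u v : F) : (u%:P + v *: 'X)^`() = v%:P.
  by rewrite derivD derivC derivZ derivX add0r alg_polyC.
have hB (u v : F) : (u%:P + v *: 'X).[t] = u + v * t.
  by rewrite hornerD hornerC hornerZ hornerX.
rewrite derivM derivB derivM derivM !deriv_exp -[1]/(1%:P) derivC !dB.
rewrite !(hornerD, hornerN, hornerM, hornerMn, horner_exp, hornerC, hornerZ, hornerX).
set z := z0 + al * t; set w := w0 + be * t; rewrite /green_integrand.
by case: a => [|a]; case: b => [|b]; rewrite /= ?exprS; ring.
Qed.

Lemma has_cint_green al be a b :
  has_cint leb2 (fun z => (disc_ind z)%:C * green_integrand al be a b (toC z) (toC z)^*%C)
    (al * (a%:R * disc_mono a.-1 b - a.+1%:R * disc_mono a b.+1) +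
     be * (b%:R * disc_mono a b.-1 - b.+1%:R * disc_mono a.+1 b)).
Proof.
have h i j := has_cint_disc_mono i j.
have shuffle (F : comNzRingType) (al' be' c p q p' q' x1 x2 x3 x4 : F) :
    al' * (p * (c * x1) + -1 * (q * (c * x2))) + be' * (p' * (c * x3) + -1 * (q' * (c * x4))) =
    c * (al' * (p * x1 - q * x2) + be' * (p' * x3 - q' * x4)) by ring.
rewrite -[X in al * (_ + X) + _]mulN1r -[X in _ + be * (_ + X)]mulN1r.
apply: eq_has_cint (has_cintD
  (has_cintZ al (has_cintD (has_cintZ a%:R (h a.-1 b)) (has_cintZ (-1) (has_cintZ a.+1%:R (h a b.+1)))))
  (has_cintZ be (has_cintD (has_cintZ b%:R (h a b.-1)) (has_cintZ (-1) (has_cintZ b.+1%:R (h a.+1 b))))))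
  => z.
exact: shuffle.
Qed.

Lemma complex_ReIm0 (v : R[i]) : complex.Re v = 0 -> complex.Re ((0 -i* 1) * v) = 0 -> v = 0.
Proof. by case: v => u w /= ->; rewrite mul0r mulN1r opprK add0r => ->. Qed.

(** The integral of the derivative of (1 - |z|^2) z^a conj(z)^b with respect to z vanishes. That
    derivative is a combination of those along the two axes, which give U + V = 0 and iU - iV = 0;
    hence U = 0. *)
Lemma disc_mono_rec a b : a%:R * disc_mono a.-1 b = a.+1%:R * disc_mono a b.+1.
Proof.
set U := a%:R * disc_mono a.-1 b - a.+1%:R * disc_mono a b.+1.
pose V := b%:R * disc_mono a b.-1 - b.+1%:R * disc_mono a.+1 b.
pose Pol (c al be z0 w0 : R[i]) : {poly R[i]} :=
  c *: ((1 - (z0%:P + al *: 'X) * (w0%:P + be *: 'X)) *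
    ((z0%:P + al *: 'X) ^+ a * (w0%:P + be *: 'X) ^+ b)).
have PolE c al be z0 w0 t : (Pol c al be z0 w0)^`().[t] =
    c * green_integrand al be a b (z0 + al * t) (w0 + be * t).
  by rewrite derivZ hornerZ green_integrandE.
have Pol0 c al be z0 w0 t : (z0 + al * t) * (w0 + be * t) = 1 ->
    (Pol c al be z0 w0).[t] = 0.
  move=> h; rewrite hornerZ !hornerM hornerD hornerN hornerM !hornerD !hornerZ !hornerC hornerX.
  by rewrite h subrr mul0r mulr0.
have sq (u : R) : u ^+ 2 <= 1 -> Num.sqrt (1 - u ^+ 2) ^+ 2 + u ^+ 2 = 1.
  by move=> u1; rewrite sqr_sqrtr ?subrK // subr_ge0.
have scale (F : comNzRingType) (c d g : F) : d * (c * g) = c * (d * g) by rewrite mulrCA.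
have E1 : 1 * U + 1 * V = 0.
  (* The free factor [c] yields the real and imaginary parts at once. *)
  have gr c : complex.Re (c * (1 * U + 1 * V)) = 0.
    apply: (@green_Re (fun z => c * green_integrand 1 1 a b (toC z) (toC z)^*%C)).
      have [h _] := has_cintZ c (has_cint_green 1 1 a b).
      by apply: eq_has_int h => z; rewrite mulrCA.
    move=> y y1; exists (Pol c 1 1 (0 +i* y) (0 -i* y)).
    have cE (x : R) : (0 +i* y) + 1 * x%:C = toC (x, y).
      by rewrite mul1r /toC /=; apply/eqP; rewrite eq_complex /= add0r addr0 !eqxx.
    have cE' (x : R) : (0 -i* y) + 1 * x%:C = (toC (x, y))^*%C.
      by rewrite mul1r /toC /=; apply/eqP; rewrite eq_complex /= add0r addr0 !eqxx.
    split; [apply: Pol0|apply: Pol0|by move=> x; rewrite PolE cE cE'].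
      by rewrite cE cE' -cmod2_conj cmod_toC /= sq.
    by rewrite cE cE' -cmod2_conj cmod_toC /= sqrrN sq.
  by apply: complex_ReIm0; [rewrite -[X in complex.Re X]mul1r; exact: gr|exact: gr].
have E2 : (0 +i* 1) * U + (0 -i* 1) * V = 0.
  have gr c : complex.Re (c * ((0 +i* 1) * U + (0 -i* 1) * V)) = 0.
    apply: (@green_Re_sym (fun z => c * green_integrand (0 +i* 1) (0 -i* 1) a b (toC z) (toC z)^*%C)).
      have [h _] := has_cintZ c (has_cint_green (0 +i* 1) (0 -i* 1) a b).
      by apply: eq_has_int h => z; rewrite mulrCA.
    move=> x x1; exists (Pol c (0 +i* 1) (0 -i* 1) x%:C x%:C).
    have cE (y : R) : x%:C + (0 +i* 1) * y%:C = toC (x, y).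
      apply/eqP; rewrite eq_complex /=; apply/andP; split; apply/eqP; ring.
    have cE' (y : R) : x%:C + (0 -i* 1) * y%:C = (toC (x, y))^*%C.
      apply/eqP; rewrite eq_complex /=; apply/andP; split; apply/eqP; ring.
    split; [apply: Pol0|apply: Pol0|by move=> y; rewrite PolE cE cE'].
      by rewrite cE cE' -cmod2_conj cmod_toC /= addrC sq.
    by rewrite cE cE' -cmod2_conj cmod_toC /= sqrrN addrC sq.
  by apply: complex_ReIm0; [rewrite -[X in complex.Re X]mul1r; exact: gr|exact: gr].
have VU : V = - U.
  by apply/eqP; rewrite -addr_eq0 addrC; move: E1; rewrite !mul1r => ->.
move: E2; rewrite VU mulrN -mulrBl => /eqP; rewrite mulf_eq0 => /orP[|].
  by rewrite eq_complex /= opprK -[X in _ && X]/(1 + 1 == 0) -mulr2n pnatr_eq0 andbF.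
by rewrite subr_eq0 => /eqP.
Qed.

Lemma disc_monoJ a b : disc_mono b a = (disc_mono a b)^*%C.
Proof.
have [h1 h2] := has_cint_disc_mono a b; apply: has_cintE.
split; first rewrite ReJ.
  apply: eq_has_int h1 => z; rewrite !Re_realM; congr (_ * _).
  by rewrite /zmono -[in RHS]ReJ conjcM !conjcX conjcK mulrC.
rewrite ImJ; apply: eq_has_int (has_intN h2) => z.
by rewrite -ImJ conjcM /zmono conjcM !conjcX conjcK conjc_real [X in _ * X]mulrC.
Qed.

(** The recursion lowers both exponents together until one is 0; there the case [a = 0] of the
    recursion, conjugation, or the area of the disc concludes. *)
Lemma disc_monoE a b : disc_mono a b = (a == b)%:R * (pi / a.+1%:R)%:C.
Proof.
have n0 k : k.+1%:R != 0 :> R[i] by rewrite pnatr_eq0.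
have zero_l k : disc_mono 0 k.+1 = 0.
  by have /esym := disc_mono_rec 0 k; rewrite mul0r => /eqP; rewrite mulf_eq0 (negPf (n0 0%N)) => /eqP.
elim: a b => [|a IH] [|b]; rewrite ?zero_l ?mul0r //.
- rewrite divr1 mul1r; apply: has_cintE; split.
    by apply: eq_has_int (integral_disc R) => z; rewrite /zmono !expr0 !mulr1.
  by apply: eq_has_int (has_int0 leb2) => z; rewrite /zmono !expr0 !mulr1.
- by rewrite disc_monoJ zero_l conjc0.
have /esym := disc_mono_rec a.+1 b; rewrite /= IH => /(canRL (mulKf (n0 _))) ->.
have m0 k : k.+1%:R != 0 :> R by rewrite pnatr_eq0.
have -> : (pi / a.+2%:R)%:C = a.+2%:R^-1 * (a.+1%:R * (pi / a.+1%:R)%:C) :> R[i].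
  have realCV (x : R) : (x^-1)%:C = x%:C^-1 by exact: fmorphV.
  rewrite -!realC_nat -realCV -!realCM; congr (_%:C).
  by rewrite [_ * (pi / _)]mulrC divfK // mulrC.
by rewrite eqSS (mulrCA a.+1%:R) (mulrCA _^-1).
Qed.

(** Parseval: monomials are orthogonal on the disc, with squared norms pi / (k + 1). *)
Lemma disc_norm2_poly (p : {poly R[i]}) :
  pi^-1 * disc_norm2 (fun z => p.[z]) = \sum_(k < size p) cmod p`_k ^+ 2 / k.+1%:R.
Proof.
have pi0 : pi != 0 :> R by rewrite gt_eqF // pi_gt0.
have h : has_cint leb2 (fun z => (disc_ind z)%:C * (cmod p.[toC z] ^+ 2)%:C)
    (\sum_(j < size p) \sum_(k < size p) p`_j * (p`_k)^*%C * disc_mono j k).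
  apply: (eq_has_cint _ (has_cint_sum (index_enum 'I_(size p)) (fun j : 'I_(size p) =>
     has_cint_sum (index_enum 'I_(size p)) (fun k : 'I_(size p) =>
     has_cintZ (p`_j * (p`_k)^*%C) (has_cint_disc_mono j k))))) => z.
  rewrite cmod2_conj horner_coef conjc_sum mulr_suml mulr_sumr; apply: eq_bigr => j _.
  rewrite !mulr_sumr; apply: eq_bigr => k _; rewrite conjcM conjcX /zmono.
  by rewrite [LHS]mulrCA; congr (_ * _); rewrite mulrACA.
have E : \sum_(j < size p) \sum_(k < size p) p`_j * (p`_k)^*%C * disc_mono j k =
    (pi * \sum_(k < size p) cmod p`_k ^+ 2 / k.+1%:R)%:C.
  rewrite realCM realC_sum mulr_sumr; apply: eq_bigr => j _.
  rewrite (bigD1 j) //= big1 ?addr0 => [|k kj]; last first.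
    have -> : disc_mono j k = 0.
      by rewrite disc_monoE; case: eqP => [jk|]; rewrite ?mul0r //; move/eqP: kj; case; apply: val_inj.
    by rewrite mulr0.
  by rewrite disc_monoE eqxx mul1r -cmod2_conj -!realCM mulrCA.
have [h1 _] := h; rewrite E in h1; have [_ h1E] := h1.
rewrite /disc_norm2 integral_mkcond.
have -> : (\int[leb2]_z ((fun z => (cmod p.[toC z] ^+ 2)%:E) \_ [set z : plane R | (cmod (toC z) < 1)%R]) z =
   \int[leb2]_z (complex.Re ((disc_ind z)%:C * (cmod p.[toC z] ^+ 2)%:C))%:E)%E.
  apply: eq_integral => z _; rewrite patchE Re_realM /= /disc_ind -cmod_toC.
  have -> : (cmod (toC z) ^+ 2 < 1) = (cmod (toC z) < 1) by rewrite expr_lt1 ?cmod_ge0.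
  have [z1|z1] := boolP (cmod (toC z) < 1); first by rewrite mem_set // mul1r.
  by rewrite memNset ?mul0r //; exact/negP.
by rewrite h1E /= mulKf.
Qed.

End DiscMoments.

(** * The central limit theorem *)

Section LinearStatistic.
Context (R : realType) (mu : nat -> probability (plane R) R)
  (d0 : nat -> measure_display) (T : forall n, measurableType (d0 n))
  (P : forall n, probability (T n) R)
  (Z : forall n, 'I_n -> {RV (P n) >-> plane R}).
Hypothesis mu_rot : forall n, (0 < n)%N -> rotation_invariant (mu n).
Hypothesis Z_SPP : forall n, (0 < n)%N -> is_SPP (mu n) (@Z n).
Hypothesis mu_ratio : forall m : int,
  moment_ratio (mu n) n m @[n --> \oo] --> (1 : R).

Definition linstat d (c : nat -> R[i]) n (w : T n) : R[i] :=
  powersum d c (fun i => toC (@Z n i w)).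

Definition variance_sum d (c : nat -> R[i]) : R := \sum_(k < d) k.+1%:R * cmod (c k) ^+ 2.

Lemma variance_sum_ge0 d c : 0 <= variance_sum d c.
Proof. by apply: sumr_ge0 => k _; rewrite mulr_ge0 // exprn_ge0 // cmod_ge0. Qed.

Lemma cmeasurable_linstat d c n : cmeasurable (@linstat d c n).
Proof.
apply: cmeasurable_sum => i; apply: cmeasurable_sum => k.
apply: cmeasurableM; first exact: cmeasurable_cst.
by apply: cmeasurableX; exact: cmeasurable_toC.
Qed.

Lemma near_mixed_moment d c a b (eps : R) : 0 < eps -> \forall n \near \oo, exists2 v,
  has_int (P n) (fun w => complex.Re (@linstat d c n w ^+ a * (@linstat d c n w ^+ b)^*%C)) v &
  `|v - (a == b)%:R * (a`!%:R * variance_sum d c ^+ a)| <= eps.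
Proof.
move=> eps0; pose D := ((a + b) * d)%N.
have np1 := near_pairing mu_ratio d c a b eps0.
have np2 := near_pairing mu_ratio d c b a eps0.
have nm := near_moments mu_ratio D ltr01.
near=> n.
have n0 : (0 < n)%N by near: n; exact: nbhs_infty_gt.
have [fin pos _] : [/\ (moment (mu n) (2 * (n + D)) < +oo)%E,
      forall k, (k <= n)%N -> 0 < rmoment (mu n) (2 * k) &
      forall j, (n <= j + D)%N -> (j <= n + D)%N ->
        `|rmoment (mu n) (2 * j) / rmoment (mu n) (2 * n) - 1| <= 1].
  by near: n; exact: nm.
have [_ [K [KK ZK]]] := Z_SPP n0.
have aD : (a * d <= D)%N by rewrite /D leq_mul2r leq_addr orbT.
have bD : (b * d <= D)%N by rewrite /D leq_mul2r leq_addl orbT.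
have pos' k : (k < n)%N -> 0 < rmoment (mu n) (2 * k) by move=> kn; exact: pos (ltnW kn).
exists ((complex.Re (pairing (mu n) n d c a b) + complex.Re (pairing (mu n) n d c b a)) / 2).
  exact: (has_int_powersum c (mu_rot n0) fin pos' KK ZK aD bD).
set v := (a == b)%:R * _.
have h1 : `|complex.Re (pairing (mu n) n d c a b) - v| <= eps.
  by rewrite /v /variance_sum; near: n; exact: np1.
have h2 : `|complex.Re (pairing (mu n) n d c b a) - v| <= eps.
  have -> : v = (b == a)%:R * (b`!%:R * variance_sum d c ^+ b).
    by rewrite /v eq_sym; case: eqP => [->|]; rewrite ?mul0r.
  by rewrite /variance_sum; near: n; exact: np2.
move: h1 h2; rewrite !ler_norml; lra.
Unshelve. all: by end_near.
Qed.

Lemma Re_expn (z : R[i]) k : complex.Re z ^+ k =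
  2 ^- k * \sum_(i < k.+1) 'C(k, i)%:R * complex.Re (z ^+ (k - i) * (z ^+ i)^*%C).
Proof.
have h : (z + z^*%C) ^+ k = (2 ^+ k * complex.Re z ^+ k)%:C.
  have -> : z + z^*%C = (2 * complex.Re z)%:C.
    by case: z => x y; apply/eqP; rewrite eq_complex /= subrr eqxx andbT; apply/eqP; ring.
  by rewrite -realCX exprMn.
have -> : complex.Re z ^+ k = 2 ^- k * complex.Re ((z + z^*%C) ^+ k).
  by rewrite h /= mulKf // expf_neq0 // pnatr_eq0.
rewrite [(z + _) ^+ k]exprDn Re_sum; congr (_ * _); apply: eq_bigr => i _.
by rewrite conjcX -Re_realM realC_nat mulr_natl.
Qed.

(** The real part of a complex Gaussian of variance s2 has variance s2/2. In the binomial expansion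
    only the balanced term i = k/2 survives. *)
Lemma gaussian_momentE (s2 tau : R) k : tau ^+ 2 = s2 / 2 ->
  gaussian_moment tau k = 2 ^- k *
    \sum_(i < k.+1) 'C(k, i)%:R * ((k - i == i)%N%:R * ((k - i)`!%:R * s2 ^+ (k - i))).
Proof.
move=> tau2; rewrite /gaussian_moment /normal_moment; case: ifPn => [ok|ek].
  rewrite mulr0 big1 ?mulr0 // => i _; case: eqP => [h|_]; last by rewrite mul0r mulr0.
  by move: ok; have := ltn_ord i; lia.
have kE : k = (k./2 + k./2)%N by have := odd_double_half k; lia.
have jk : (k./2 < k.+1)%N by lia.
rewrite (bigD1 (Ordinal jk)) //= big1 ?addr0 => [|i ij]; last first.
  have -> : (k - i == i)%N = false; last by rewrite mul0r mulr0.
  apply/eqP => h; move/eqP: ij; apply; apply: val_inj => /=; have := ltn_ord i; lia.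
have -> : (k - k./2)%N = k./2 by lia.
rewrite eqxx mul1r.
move: kE; move: (k./2) => j ->; rewrite {jk ek}.
have E : ('C(j + j, j) * j`! * j`! = (j + j)`!)%N.
  by have := @bin_fact (j + j) j (leq_addr j j); rewrite addnK mulnA.
have jf : j`!%:R != 0 :> R by rewrite pnatr_eq0 -lt0n fact_gt0.
have p2 : 2 ^+ j != 0 :> R by rewrite expf_neq0 // pnatr_eq0.
have -> : tau ^+ (j + j) = s2 ^+ j / 2 ^+ j by rewrite addnn -mul2n exprM tau2 exprMn exprVn.
rewrite -E !natrM exprD; move: (2 ^+ j : R) p2 (j`!%:R : R) jf => x x0 y y0.
by field; rewrite x0 y0.
Qed.

Lemma near_Re_moment d c tau k (eps : R) : tau ^+ 2 = variance_sum d c / 2 -> 0 < eps ->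
  \forall n \near \oo, exists2 v,
  has_int (P n) (fun w => complex.Re (@linstat d c n w) ^+ k) v &
  `|v - gaussian_moment tau k| <= eps.
Proof.
move=> tau2 eps0.
have near1 : \forall n \near \oo, forall i : 'I_k.+1, exists2 v,
  has_int (P n) (fun w => complex.Re (@linstat d c n w ^+ (k - i) * (@linstat d c n w ^+ i)^*%C)) v &
  `|v - (k - i == i)%N%:R * ((k - i)`!%:R * variance_sum d c ^+ (k - i))| <= eps.
  by apply: filter_forall => i; exact: near_mixed_moment.
apply: filterS near1 => n hn.
pose v (i : 'I_k.+1) := \int[P n]_w complex.Re (@linstat d c n w ^+ (k - i) * (@linstat d c n w ^+ i)^*%C).
have hv (i : 'I_k.+1) : has_int (P n) (fun w => complex.Re (@linstat d c n w ^+ (k - i) * (@linstat d c n w ^+ i)^*%C)) (v i) /\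
  `|v i - (k - i == i)%N%:R * ((k - i)`!%:R * variance_sum d c ^+ (k - i))| <= eps.
  by have [u hu1 hu2] := hn i; rewrite /v (has_int_Rintegral hu1).
exists (2 ^- k * \sum_(i < k.+1) 'C(k, i)%:R * v i).
  apply: eq_has_int (has_intZ (2 ^- k) (has_int_sum (index_enum 'I_k.+1) (P := xpredT)
    (fun (i : 'I_k.+1) _ => has_intZ 'C(k, i)%:R (hv i).1))) => w.
  by rewrite Re_expn.
rewrite (gaussian_momentE _ tau2) -mulrBr -sumrB normrM.
have p2 : 0 < 2 ^+ k :> R by rewrite exprn_gt0.
rewrite ger0_norm ?invr_ge0 ?(ltW p2) // mulrC ler_pdivrMr //.
apply: le_trans (ler_norm_sum _ _ _) _.
apply: le_trans (_ : \sum_(i < k.+1) 'C(k, i)%:R * eps <= _).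
  apply: ler_sum => i _; rewrite -mulrBr normrM ger0_norm ?ler0n // ler_wpM2l //.
  by have [] := hv i.
rewrite -mulr_suml mulrC ler_pM2l // -natr_sum.
have -> : (\sum_(i < k.+1) 'C(k, i) = 2 ^ k)%N.
  by rewrite -[2%N]/(1 + 1)%N expnDn; apply: eq_bigr => i _; rewrite !exp1n !muln1.
by rewrite natrX.
Qed.

Lemma variance_sumZ d c (a : R[i]) :
  variance_sum d (fun k => a * c k) = cmod a ^+ 2 * variance_sum d c.
Proof.
by rewrite /variance_sum mulr_sumr; apply: eq_bigr => k _; rewrite cmodM exprMn mulrCA.
Qed.

Lemma linstatZ d c (a : R[i]) n w : @linstat d (fun k => a * c k) n w = a * @linstat d c n w.
Proof.
rewrite /linstat /powersum mulr_sumr; apply: eq_bigr => i _.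
by rewrite mulr_sumr; apply: eq_bigr => k _; rewrite mulrA.
Qed.

(** s Re X + t Im X is the real part of (s - it) X, again a linear statistic, with variance
    multiplied by s^2 + t^2; one-dimensional moments thus suffice. *)
Lemma near_cos d c (s t theta : R) (eps : R) : 0 < eps -> \forall n \near \oo, exists2 v,
  has_int (P n) (fun w => cos (theta + (s * complex.Re (@linstat d c n w) +
    t * complex.Im (@linstat d c n w)))) v &
  `|v - cos theta * expR (- ((s ^+ 2 + t ^+ 2) * (variance_sum d c / 4)))| <= eps.
Proof.
move=> eps0; pose c' k := (s -i* t) * c k.
have v0 := variance_sum_ge0 d c'.
pose tau := Num.sqrt (variance_sum d c' / 2).
have tau2 : tau ^+ 2 = variance_sum d c' / 2 by rewrite sqr_sqrtr // divr_ge0.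
have mY n : measurable_fun setT (fun w => complex.Re (@linstat d c' n w)).
  by have [] := cmeasurable_linstat d c' n.
have := cvg_cos_expectation theta mY (fun k e e0 => @near_Re_moment d c' tau k e tau2 e0) eps0.
apply: filterS => n h.
have E (w : T n) : complex.Re (@linstat d c' n w) =
    s * complex.Re (@linstat d c n w) + t * complex.Im (@linstat d c n w).
  by rewrite linstatZ ReM /= mulNr opprK.
exists (\int[P n]_w cos (theta + complex.Re (@linstat d c' n w))).
  apply: eq_has_int (has_int_dom (f := fun w => cos (theta + complex.Re (@linstat d c' n w))) _ (has_int_cst (P n) 1) _) => [w||w].
  - by rewrite E.
  - apply: measurableT_comp; last exact: measurable_funD.
    by apply: continuous_measurable_fun; exact: continuous_cos.
  - by rewrite ler_norml cos_geN1 cos_le1.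
move: h; rewrite tau2 variance_sumZ cmod_sqr /= sqrrN.
by congr (is_true (`|_ - _ * expR (- _)| <= _)); field.
Qed.

End LinearStatistic.

(** * Expectations under the complex Gaussian *)

Section GaussianIntegrals.
Context (R : realType).
Local Notation N2 := (@std_normal R \x @std_normal R)%E.

Lemma measurable_cos_linear d (T : measurableType d) (X Y : T -> R) (s t theta : R) :
  measurable_fun setT X -> measurable_fun setT Y ->
  measurable_fun setT (fun z => cos (theta + (s * X z + t * Y z))).
Proof.
move=> mX mY; apply: measurableT_comp.
  by apply: continuous_measurable_fun; exact: continuous_cos.
by apply: measurable_funD => //; apply: measurable_funD; apply: measurable_funM.
Qed.

Lemma std_normal2_cos (s t theta : R) :
  has_int N2 (fun z => cos (theta + (s * z.1 + t * z.2)))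
    (cos theta * expR (- ((s ^+ 2 + t ^+ 2) / 2))).
Proof.
have mf : measurable_fun setT (fun z : plane R => cos (theta + (s * z.1 + t * z.2))).
  by apply: measurable_cos_linear.
have [hi _] : has_int N2 (fun z : plane R => cos (theta + (s * z.1 + t * z.2)))
    (\int[N2]_z cos (theta + (s * z.1 + t * z.2))).
  apply: has_int_dom mf (has_int_cst N2 1) _ => z.
  by rewrite ler_norml cos_geN1 cos_le1.
split=> //; rewrite -(integral12_prod_meas1 hi).
have [_ <-] : has_int (std_normal R)
    (fun x => expR (- (t ^+ 2 / 2)) * cos (theta + s * x))
    (cos theta * expR (- ((s ^+ 2 + t ^+ 2) / 2))).
  have := has_intZ (expR (- (t ^+ 2 / 2))) (std_normal_cos theta s).
  by rewrite mulrCA -expRD mulrDl opprD addrC.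
apply: eq_integral => x _; rewrite /fubini_F /=.
have [_ h] := std_normal_cos (theta + s * x) t.
rewrite [expR _ * _]mulrC; apply: etrans h.
by apply: eq_integral => y _; rewrite addrA.
Qed.

Lemma std_normal2_norm : has_int N2 (fun z => z.1 ^+ 2 + z.2 ^+ 2) 2.
Proof.
have nm : normal_moment R 2 = 1.
  by rewrite /normal_moment /= !mulr1 divff.
have mf : measurable_fun setT (fun z : plane R => z.1 ^+ 2 + z.2 ^+ 2).
  by apply: measurable_funD; apply: measurable_funX; [exact: measurable_fst|exact: measurable_snd].
have f0 (z : plane R) : 0 <= z.1 ^+ 2 + z.2 ^+ 2 by rewrite addr_ge0 ?sqr_ge0.
apply: has_int_ge0 => //; rewrite fubini_tonelli1; last 2 first.
- exact/measurable_EFinP.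
- by move=> z; rewrite lee_fin.
have [_ <-] : has_int (std_normal R) (fun x => x ^+ 2 + 1) 2.
  have := has_intD (has_int_std_normal R 2) (has_int_cst (std_normal R) 1).
  by rewrite nm.
apply: eq_integral => x _; rewrite /fubini_F /=.
by have [_] := has_intD (has_int_cst (std_normal R) (x ^+ 2)) (has_int_std_normal R 2); rewrite nm.
Qed.

Lemma has_int_distribution d d' (T : measurableType d) (T' : measurableType d')
    (P : probability T R) (X : {RV P >-> T'}) (f : T' -> R) v :
  measurable_fun setT f -> has_int P (fun w => f (X w)) v -> has_int (distribution P X) f v.
Proof.
move=> mf [/integrableP[mfX fi] fv]; split.
  apply/integrableP; split; first exact/measurable_EFinP.
  rewrite ge0_integral_distribution //.
  by apply/measurable_EFinP; exact: measurableT_comp.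
rewrite integral_distribution //; first exact/measurable_EFinP.
exact/integrableP.
Qed.

Lemma measurable_trigpoly (T : R -> R -> R) : trigpoly T ->
  measurable_fun setT (fun z : plane R => T z.1 z.2).
Proof.
elim=> [a s t theta|f g _ IH1 _ IH2]; last exact: measurable_funD.
by apply: measurable_funM; [exact: measurable_cst|exact: measurable_cos_linear].
Qed.

(** Measurability for the product sigma-algebra follows because g is a pointwise limit of
    trigonometric polynomials. *)
Lemma measurable_continuous_plane (g : plane R -> R) M : continuous g ->
  (forall z, `|g z| <= M) -> measurable_fun setT g.
Proof.
move=> cg gM.
have /choice [T hT] : forall n : nat, exists T : R -> R -> R, trigpoly T /\
    forall x y, `|g (x, y) - T x y| <= n.+1%:R^-1 * (1 + (x ^+ 2 + y ^+ 2)).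
  move=> n; have n0 : 0 < n.+1%:R^-1 :> R by rewrite invr_gt0.
  by have [T tT TE] := trig_approximation_global cg gM n0; exists T.
apply: (@measurable_fun_cvg _ _ _ _ (fun n (z : plane R) => T n z.1 z.2)).
  by move=> n; apply: measurable_trigpoly; have [] := hT n.
move=> z _; apply/cvgrPdist_le => e e0.
pose B := 1 + (z.1 ^+ 2 + z.2 ^+ 2).
have hB : (harmonic n * B) @[n --> \oo] --> (0 : R).
  rewrite -[X in _ --> X](mul0r B); apply: cvgM; [exact: cvg_harmonic|exact: cvg_cst].
have /cvgr_dist_le /(_ e e0) := hB; apply: filterS => n.
rewrite sub0r normrN => h; have [_ /(_ z.1 z.2)] := hT n.
rewrite -surjective_pairing => /le_trans; apply.
by apply: le_trans h; rewrite ler_norm.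
Qed.

Variables (s2 : R).
Hypothesis s20 : 0 <= s2.

Lemma gaussian_cos (s t theta : R) :
  has_int (complex_gaussian s2) (fun z => cos (theta + (s * z.1 + t * z.2)))
    (cos theta * expR (- ((s ^+ 2 + t ^+ 2) * (s2 / 4)))).
Proof.
apply: has_int_distribution; first exact: measurable_cos_linear.
set a := Num.sqrt (s2 / 2).
have a2 : a ^+ 2 = s2 / 2 by rewrite sqr_sqrtr // divr_ge0.
have -> : (s ^+ 2 + t ^+ 2) * (s2 / 4) = ((s * a) ^+ 2 + (t * a) ^+ 2) / 2.
  by rewrite !exprMn a2; field.
apply: eq_has_int (std_normal2_cos (s * a) (t * a) theta) => z.
by rewrite /scale_plane /= !mulrA.
Qed.

Lemma gaussian_norm : has_int (complex_gaussian s2) (fun z => z.1 ^+ 2 + z.2 ^+ 2) s2.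
Proof.
apply: has_int_distribution.
  by apply: measurable_funD; apply: measurable_funX; [exact: measurable_fst|exact: measurable_snd].
set a := Num.sqrt (s2 / 2).
have a2 : a ^+ 2 = s2 / 2 by rewrite sqr_sqrtr // divr_ge0.
have -> : s2 = a ^+ 2 * 2 by rewrite a2; field.
apply: eq_has_int (has_intZ (a ^+ 2) std_normal2_norm) => z.
by rewrite /scale_plane /= mulrDr !exprMn.
Qed.

End GaussianIntegrals.

Section Convergence.
Context (R : realType) (d0 : nat -> measure_display) (T : forall n, measurableType (d0 n))
  (P : forall n, probability (T n) R) (X : forall n, T n -> plane R).
Arguments X : clear implicits.
Variable (s2 : R).
Hypothesis s20 : 0 <= s2.
Hypothesis mX : forall n, measurable_fun setT (X n).
Hypothesis X_cos : forall (s t theta eps : R), 0 < eps -> \forall n \near \oo, exists2 v,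
  has_int (P n) (fun w => cos (theta + (s * (X n w).1 + t * (X n w).2))) v &
  `|v - cos theta * expR (- ((s ^+ 2 + t ^+ 2) * (s2 / 4)))| <= eps.
Hypothesis X_norm : \forall n \near \oo, exists2 v,
  has_int (P n) (fun w => (X n w).1 ^+ 2 + (X n w).2 ^+ 2) v & v <= s2 + 1.

Lemma near_trigpoly (f : R -> R -> R) : trigpoly f -> exists2 v,
  has_int (complex_gaussian s2) (fun z => f z.1 z.2) v &
  forall eps, 0 < eps -> \forall n \near \oo, exists2 u,
    has_int (P n) (fun w => f (X n w).1 (X n w).2) u & `|u - v| <= eps.
Proof.
elim=> [a s t theta|f1 f2 _ [v1 h1 H1] _ [v2 h2 H2]].
  exists (a * (cos theta * expR (- ((s ^+ 2 + t ^+ 2) * (s2 / 4))))).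
    exact: has_intZ (gaussian_cos s20 s t theta).
  move=> eps eps0; have e1 : 0 < eps / (`|a| + 1) by rewrite divr_gt0 // ltr_wpDl.
  have := X_cos s t theta e1; apply: filterS => n [u hu1 hu2].
  exists (a * u); first exact: has_intZ.
  rewrite -mulrBr normrM; apply: le_trans (ler_wpM2l _ hu2) _ => //.
  by rewrite mulrCA ler_piMr ?(ltW eps0) // ler_pdivrMr ?mul1r ?lerDl // ltr_wpDl.
exists (v1 + v2); first exact: has_intD.
move=> eps eps0; have e2 : 0 < eps / 2 by rewrite divr_gt0.
apply: filterS2 (H1 _ e2) (H2 _ e2) => n [u1 a1 b1] [u2 a2 b2].
exists (u1 + u2); first exact: has_intD.
have -> : u1 + u2 - (v1 + v2) = (u1 - v1) + (u2 - v2) by ring.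
by apply: le_trans (ler_normD _ _) _; lra.
Qed.

Lemma cvg_distribution : converges_in_distribution P X (complex_gaussian s2).
Proof.
move=> g cg [M gM]; have mg := measurable_continuous_plane cg gM.
have M0 : 0 <= M := le_trans (normr_ge0 _) (gM (0, 0)).
have hn n : has_int (P n) (fun w => g (X n w)) (\int[P n]_w g (X n w)).
  apply: has_int_dom (has_int_cst (P n) M) _ => [|w]; last exact: gM.
  exact: measurableT_comp.
have hG : has_int (complex_gaussian s2) g (\int[complex_gaussian s2]_z g z).
  by apply: has_int_dom (has_int_cst (complex_gaussian s2) M) _ => // z; exact: gM.
have -> : (\int[complex_gaussian s2]_z (g z)%:E)%E = (\int[complex_gaussian s2]_z g z)%:E.
  by case: hG.
have -> : (fun n => 'E_(P n)[fun w => g (X n w)])%E = fun n => (\int[P n]_w g (X n w))%:E.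
  by apply/funext => n; rewrite unlock; case: (hn n).
apply: cvg_EFin; first exact: nearW.
apply/cvgrPdist_le => eps eps0.
(* Approximation costs eta (2 + s2) under the law of X and eta (1 + s2) under the Gaussian, eps/2 in
   total. *)
pose eta := eps / (2 * (3 + 2 * s2)).
have B0 : 0 < 2 * (3 + 2 * s2) by move: s20; lra.
have eta0 : 0 < eta by rewrite divr_gt0.
have [f tf fE] := trig_approximation_global cg gM eta0.
have [v hv Hv] := near_trigpoly tf.
have e2 : 0 < eps / 2 by rewrite divr_gt0.
apply: filterS2 X_norm (Hv _ e2) => n [q hq q1] [u hu uv].
have dist (d : measure_display) (T' : measurableType d) (Q : probability T' R)
    (Y : T' -> plane R) (a b r : R) : has_int Q (fun w => g (Y w)) a ->
    has_int Q (fun w => f (Y w).1 (Y w).2) b ->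
    has_int Q (fun w => (Y w).1 ^+ 2 + (Y w).2 ^+ 2) r -> `|a - b| <= eta * (1 + r).
  move=> ha hb hr; have hd := has_intB ha hb.
  have he := has_intZ eta (has_intD (has_int_cst Q 1) hr).
  have le w := fE (Y w).1 (Y w).2.
  rewrite ler_norml; apply/andP; split.
    apply: has_int_le (has_intN he) hd _ => w.
    by have := le w; rewrite -surjective_pairing ler_norml => /andP[].
  apply: has_int_le hd he _ => w.
  by have := le w; rewrite -surjective_pairing ler_norml => /andP[].
have d1 := dist _ _ _ _ _ _ _ (hn n) hu hq.
have d2 := dist _ _ _ (fun z => z) _ _ _ hG hv (gaussian_norm s20).
set a := \int[P n]_w _ in d1 *; set b := \int[complex_gaussian s2]_z _ in d2 *.
have d1' : `|a - u| <= eta * (2 + s2).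
  by apply: le_trans d1 _; rewrite ler_wpM2l ?(ltW eta0) //; lra.
have -> : b - a = (b - v) - (u - v) - (a - u) by ring.
apply: le_trans (ler_normB _ _) _; apply: le_trans (lerD (ler_normB _ _) (lexx _)) _.
have : eta * (3 + 2 * s2) = eps / 2 by rewrite /eta; field; move: B0; lra.
by lra.
Qed.

End Convergence.

(** The constant term is set apart because centering removes it. *)
Lemma horner_coef0D (F : comNzRingType) (f : {poly F}) z :
  f.[z] = f`_0 + \sum_(k < (size f).-1) f`_k.+1 * z ^+ k.+1.
Proof.
rewrite horner_coef; case sf: (size f) => [|n] /=; last first.
  by rewrite big_ord_recl expr0 mulr1.
by rewrite !big_ord0 addr0 nth_default ?sf.
Qed.

(** The coefficient (k+1) c_k of the derivative contributes (k+1)^2 |c_k|^2 / (k+1). *)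
Lemma variance_sumE (R : realType) (f : {poly R[i]}) :
  pi^-1 * disc_norm2 (fun z => f^`().[z]) = variance_sum (size f).-1 (fun k => f`_k.+1).
Proof.
have sd : (size f^`() <= (size f).-1)%N by rewrite size_poly.
rewrite disc_norm2_poly /variance_sum.
rewrite (big_ord_widen _ (fun k => cmod f^`()`_k ^+ 2 / k.+1%:R) sd) big_mkcond /=.
apply: eq_bigr => k _; case: ltnP => sk.
  rewrite coef_deriv -[f`_k.+1 *+ k.+1]mulr_natr -(realC_nat R) cmodM exprMn.
  have -> : cmod (k.+1%:R%:C : R[i]) ^+ 2 = k.+1%:R ^+ 2.
    by rewrite cmod_sqr /= expr0n addr0.
  by rewrite [k.+1%:R ^+ 2]expr2 mulrA mulfK ?pnatr_eq0 // mulrC.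
have := nth_default 0 sk; rewrite coef_deriv => /eqP; rewrite -[f`_k.+1 *+ k.+1]mulr_natr mulf_eq0.
rewrite pnatr_eq0 orbF => /eqP ->.
by rewrite cmod_sqr /= expr0n addr0 mulr0.
Qed.

Section CenteredSum.
Context (R : realType) (mu : nat -> probability (plane R) R)
  (d0 : nat -> measure_display) (T : forall n, measurableType (d0 n))
  (P : forall n, probability (T n) R)
  (Z : forall n, 'I_n -> {RV (P n) >-> plane R}).
Hypothesis mu_rot : forall n, (0 < n)%N -> rotation_invariant (mu n).
Hypothesis Z_SPP : forall n, (0 < n)%N -> is_SPP (mu n) (@Z n).
Hypothesis mu_ratio : forall m : int,
  moment_ratio (mu n) n m @[n --> \oo] --> (1 : R).
Variable f : {poly R[i]}.

Definition centered_sum n (w : T n) : R[i] :=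
  \sum_(k < n) (f.[toC (@Z n k w)] - cint (P n) (fun v => f.[toC (@Z n k v)])).

Lemma cmeasurable_centered_sum n : cmeasurable (@centered_sum n).
Proof.
apply: cmeasurable_sum => i; apply: cmeasurableD; last exact: cmeasurable_cst.
by apply: cmeasurable_poly; exact: cmeasurable_toC.
Qed.

(** The nonconstant part has mean 0, so the expectations add up to n times the constant coefficient.
    This needs finite moments, available for large n. *)
Lemma near_centered_sum : \forall n \near \oo, forall w,
  @centered_sum n w = @linstat R d0 T P Z (size f).-1 (fun k => f`_k.+1) n w.
Proof.
have nm := near_moments mu_ratio (size f) ltr01.
near=> n.
have n0 : (0 < n)%N by near: n; exact: nbhs_infty_gt.
have [fin pos _] : [/\ (moment (mu n) (2 * (n + size f)) < +oo)%E,
      forall k, (k <= n)%N -> 0 < rmoment (mu n) (2 * k) &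
      forall j, (n <= j + size f)%N -> (j <= n + size f)%N ->
        `|rmoment (mu n) (2 * j) / rmoment (mu n) (2 * n) - 1| <= 1].
  by near: n; exact: nm.
have [_ [K [KK ZK]]] := Z_SPP n0.
have pos' k : (k < n)%N -> 0 < rmoment (mu n) (2 * k) by move=> kn; exact: pos (ltnW kn).
have sumE w : \sum_(i < n) f.[toC (@Z n i w)] =
    n%:R * f`_0 + @linstat R d0 T P Z (size f).-1 (fun k => f`_k.+1) n w.
  under eq_bigr => i _ do rewrite horner_coef0D.
  by rewrite big_split /= sumr_const card_ord mulr_natl.
have h1 := has_cint_sum (index_enum 'I_n) (fun i : 'I_n =>
  integrable_poly (mu_rot n0) fin pos' KK ZK i (leqnSn (size f))).
have hl := has_cint_powersum (mu_rot n0) fin pos' KK ZK (fun k => f`_k.+1) (leq_pred (size f)).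
have hc : has_cint (P n) (fun=> n%:R * f`_0) (n%:R * f`_0) by split; exact: has_int_cst.
have cE := has_cintE h1.
rewrite (has_cintE (eq_has_cint (fun w => esym (sumE w)) (has_cintD hc hl))) addr0 in cE.
by move=> w; rewrite /centered_sum sumrB sumE -cE addrAC subrr add0r.
Unshelve. all: by end_near.
Qed.

End CenteredSum.

Theorem theorem3 (R : realType) (mu : nat -> probability (plane R) R)
  (d : nat -> measure_display) (T : forall n, measurableType (d n))
  (P : forall n, probability (T n) R)
  (Z : forall n, 'I_n -> {RV (P n) >-> plane R})
  (mu_rot : forall n, (0 < n)%N -> rotation_invariant (mu n))
  (Z_SPP : forall n, (0 < n)%N -> is_SPP (mu n) (Z n))
  (mu_ratio : forall m : int,
     moment_ratio (mu n) n m @[n --> \oo] --> (1 : R))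
  (f : {poly R[i]}) :
  converges_in_distribution P
    (fun n w => ofC (\sum_(k < n) (f.[toC (Z n k w)] -
                                   cint (P n) (fun v => f.[toC (Z n k v)]))))
    (complex_gaussian (pi^-1 * disc_norm2 (fun z => f^`().[z]))).
Proof.
rewrite variance_sumE; set c := fun k => f`_k.+1.
have near_eq := near_centered_sum mu_rot Z_SPP mu_ratio f.
apply: (cvg_distribution (X := fun n w => ofC (@centered_sum R d T P Z f n w))).
- exact: variance_sum_ge0.
- by move=> n; apply: measurable_ofC; exact: cmeasurable_centered_sum.
- move=> s t theta eps eps0.
  have h := near_cos mu_rot Z_SPP mu_ratio (size f).-1 c s t theta eps0.
  apply: filterS2 near_eq h => n E [v hv ev]; exists v => //.
  by apply: eq_has_int hv => w; rewrite E.
(* The mixed moment with a = b = 1 is the second moment of the modulus, eventually within 1 of its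
   limit. *)
- have h := near_mixed_moment mu_rot Z_SPP mu_ratio (size f).-1 c 1 1 ltr01.
  apply: filterS2 near_eq h => n E [v hv ev]; exists v.
    by apply: eq_has_int hv => w; rewrite E !expr1 -cmod2_conj /= cmod_sqr.
  by move: ev; rewrite eqxx !mul1r expr1 => /ler_normlW; rewrite lerBlDl.
Qed.
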